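(* We have $\kappa_{nl}(\mathbb{R}^2)=\sqrt2$. In particular, for every $u\in W^{1,2}_{loc}(\mathbb{R}^2,\mathbb{R}^2)$ with $\mathrm{dist}(\nabla u,SO(2))\in L^2(\mathbb{R}^2)$ there holds $$\min_{R\in SO(2)}\|\nabla u-R\|_{L^2(\mathbb{R}^2)}\leq\sqrt2\,\|\mathrm{dist}(\nabla u,SO(2))\|_{L^2(\mathbb{R}^2)}.$$
   Context: $SO(2)$ is the group of proper rotations of $\mathbb{R}^2$, viewed in $\mathbb{R}^{2\times2}$. Matrices carry the Frobenius norm $|A|^2=\mathrm{tr}(A^TA)$, and $L^2$ norms of matrix fields as well as the distance $\mathrm{dist}(F,SO(2))=\min_{R\in SO(2)}|F-R|$ (applied pointwise to $\nabla u(x)$) use this norm. $\|\nabla u-R\|_{L^2(\mathbb{R}^2)}$ may equal $+\infty$ for some $R$. Define $$\kappa_{nl}(\mathbb{R}^2)=\sup\Bigg\{\min_{R\in SO(2)}\frac{\|\nabla u-R\|_{L^2(\mathbb{R}^2)}}{\|\mathrm{dist}(\nabla u,SO(2))\|_{L^2(\mathbb{R}^2)}};\ u\in W^{1,2}_{loc}(\mathbb{R}^2,\mathbb{R}^2),\ \mathrm{dist}(\nabla u,SO(2))\in L^2(\mathbb{R}^2)\setminus\{0\}\Bigg\}.$$ *)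

(* Defs.v *)
From mathcomp Require Import all_boot all_order all_algebra.
From mathcomp Require Import all_classical all_reals all_analysis.
From mathcomp Require Import ring lra.

Set Implicit Arguments.
Unset Strict Implicit.
Unset Printing Implicit Defensive.

Import Order.TTheory GRing.Theory Num.Theory.
Import numFieldNormedType.Exports.

Local Open Scope classical_set_scope.
Local Open Scope ring_scope.

Definition is_minimum (d : Order.disp_t) (T : porderType d) (A : set T) (m : T) :=
  A m /\ lbound A m.

Section matrices.
Context {R : realType}.
Implicit Types A F : 'M[R]_2.

Definition SO2 : set 'M[R]_2 := [set A | A^T *m A = 1%:M /\ \det A = 1].

(* The library norm on matrices is the sup norm, hence this definition. *)
Definition frob A : R := Num.sqrt (\tr (A^T *m A)).

(* The infimum is attained, see distSO2_minimum. *)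
Definition distSO2 F : R := inf [set frob (F - A) | A in SO2].

Let frobE A :
  \tr (A^T *m A) = A 0 0 ^+ 2 + A 0 1 ^+ 2 + A 1 0 ^+ 2 + A 1 1 ^+ 2.
Proof.
rewrite /mxtrace !big_ord_recl !big_ord0 !mxE !big_ord_recl !big_ord0 !mxE.
have -> : lift ord0 ord0 = 1 :> 'I_2 by apply/val_inj.
have -> : (ord0 : 'I_2) = 0 by apply/val_inj.
by ring.
Qed.

Let det22 A : \det A = A 0 0 * A 1 1 - A 0 1 * A 1 0.
Proof.
rewrite (expand_det_row _ 0) !big_ord_recl big_ord0 /cofactor !det_mx11 !mxE /=.
have -> : lift ord0 ord0 = 1 :> 'I_2 by apply/val_inj.
have -> : lift 1 0 = 0 :> 'I_2 by apply/val_inj.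
have -> : (ord0 : 'I_2) = 0 by apply/val_inj.
by rewrite expr0 (_ : bump 0 0 = 1%N) // expr1; ring.
Qed.

Let rot (c s : R) : 'M[R]_2 := \matrix_(i, j)
  (if i == 0 then if j == 0 then c else - s else if j == 0 then s else c).

Let SO2_rot A : SO2 A ->
  [/\ A 1 1 = A 0 0, A 0 1 = - A 1 0 & A 0 0 ^+ 2 + A 1 0 ^+ 2 = 1].
Proof.
move=> [/matrixP H]; rewrite det22 => D.
have := H 0 0; have := H 0 1; have := H 1 1.
rewrite !mxE !big_ord_recl !big_ord0 !mxE.
have -> : lift ord0 ord0 = 1 :> 'I_2 by apply/val_inj.
have -> : (ord0 : 'I_2) = 0 by apply/val_inj.
rewrite /= !addr0 => h11 h01 h00.
set a := A 0 0 in D h11 h01 h00 *; set b := A 0 1 in D h11 h01 h00 *.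
set c := A 1 0 in D h11 h01 h00 *; set e := A 1 1 in D h11 h01 h00 *.
have hs : (e - a) ^+ 2 + (b + c) ^+ 2 = 0.
  have -> : (e - a) ^+ 2 + (b + c) ^+ 2 =
    (b * b + e * e) + (a * a + c * c) - 2 * (a * e - b * c) by ring.
  by rewrite h11 h00 D; ring.
move/eqP: hs; rewrite paddr_eq0 ?sqr_ge0// !sqrf_eq0 subr_eq0 addr_eq0.
by move=> /andP[/eqP -> /eqP ->]; split=> //; rewrite !expr2.
Qed.

Let rot_SO2 c s : c ^+ 2 + s ^+ 2 = 1 -> SO2 (rot c s).
Proof.
move=> h; split; last by rewrite det22 !mxE /= -h; ring.
apply/matrixP => i j; rewrite !mxE !big_ord_recl !big_ord0 !mxE /=.
by case: i => -[|[|//]] ?; case: j => -[|[|//]] ?; rewrite /= -?h; ring.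
Qed.

Lemma distSO2_minimum F : is_minimum [set frob (F - A) | A in SO2] (distSO2 F).
Proof.
suff [m [Sm mS]] : exists m, is_minimum [set frob (F - A) | A in SO2] m.
  suff -> : distSO2 F = m by [].
  apply/eqP; rewrite eq_le; apply/andP; split.
    by apply: ge_inf => //; exists m.
  by apply: lb_le_inf => //; exists m.
pose a := F 0 0 + F 1 1; pose b := F 1 0 - F 0 1.
pose r := Num.sqrt (a ^+ 2 + b ^+ 2).
have r2 : r ^+ 2 = a ^+ 2 + b ^+ 2 by rewrite sqr_sqrtr// addr_ge0 ?sqr_ge0.
have r0 : 0 <= r by exact: sqrtr_ge0.
have [c [s [cs E]]] : exists c s, c ^+ 2 + s ^+ 2 = 1 /\ a * c + b * s = r.
  have [rz|rz] := eqVneq r 0.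
    exists 1, 0; split; first by ring.
    move/eqP: r2; rewrite rz expr0n/= eq_sym paddr_eq0 ?sqr_ge0// !sqrf_eq0.
    by move=> /andP[/eqP -> /eqP ->]; ring.
  exists (a / r), (b / r); split.
    by rewrite !expr_div_n -mulrDl -r2 divff// sqrf_eq0.
  by rewrite !mulrA -mulrDl -!expr2 -r2 expr2 mulfK.
exists (frob (F - rot c s)); split; first by exists (rot c s) => //; exact: rot_SO2.
move=> _ [A /SO2_rot[h1 h2 h3] <-]; rewrite /frob ler_sqrt; last first.
  by rewrite frobE !addr_ge0 ?sqr_ge0.
rewrite !frobE !mxE /= h1 h2.
have CS : a * A 0 0 + b * A 1 0 <= r.
  apply: le_trans (ler_norm _) _; rewrite -(ler_pXn2r (n := 2)) ?nnegrE//.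
  rewrite real_normK ?num_real// r2 -[leRHS]mulr1 -h3 -subr_ge0.
  have -> : (a ^+ 2 + b ^+ 2) * (A 0 0 ^+ 2 + A 1 0 ^+ 2) -
    (a * A 0 0 + b * A 1 0) ^+ 2 = (a * A 1 0 - b * A 0 0) ^+ 2 by ring.
  exact: sqr_ge0.
rewrite /a /b in CS E; nra.
Qed.

End matrices.

Section plane.
Context {R : realType}.

(* The Borel plane, and the Lebesgue measure on it.  Every Lebesgue-measurable
   function is almost everywhere equal to a Borel one, so working with Borel
   representatives loses no element of L^2 or of W^{1,2}_loc. *)
Definition plane := (measurableTypeR R * measurableTypeR R)%type.

Definition leb2 : {measure set plane -> \bar R} :=
  (@lebesgue_measure R \x @lebesgue_measure R)%E.

Definition e_ (j : 'I_2) : R * R := if j == 0 then (1, 0) else (0, 1).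

Fixpoint Ck (k : nat) (phi : R * R -> R) : Prop :=
  continuous phi /\
  if k is k'.+1 then forall j,
    (forall x, derivable phi x (e_ j)) /\ Ck k' (fun x => 'D_(e_ j) phi x)
  else True.

Definition test_function (phi : R * R -> R) :=
  (forall k, Ck k phi) /\ compact (closure [set x | phi x != 0]).

Definition L2loc (f : plane -> R) :=
  measurable_fun setT f /\
  forall K : set (R * R), compact K ->
    leb2.-integrable K (fun x => (f x ^+ 2)%:E).

(* [W12loc u G] : u belongs to W^{1,2}_loc(R^2, R^2) and G is (a representative
   of) its weak gradient, with the convention (nabla u)_ij = d_j u_i. *)
Definition W12loc (u : plane -> 'cV[R]_2) (G : plane -> 'M[R]_2) :=
  [/\ forall i, L2loc (fun x => u x i 0),
      forall i j, L2loc (fun x => G x i j) &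
      forall i j phi, test_function phi ->
        \int[leb2]_x (u x i 0 * 'D_(e_ j) phi x) =
        - \int[leb2]_x (G x i j * phi x)].

Definition L2norm (f : plane -> R) : \bar R := Lnorm leb2 2%:E (EFin \o f).

Definition dist_norm (G : plane -> 'M[R]_2) : \bar R :=
  L2norm (fun x => distSO2 (G x)).

Definition rot_norm (G : plane -> 'M[R]_2) (Q : 'M[R]_2) : \bar R :=
  L2norm (fun x => frob (G x - Q)).

Definition distL2 (G : plane -> 'M[R]_2) :=
  (fun x => distSO2 (G x)) \in Lfun leb2 2%:E.

End plane.

Arguments plane : clear implicits.

(* The quotients live in \bar R since rot_norm may be +oo.  Their minimum over
   SO(2) always exists, so no admissible u is lost. *)
Definition kappa_nl (R : realType) : \bar R :=
  ereal_sup [set m | exists (u : plane R -> 'cV[R]_2) (G : plane R -> 'M[R]_2),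
    [/\ W12loc u G, distL2 G,
        ~ {ae leb2, forall x, distSO2 (G x) = 0} &
        is_minimum [set (rot_norm G Q / dist_norm G)%E | Q in SO2] m]].

(* Main.v *)
(* With p = f_z and q = f_zbar the complex derivatives of u, a rotation c and
   the distance to SO(2) satisfy |grad u - c|^2 = 2 (|p - c|^2 + |q|^2) and
   dist^2 = 2 ((|p| - 1)^2 + |q|^2), so the bound by sqrt 2 follows from
   int |p - c|^2 <= int |q|^2 for some constant c; |c| = 1 is then automatic, and
   every other rotation has infinite norm, because the plane has infinite area.
   Formally p - c is the Beurling transform of q, which is an isometry.  Singular
   integrals are avoided as follows.  The difference Z of two radial mollifiers at
   the scales 1/lam < 1/mu is the divergence of a compactly supported gradient
   field, whose trace-free gradient S has the same energy (and autocorrelation) as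
   Z, the determinant being a null Lagrangian.  Testing the curl-free rows of the
   weak gradient with this field gives p * Z = q * S.  Pairing with a test function
   theta and letting mu -> 0 (where p * zeta_mu tends to a constant c, since |p| - 1
   is in L^2 and the oscillation is controlled by q), then lam -> oo, yields
   <p - c, theta> <= (|q|^2 + |theta|^2) / 2, and theta = p - c, truncated, is optimal.
   For the converse rotate such a field by a right angle and add eps times it to the
   identity: then p = 1 + i eps Z / 2, so p - 1 and q have equal norms while |p| - 1
   is of order eps^2. *)
From HB Require Import structures.
Require Import Defs.
From mathcomp Require Import all_boot all_order all_algebra.
From mathcomp Require Import all_classical all_reals all_analysis.
From mathcomp Require Import measurable_realfun ring lra.

Import Order.TTheory GRing.Theory Num.Theory.
Import numFieldNormedType.Exports.

Local Open Scope classical_set_scope.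
Local Open Scope ring_scope.

(** * Smooth cutoffs and radial gradient fields *)

(** The relation between p and q determines p only up to an entire function; the averages at large
    scales replace Liouville's theorem in excluding non-constant ones. The truncated kernel has an
    energy of order lam^2 uniformly in mu, so Young's inequality makes the increments of p * zeta at
    a fixed point O(lam), and moving the centre costs O(mu). The limits in mu and lam therefore come
    with linear rates and reduce to [ler_small]. The constant in the energy identity must be exactly
    1: the truncation is the gradient of a smooth compactly supported field, for which the identity
    is integration by parts. Kernels are functions of two points: their symmetry and the
    autocorrelation identities take over the algebra of convolutions and the translation invariance
    of the measure. Removing the mollifier needs a modulus of continuity of the test functions,
    while truncations of p - c are merely bounded and measurable; Lipschitz functions bridge the
    two. *)

Section pointwise_derivatives.
Context {R : realType} {V : normedModType R}.
Implicit Types (f g : V -> R) (x v : V).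

Lemma is_derive_addf f g x v df dg : is_derive x v f df ->
  is_derive x v g dg -> is_derive x v (fun z => f z + g z) (df + dg).
Proof. by move=> hf hg; exact: is_deriveD. Qed.

Lemma is_derive_mulf f g x v df dg : is_derive x v f df ->
  is_derive x v g dg -> is_derive x v (fun z => f z * g z) (df * g x + f x * dg).
Proof.
move=> hf hg; apply: (is_derive_eq (@is_deriveM _ _ f g x v df dg hf hg)).
by rewrite /GRing.scale/= addrC; congr (_ + _); rewrite mulrC.
Qed.

Lemma is_derive_cstf (c : R) x v : is_derive x v (fun=> c) 0.
Proof. exact: is_derive_cst. Qed.

Lemma is_derive_invf f x v df : f x != 0 -> is_derive x v f df ->
  is_derive x v (fun z => (f z)^-1) (- df * (f x)^-1 ^+ 2).
Proof.
move=> f0 hf; apply: DeriveDef; first by apply: derivableV => //; case: hf.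
rewrite deriveV; [|by []|by case: hf].
by rewrite derive_val /GRing.scale/= mulrC mulNr mulrN -exprVn.
Qed.

Lemma is_derive_expf f x v df n : is_derive x v f df ->
  is_derive x v (fun z => f z ^+ n) (n%:R * f x ^+ n.-1 * df).
Proof.
move=> hf; have := @is_deriveX _ _ f n x v df hf.
by congr is_derive; apply/funext => z; rewrite exprfctE.
Qed.

Lemma is_derive_compf (g : R -> R) f x v df dg : is_derive x v f df ->
  is_derive (f x) 1 g dg -> is_derive x v (fun z => g (f z)) (dg * df).
Proof.
move=> [f1 f2] [g1 g2].
have e (h : V -> R) : 'D_v h x = 'D_1 (fun t : R => h (t *: v + x)) 0.
  rewrite /derive; set p := fun _ => _; set q := fun _ => _.
  suff -> : p = q by [].
  apply/funext => t; rewrite /p /q /= scale0r add0r addr0.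
  by rewrite (_ : t *: 1 = t)// /GRing.scale/= mulr1.
pose l := fun t : R => f (t *: v + x).
have l0 : l 0 = f x by rewrite /l scale0r add0r.
have dl : derivable l 0 1 by exact: (derivable1P f x v).1.
have dg0 : derivable g (l 0) 1 by rewrite l0.
apply: DeriveDef.
  apply/derivable1P/derivable1_diffP.
  by apply: (@differentiable_comp _ _ _ _ l g 0); apply/derivable1_diffP.
rewrite e -derive1E (_ : (fun t : R => _) = g \o l)//.
by rewrite derive1_comp// l0 !derive1E g2 -e f2.
Qed.

End pointwise_derivatives.

Section smooth.
Context {R : realType}.

(** Each derivative is supplied as a witness with [is_derive], so closure under algebraic operations
    is an induction on [k] that never rewrites ['D_v]. [E] is the set of directions of
    differentiation; [smooth2_Ck] returns to [Ck]. *)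
Fixpoint smooth (V : normedModType R) (E : set V) (k : nat) (phi : V -> R) : Prop :=
  continuous phi /\
  if k is k'.+1 then forall v, E v -> exists2 psi,
    (forall x, is_derive x v phi (psi x)) & smooth V E k' psi
  else True.

Section closure.
Context {V : normedModType R} {E : set V}.
Implicit Types (f g : V -> R).

Lemma smooth_cont k f : smooth V E k f -> continuous f.
Proof. by case: k => [|k] []. Qed.

Lemma smoothS k f : smooth V E k.+1 f -> smooth V E k f.
Proof.
elim: k f => [f [cf _]//|k IH f [cf H]]; split => // v Ev.
by have [psi d s] := H v Ev; exists psi => //; exact: IH.
Qed.

Lemma smooth_cst k c : smooth V E k (fun=> c).
Proof.
elim: k c => [c|k IH c]; split => //; try exact: cst_continuous.
by move=> v _; exists (fun=> 0) => [x|]; [exact: is_derive_cstf|exact: IH].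
Qed.

Lemma smoothD k f g : smooth V E k f -> smooth V E k g ->
  smooth V E k (fun x => f x + g x).
Proof.
elim: k f g => [f g [cf _] [cg _]|k IH f g [cf Hf] [cg Hg]]; split => //;
  try by move=> x; apply: continuousD; [exact: cf|exact: cg].
move=> v Ev; have [f' df sf] := Hf v Ev; have [g' dg sg] := Hg v Ev.
exists (fun x => f' x + g' x) => [x|]; last exact: IH.
exact: is_derive_addf.
Qed.

Lemma smoothM k f g : smooth V E k f -> smooth V E k g ->
  smooth V E k (fun x => f x * g x).
Proof.
elim: k f g => [f g [cf _] [cg _]|k IH f g sf sg]; split => //;
  try by move=> x; apply: continuousM; [exact: (smooth_cont _ _ sf)|exact: (smooth_cont _ _ sg)].
- by move=> x; apply: continuousM; [exact: cf|exact: cg].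
move=> v Ev; have [f' df sf'] := sf.2 v Ev; have [g' dg sg'] := sg.2 v Ev.
exists (fun x => f' x * g x + f x * g' x) => [x|]; first exact: is_derive_mulf.
by apply: smoothD; apply: IH => //; exact: smoothS.
Qed.

Lemma smoothZ k c f : smooth V E k f -> smooth V E k (fun x => c * f x).
Proof. by apply: smoothM; exact: smooth_cst. Qed.

Lemma smoothN k f : smooth V E k f -> smooth V E k (fun x => - f x).
Proof.
move=> /(smoothZ _ (-1)); congr smooth; apply/funext => x; exact: mulN1r.
Qed.

Lemma smoothB k f g : smooth V E k f -> smooth V E k g ->
  smooth V E k (fun x => f x - g x).
Proof. by move=> hf hg; apply: smoothD => //; exact: smoothN. Qed.

Lemma smooth_inv k f : (forall x, f x != 0) -> smooth V E k f ->
  smooth V E k (fun x => (f x)^-1).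
Proof.
move=> f0; elim: k => [[cf _]|k IH sf]; split => //;
  try by move=> x; apply: continuousV; [exact: f0|apply: (smooth_cont _ _ sf)].
- by move=> x; apply: continuousV; [exact: f0|exact: cf].
move=> v Ev; have [f' df sf'] := sf.2 v Ev.
exists (fun x => - f' x * (f x)^-1 ^+ 2) => [x|]; first exact: is_derive_invf.
have si := IH (smoothS _ _ sf).
apply: smoothM; first exact: smoothN.
exact: smoothM.
Qed.

End closure.

Definition smooth1 (f : R -> R) := forall k, smooth R^o [set 1] k f.

Lemma smooth_comp (V : normedModType R) (E : set V) k (g : R -> R) f :
  smooth R^o [set 1] k g -> smooth V E k f -> smooth V E k (fun x => g (f x)).
Proof.
elim: k g f => [g f [cg _] [cf _]|k IH g f sg sf]; split => //;
  try by move=> x; apply: continuous_comp; [exact: (smooth_cont _ _ sf)|exact: (smooth_cont _ _ sg)].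
- by move=> x; apply: continuous_comp; [exact: cf|exact: cg].
move=> v Ev; have [f' df sf'] := sf.2 v Ev; have [g' dg sg'] := sg.2 1 erefl.
exists (fun x => g' (f x) * f' x) => [x|]; first exact: is_derive_compf.
by apply: smoothM => //; apply: IH => //; exact: smoothS.
Qed.

Lemma smooth1_id : smooth1 id.
Proof.
case=> [|k]; split => //; try by move=> x; exact: cvg_id.
by move=> _ ->; exists (fun=> 1) => [x|]; [exact: is_derive_id|exact: smooth_cst].
Qed.

(** One witness must serve all orders [k]: uniqueness of derivatives identifies those that the
    different orders supply. *)
Lemma smooth1_deriv f : smooth1 f ->
  exists2 f' : R -> R, (forall x : R, is_derive x 1 f (f' x)) & smooth1 f'.
Proof.
move=> sf; have [f' df sf'] := (sf 1%N).2 1 erefl.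
exists f' => // k; have [f2 df2 sf2] := (sf k.+1).2 1 erefl.
suff -> : f' = f2 by [].
apply/funext => x; have := df x; have := df2 x => h1 h2.
by rewrite -(derive_val (is_derive := h1)) -(derive_val (is_derive := h2)).
Qed.

End smooth.

(** * The flat functions t^(-n) exp(-1/t) *)

Section flat.
Context {R : realType}.
Implicit Types (t : R).

(** The powers of 1/t make the family closed under differentiation up to linear combinations, which
    is what the induction of [smooth1_flat] needs. *)
Definition flat (n : nat) (t : R) : R :=
  if 0 < t then t^-1 ^+ n * expR (- t^-1) else 0.

Lemma flat_le0 n t : t <= 0 -> flat n t = 0.
Proof. by move=> t0; rewrite /flat ltNge t0. Qed.

Lemma flat_gt0 n t : 0 < t -> 0 < flat n t.
Proof. by move=> t0; rewrite /flat t0 mulr_gt0 ?expR_gt0// exprn_gt0// invr_gt0. Qed.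

Lemma flat_ge0 n t : 0 <= flat n t.
Proof. by have [/flat_gt0/ltW//|/flat_le0->] := ltP 0 t. Qed.

(** One term of the exponential series at u = 1/t suffices: exp u >= u^(n+2) / (n+2)!. A quadratic
    bound is enough for the derivative at 0 to vanish. *)
Lemma flat_quadratic n t : flat n t <= (n.+2)`!%:R * t ^+ 2.
Proof.
rewrite /flat; case: ifPn => [t0|_]; last by rewrite mulr_ge0 ?sqr_ge0.
have u0 : 0 < t^-1 by rewrite invr_gt0.
have H : t^-1 ^+ n.+2 / (n.+2)`!%:R <= expR t^-1.
  by apply: le_trans (@expR_ge1Dxn _ t^-1 n.+1 (ltW u0)); rewrite lerDr.
have N0 : 0 < (n.+2)`!%:R :> R by rewrite ltr0n fact_gt0.
rewrite expRN ler_pdivrMr ?expR_gt0//.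
rewrite -(ler_pM2l (_ : 0 < (n.+2)`!%:R * t ^+ 2)) in H; last first.
  by rewrite mulr_gt0// exprn_gt0.
apply: le_trans H; rewrite (exprS _ n.+1) (exprS _ n) [leRHS](_ : _ = t^-1 ^+ n)//.
by field; rewrite !gt_eqF.
Qed.

Lemma is_derive_flat n t :
  is_derive t 1 (flat n) (flat n.+2 t - n%:R * flat n.+1 t).
Proof.
have [t0|t0|->] := ltgtP t 0.
- rewrite !flat_le0 ?ltW// mulr0 subrr.
  have e : \near t, (fun=> 0) t = flat n t.
    by near=> s; rewrite flat_le0//; near: s; exact: lt_le_nbhsl.
  exact: near_eq_is_derive e (is_derive_cstf 0 t 1).
- have tn : t != 0 by rewrite gt_eqF.
  have e : \near t, (fun s => s^-1 ^+ n * expR (- s^-1)) t = flat n t.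
    by near=> s; rewrite /flat ifT//; near: s; exact: lt_nbhsr.
  apply: near_eq_is_derive e _.
  have di := is_derive_invf id _ _ _ tn (is_derive_id t 1).
  have dn : is_derive t 1 (fun s : R => - s^-1) (t^-1 ^+ 2).
    by apply: (is_derive_eq (is_deriveN _)); rewrite mulN1r opprK.
  have dx : is_derive t 1 (fun s : R => s^-1 ^+ n) (- (n%:R * t^-1 ^+ n.+1)).
    apply: (is_derive_eq (is_derive_expf _ _ _ _ n di)).
    case: (n) => [|p]; first by rewrite !mul0r oppr0.
    by rewrite mulN1r mulrN -mulrA -exprD addn2.
  have de := is_derive_compf expR _ _ _ _ _ dn (is_derive_expR _).
  apply: (is_derive_eq (is_derive_mulf _ _ _ _ _ _ dx de)).
  by rewrite /flat t0 !exprS; ring.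
- rewrite !flat_le0// mulr0 subrr.
  suff H : h^-1 *: ((flat n \o shift 0) (h *: 1) - flat n 0) @[h --> 0^'] --> (0:R).
    by apply: DeriveDef; [apply/cvg_ex; exists 0|apply/cvg_lim].
  set C : R := (n.+2)`!%:R.
  apply/cvgr0Pnorm_lt => e e0; near=> h.
  have h0 : h != 0 by near: h; exact: nbhs_dnbhs_neq.
  have hC : `|h| < e / (C + 1).
    by near: h; apply: dnbhs0_lt; rewrite divr_gt0// ltr_wpDl.
  rewrite /= [flat n 0]flat_le0// subr0 addr0 normrM normfV.
  rewrite (_ : h *: 1 = h); last by rewrite /GRing.scale/= mulr1.
  rewrite (ger0_norm (flat_ge0 _ _)).
  have h1 : 0 < `|h| by rewrite normr_gt0.
  rewrite mulrC ltr_pdivrMr//; apply: le_lt_trans (flat_quadratic _ _) _.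
  rewrite -real_normK ?num_real// expr2 mulrA ltr_pM2r//.
  apply: (@le_lt_trans _ _ ((C + 1) * `|h|)).
    by rewrite ler_wpM2r// lerDl.
  by rewrite mulrC -ltr_pdivlMr// ltr_wpDl.
Unshelve. all: by end_near. Qed.

Lemma smooth1_flat n : smooth1 (flat n).
Proof.
move=> k; elim: k n => [|k IH] n; split => //.
- by move=> x; apply/differentiable_continuous/derivable1_diffP; case: (is_derive_flat n x).
- by move=> x; apply/differentiable_continuous/derivable1_diffP; case: (is_derive_flat n x).
move=> _ ->; exists (fun t => flat n.+2 t - n%:R * flat n.+1 t).
  by move=> x; exact: is_derive_flat.
by apply: smoothB => //; apply: smoothZ.
Qed.

End flat.

Section cutoff.
Context {R : realType}.
Implicit Types (s t : R).

Let cden s : R := flat 0 (2 - s) + flat 0 (s - 1).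

Definition cutoff s : R := flat 0 (2 - s) / cden s.

(** Minus the derivative of [cutoff] in closed form, as [flat 0] has derivative [flat 2]. It is a
    bump on [1, 2], from which the mollifiers are built. *)
Definition cslope s : R :=
  (flat 2 (2 - s) * flat 0 (s - 1) + flat 0 (2 - s) * flat 2 (s - 1)) *
  (cden s)^-1 ^+ 2.

Let cden_gt0 s : 0 < cden s.
Proof.
rewrite /cden; have [s1|s1] := ltP 1 s.
  by rewrite ltr_wpDl ?flat_ge0// flat_gt0// subr_gt0.
by rewrite ltr_wpDr ?flat_ge0// flat_gt0//; lra.
Qed.

Let smooth1_affine (a b : R) : smooth1 (fun s => a * s + b).
Proof.
by move=> k; apply: smoothD; [apply: smoothZ; exact: smooth1_id|exact: smooth_cst].
Qed.

Lemma smooth1_comp (f g : R -> R) : smooth1 f -> smooth1 g -> smooth1 (fun s => f (g s)).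
Proof. by move=> sf sg k; apply: smooth_comp; [exact: sf|exact: sg]. Qed.

Let sl n : smooth1 (fun s => flat n (2 - s)).
Proof.
have := smooth1_comp _ _ (smooth1_flat n) (smooth1_affine (-1) 2).
by congr smooth1; apply/funext => s; rewrite mulN1r addrC.
Qed.

Let sr n : smooth1 (fun s => flat n (s - 1)).
Proof.
have := smooth1_comp _ _ (smooth1_flat n) (smooth1_affine 1 (- 1)).
by congr smooth1; apply/funext => s; rewrite mul1r.
Qed.

Let scden_inv : smooth1 (fun s => (cden s)^-1).
Proof.
move=> k; apply: smooth_inv => [s|]; first by rewrite gt_eqF.
by apply: smoothD; [exact: sl|exact: sr].
Qed.

Lemma smooth1_cutoff : smooth1 cutoff.
Proof. by move=> k; apply: smoothM; [exact: sl|exact: scden_inv]. Qed.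

Lemma smooth1_cslope : smooth1 cslope.
Proof.
move=> k; apply: smoothM; last by apply: smoothM; exact: scden_inv.
by apply: smoothD; apply: smoothM; do ?[exact: sl|exact: sr].
Qed.

Lemma cslope_ge0 s : 0 <= cslope s.
Proof. by rewrite mulr_ge0 ?sqr_ge0// addr_ge0// mulr_ge0// flat_ge0. Qed.

Lemma is_derive_cutoff s : is_derive s 1 cutoff (- cslope s).
Proof.
have l : is_derive s 1 (fun s => 2 - s) (-1).
  apply: (is_derive_eq (is_derive_addf _ _ _ _ _ _
    (is_derive_cstf 2 s 1) (is_deriveNid s 1))); exact: add0r.
have r : is_derive s 1 (fun s => s - 1) 1.
  apply: (is_derive_eq (is_derive_addf _ _ _ _ _ _
    (is_derive_id s 1) (is_derive_cstf (-1) s 1))); exact: addr0.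
have dl := is_derive_compf _ _ _ _ _ _ l (is_derive_flat 0 _).
have dr := is_derive_compf _ _ _ _ _ _ r (is_derive_flat 0 _).
have c0 : cden s != 0 by rewrite gt_eqF.
have di := is_derive_invf _ _ _ _ c0 (is_derive_addf _ _ _ _ _ _ dl dr).
apply: (is_derive_eq (is_derive_mulf _ _ _ _ _ _ dl di)).
rewrite /cslope /cden in c0 *; field; by rewrite c0.
Qed.

Lemma cutoff_eq1 s : s <= 1 -> cutoff s = 1.
Proof.
move=> s1; have := cden_gt0 s; rewrite /cutoff /cden.
by rewrite (@flat_le0 _ 0 (s - 1)) ?addr0 ?subr_le0// => h; rewrite divff// gt_eqF.
Qed.

Lemma cutoff_eq0 s : 2 <= s -> cutoff s = 0.
Proof. by move=> s2; rewrite /cutoff flat_le0 ?mul0r// subr_le0. Qed.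

Lemma cslope_eq0l s : s <= 1 -> cslope s = 0.
Proof.
by move=> s1; rewrite /cslope !(@flat_le0 _ _ (s - 1)) ?subr_le0// !mulr0 addr0 mul0r.
Qed.

Lemma cslope_eq0r s : 2 <= s -> cslope s = 0.
Proof.
by move=> s1; rewrite /cslope !(@flat_le0 _ _ (2 - s)) ?subr_le0// !mul0r addr0 mul0r.
Qed.

Lemma cslope_gt0 s : 1 < s -> s < 2 -> 0 < cslope s.
Proof.
move=> s1 s2; rewrite mulr_gt0 ?exprn_gt0 ?invr_gt0//.
by rewrite ltr_pwDl ?mulr_ge0 ?flat_ge0// mulr_gt0// flat_gt0// subr_gt0.
Qed.

(** The derivative is continuous on [0, 3], hence bounded there, and vanishes outside: the margin
    around [1, 2] makes [cslope] zero near every point outside [0, 3]. *)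
Lemma cslope_lipschitz : exists2 L : R, 0 < L & forall s t, `|cslope s - cslope t| <= L * `|s - t|.
Proof.
have [b' db sb'] := smooth1_deriv _ smooth1_cslope.
have cb' : continuous b' := smooth_cont _ _ (sb' 0%N).
have [L L0 bL] : exists2 L, 0 < L & forall s, `|b' s| <= L.
  have nc : {within `[0, 3], continuous (fun s => `|b' s|)}.
    by apply: continuous_subspaceT => s; apply: continuous_comp; [exact: cb'|exact: norm_continuous].
  have [c _ cM] := EVT_max (ler0n R 3) nc.
  exists (`|b' c| + 1) => [|s]; first by rewrite ltr_wpDl.
  have [s0|s0] := ltP s 0.
    have e : \near s, (fun=> 0) s = cslope s.
      near=> r; rewrite cslope_eq0l//; near: r; apply: lt_le_nbhsl.
      by rewrite (lt_trans s0).
    have := near_eq_is_derive e (is_derive_cstf 0 s 1) => h.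
    have := db s => h'; rewrite -(derive_val (is_derive := h')).
    by rewrite (derive_val (is_derive := h)) normr0 addr_ge0.
  have [s3|s3] := leP s 3.
    by rewrite (le_trans (cM _ _)) ?lerDl// in_itv/= s0.
  have e : \near s, (fun=> 0) s = cslope s.
    near=> r; rewrite cslope_eq0r//; near: r; apply: lt_le_nbhsr.
    by rewrite (lt_trans _ s3)// ltr_nat.
  have := near_eq_is_derive e (is_derive_cstf 0 s 1) => h.
  have := db s => h'; rewrite -(derive_val (is_derive := h')).
  by rewrite (derive_val (is_derive := h)) normr0 addr_ge0.
exists L => // s t; wlog st : s t / t <= s.
  move=> H; have [/H//|/ltW/H] := leP t s.
  by rewrite distrC [`|t - s|]distrC.
have cb : {within `[t, s], continuous cslope}.
  by apply: continuous_subspaceT; exact: smooth_cont _ _ (smooth1_cslope 0%N).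
have [c _ ->] := MVT_segment st (fun x _ => db x) cb.
by rewrite normrM ler_wpM2r.
Unshelve. all: by end_near. Qed.

Lemma cslope_bounded : exists2 C : R, 0 < C & forall s, cslope s <= C.
Proof.
have [L L0 HL] := cslope_lipschitz; exists (L * 2) => [|s]; first by rewrite mulr_gt0.
have [s0|s0] := leP s 0; first by rewrite cslope_eq0l ?(le_trans s0)// mulr_ge0// ltW.
have [s2|s2] := leP 2 s; first by rewrite cslope_eq0r// mulr_ge0// ltW.
have := HL s 0; rewrite (cslope_eq0l 0)// !subr0 ger0_norm ?cslope_ge0// => /le_trans; apply.
by rewrite ler_pM2l// gtr0_norm// ltW.
Qed.

End cutoff.

Section radial.
Context {R : realType}.
Implicit Types (s t tau : R).

Lemma cutoff_ge0 s : 0 <= @cutoff R s.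
Proof. by rewrite mulr_ge0 ?invr_ge0 ?addr_ge0 ?flat_ge0. Qed.

Lemma cutoff_le1 s : @cutoff R s <= 1.
Proof.
rewrite /cutoff; set a := flat _ _; set b := flat _ _.
have a0 : 0 <= a := flat_ge0 _ _; have b0 : 0 <= b := flat_ge0 _ _.
have [->|ab] := eqVneq (a + b) 0; first by rewrite invr0 mulr0.
by rewrite ler_pdivrMr ?mul1r ?lerDl// lt_neqAle eq_sym ab addr_ge0.
Qed.

(* The numerator vanishes near [s = 0], so the junk value [x / 0 = 0] is the right one. *)
Definition radm (tau t s : R) : R := (cutoff (tau * s) - cutoff (t * s)) / s.

Lemma radm_eq0r tau t s : 0 < tau -> tau < t -> 2 <= tau * s -> radm tau t s = 0.
Proof.
move=> tau0 taut h; have s0 : 0 < s by rewrite -(pmulr_rgt0 _ tau0) (lt_le_trans _ h).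
rewrite /radm !cutoff_eq0 ?subrr ?mul0r//.
by rewrite (le_trans h)// ler_wpM2r// ltW.
Qed.

Lemma radm_num_eq0 tau t s : 0 < tau -> tau < t -> t * s <= 1 ->
  cutoff (tau * s) - cutoff (t * s) = 0.
Proof.
move=> tau0 taut h; rewrite !cutoff_eq1 ?subrr//.
have [s0|s0] := leP 0 s; first by rewrite (le_trans _ h)// ler_wpM2r// ltW.
by rewrite (@le_trans _ _ 0)// pmulr_rle0// ltW.
Qed.

Lemma radmM tau t s : 0 < tau -> tau < t ->
  s * radm tau t s = cutoff (tau * s) - cutoff (t * s).
Proof.
move=> tau0 taut; rewrite /radm mulrC; have [->|s0] := eqVneq s 0; last by rewrite divfK.
by rewrite !mulr0 subrr.
Qed.

Lemma smooth1_radm tau t : 0 < tau -> tau < t -> smooth1 (radm tau t).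
Proof.
move=> tau0 taut; have t0 : 0 < t by rewrite (lt_trans tau0).
pose chi s := cutoff (2 * t * s).
(* [D] replaces the denominator [s]. It equals [s] wherever the numerator can be non-zero, and it
   has no zero: it is a convex combination of [s] and 1 for s > 0 and equals 1 for s <= 0. *)
pose D s := s * (1 - chi s) + chi s.
have sc c : smooth1 (fun s : R => cutoff (c * s)).
  by apply: smooth1_comp; [exact: smooth1_cutoff|move=> k; apply: smoothZ; exact: smooth1_id].
have D0 s : D s != 0.
  rewrite gt_eqF// /D; have [s0|s0] := ltP 0 s.
    have := cutoff_ge0 (2 * t * s); have := cutoff_le1 (2 * t * s).
    rewrite -/(chi s); nra.
  rewrite /chi cutoff_eq1 ?subrr ?mulr0 ?add0r//.
  by rewrite (@le_trans _ _ 0)// mulr_ge0_le0// mulr_ge0// ltW.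
suff -> : radm tau t = (fun s => (cutoff (tau * s) - cutoff (t * s)) * (D s)^-1).
  move=> k; apply: smoothM; first by apply: smoothB; exact: sc.
  apply: smooth_inv => //; apply: smoothD; last exact: sc.
  apply: smoothM; first exact: smooth1_id.
  by apply: smoothB; [exact: smooth_cst|exact: sc].
apply/funext => s; rewrite /radm; have [h|h] := leP (t * s) 1.
  by rewrite radm_num_eq0// !mul0r.
congr (_ * _^-1); rewrite /D /chi cutoff_eq0; first by rewrite subr0 mulr1 addr0.
by rewrite -mulrA ler_peMr// ltW.
Qed.

(** The field x m(|x|^2) has divergence 2 (s m)' at s = |x|^2, so [radm] is the multiplier for which
    this divergence is a difference of one bump at two scales. *)
Lemma is_derive_radmM tau t (m' : R) s : 0 < tau -> tau < t ->
  is_derive s 1 (radm tau t) m' ->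
  radm tau t s + s * m' = t * cslope (t * s) - tau * cslope (tau * s).
Proof.
move=> tau0 taut dm.
have d1 := is_derive_mulf _ _ _ _ _ _ (is_derive_id s 1) dm.
have dl c : is_derive s 1 (fun s : R => cutoff (c * s)) (- (c * cslope (c * s))).
  have h : is_derive s 1 (fun s : R => c * s) c.
    apply: (is_derive_eq (is_derive_mulf _ _ _ _ _ _ (is_derive_cstf c s 1) (is_derive_id s 1))).
    by rewrite mul0r mulr1 add0r.
  apply: (is_derive_eq (is_derive_compf _ _ _ _ _ _ h (is_derive_cutoff _))).
  by rewrite mulNr mulrC.
have d2 := is_deriveB (dl tau) (dl t).
have e : (fun z : R => id z * radm tau t z) = (fun s => cutoff (tau * s)) - (fun s => cutoff (t * s)).
  by apply/funext => z; rewrite radmM.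
rewrite e in d1.
have := derive_val (is_derive := d1).
rewrite (derive_val (is_derive := d2)) /= opprK mul1r => <-.
by rewrite addrC.
Qed.

End radial.

Section kernel_derivatives.
Context {R : realType}.
Implicit Types (x y v : (R * R)%type).

Lemma is_derive_fst x v : is_derive x v fst v.1.
Proof.
have H : h^-1 *: ((fst \o shift x) (h *: v) - x.1) @[h --> 0^'] --> v.1.
  apply: cvg_near_cst; near=> h.
  have h0 : h != 0 by near: h; exact: nbhs_dnbhs_neq.
  by rewrite /= addrK scalerA mulVf// scale1r.
by apply: DeriveDef; [apply/cvg_ex; exists v.1|apply/cvg_lim].
Unshelve. all: by end_near. Qed.

Lemma is_derive_snd x v : is_derive x v snd v.2.
Proof.
have H : h^-1 *: ((snd \o shift x) (h *: v) - x.2) @[h --> 0^'] --> v.2.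
  apply: cvg_near_cst; near=> h.
  have h0 : h != 0 by near: h; exact: nbhs_dnbhs_neq.
  by rewrite /= addrK scalerA mulVf// scale1r.
by apply: DeriveDef; [apply/cvg_ex; exists v.2|apply/cvg_lim].
Unshelve. all: by end_near. Qed.

Definition smooth2 (f : R * R -> R) := forall k, smooth (R * R)%type (range e_) k f.

Lemma smooth2_fst : smooth2 fst.
Proof.
case=> [|k]; split; try (by []); try (by move=> x; exact: cvg_fst).
by move=> v _; exists (fun=> v.1) => [x|]; [exact: is_derive_fst|exact: smooth_cst].
Qed.

Lemma smooth2_snd : smooth2 snd.
Proof.
case=> [|k]; split; try (by []); try (by move=> x; exact: cvg_snd).
by move=> v _; exists (fun=> v.2) => [x|]; [exact: is_derive_snd|exact: smooth_cst].
Qed.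

Lemma smooth2_Ck k f : smooth (R * R)%type (range e_) k f -> Ck k f.
Proof.
elim: k f => [f [cf _]//|k IH f [cf H]]; split => // j.
have [|psi d s] := H (e_ j); first by exists j.
split=> [x|]; first by case: (d x).
rewrite (_ : (fun x => _) = psi); first exact: IH.
by apply/funext => x; rewrite (derive_val (is_derive := d x)).
Qed.

Definition dx y x : R := x.1 - y.1.
Definition dy y x : R := x.2 - y.2.
Definition sqd y x : R := dx y x ^+ 2 + dy y x ^+ 2.

Lemma is_derive_dx y x v : is_derive x v (dx y) v.1.
Proof.
apply: (is_derive_eq (is_derive_addf _ _ _ _ _ _ (is_derive_fst x v) (is_derive_cstf _ x v))).
exact: addr0.
Qed.

Lemma is_derive_dy y x v : is_derive x v (dy y) v.2.
Proof.
apply: (is_derive_eq (is_derive_addf _ _ _ _ _ _ (is_derive_snd x v) (is_derive_cstf _ x v))).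
exact: addr0.
Qed.

Lemma is_derive_sqd y x v :
  is_derive x v (sqd y) (2 * dx y x * v.1 + 2 * dy y x * v.2).
Proof.
apply: (is_derive_eq (is_derive_addf _ _ _ _ _ _
  (is_derive_expf _ _ _ _ 2 (is_derive_dx y x v))
  (is_derive_expf _ _ _ _ 2 (is_derive_dy y x v)))).
by rewrite /= !expr1.
Qed.

Lemma smooth2_dx y : smooth2 (dx y).
Proof. by move=> k; apply: smoothB; [exact: smooth2_fst|exact: smooth_cst]. Qed.

Lemma smooth2_dy y : smooth2 (dy y).
Proof. by move=> k; apply: smoothB; [exact: smooth2_snd|exact: smooth_cst]. Qed.

Lemma smooth2_sqd y : smooth2 (sqd y).
Proof.
by move=> k; apply: smoothD; apply: smoothM; do ?[exact: smooth2_dx|exact: smooth2_dy].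
Qed.

Section kernels.
Variables (m m1 m2 : R -> R).
Hypothesis dm : forall s : R, is_derive s 1 m (m1 s).
Hypothesis dm1 : forall s : R, is_derive s 1 m1 (m2 s).

(* The gradient field [(ku, kv)] of a radial potential centred at [y], with its derivatives. *)
Definition ku y x := dx y x * m (sqd y x).
Definition kv y x := dy y x * m (sqd y x).
Definition kux y x := m (sqd y x) + 2 * dx y x ^+ 2 * m1 (sqd y x).
Definition kuy y x := 2 * dx y x * dy y x * m1 (sqd y x).
Definition kvy y x := m (sqd y x) + 2 * dy y x ^+ 2 * m1 (sqd y x).
Definition kuxy y x := 2 * dy y x * m1 (sqd y x) + 4 * dx y x ^+ 2 * dy y x * m2 (sqd y x).
Definition kvxy y x := 2 * dx y x * m1 (sqd y x) + 4 * dx y x * dy y x ^+ 2 * m2 (sqd y x).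

Let dmS y x v := is_derive_compf _ _ _ _ _ _ (is_derive_sqd y x v) (dm (sqd y x)).
Let dm1S y x v := is_derive_compf _ _ _ _ _ _ (is_derive_sqd y x v) (dm1 (sqd y x)).
Let dxx y x v := is_derive_expf _ _ _ _ 2 (is_derive_dx y x v).
Let dyy y x v := is_derive_expf _ _ _ _ 2 (is_derive_dy y x v).
Let c2 x v := is_derive_cstf (2 : R) x v.

Lemma is_derive_ku y x j : is_derive x (e_ j) (ku y) (if j == 0 then kux y x else kuy y x).
Proof.
apply: (is_derive_eq (is_derive_mulf _ _ _ _ _ _ (is_derive_dx y x (e_ j)) (dmS y x (e_ j)))).
by rewrite /e_; case: ifP => _ /=; rewrite /kux /kuy; ring.
Qed.

Lemma is_derive_kv y x j : is_derive x (e_ j) (kv y) (if j == 0 then kuy y x else kvy y x).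
Proof.
apply: (is_derive_eq (is_derive_mulf _ _ _ _ _ _ (is_derive_dy y x (e_ j)) (dmS y x (e_ j)))).
by rewrite /e_; case: ifP => _ /=; rewrite /kvy /kuy; ring.
Qed.

Lemma is_derive_kux y x : is_derive x (e_ 1) (kux y) (kuxy y x).
Proof.
apply: (is_derive_eq (is_derive_addf _ _ _ _ _ _ (dmS y x (e_ 1))
  (is_derive_mulf _ _ _ _ _ _ (is_derive_mulf _ _ _ _ _ _ (c2 x (e_ 1)) (dxx y x (e_ 1))) (dm1S y x (e_ 1))))).
by rewrite /e_ /= /kuxy; ring.
Qed.

Lemma is_derive_kvy y x : is_derive x (e_ 0) (kvy y) (kvxy y x).
Proof.
apply: (is_derive_eq (is_derive_addf _ _ _ _ _ _ (dmS y x (e_ 0))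
  (is_derive_mulf _ _ _ _ _ _ (is_derive_mulf _ _ _ _ _ _ (c2 x (e_ 0)) (dyy y x (e_ 0))) (dm1S y x (e_ 0))))).
by rewrite /e_ /= /kvxy; ring.
Qed.

Lemma is_derive_kuy y x j : is_derive x (e_ j) (kuy y) (if j == 0 then kuxy y x else kvxy y x).
Proof.
apply: (is_derive_eq (is_derive_mulf _ _ _ _ _ _ (is_derive_mulf _ _ _ _ _ _ (is_derive_mulf _ _ _ _ _ _ (c2 x (e_ j))
   (is_derive_dx y x (e_ j))) (is_derive_dy y x (e_ j))) (dm1S y x (e_ j)))).
by rewrite /e_; case: ifP => _ /=; rewrite /kuxy /kvxy; ring.
Qed.

Hypothesis sm : smooth1 m.
Hypothesis sm1 : smooth1 m1.
Hypothesis sm2 : smooth1 m2.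

Let smS g y : smooth1 g -> smooth2 (fun x => g (sqd y x)).
Proof. by move=> sg k; apply: smooth_comp; [exact: sg|exact: smooth2_sqd]. Qed.

Ltac smt := repeat first [exact: smooth2_dx|exact: smooth2_dy|exact: smooth_cst|exact: smS
  |apply: smoothD|apply: smoothM].

Lemma smooth2_ku y : smooth2 (ku y). Proof. by move=> k; smt. Qed.
Lemma smooth2_kv y : smooth2 (kv y). Proof. by move=> k; smt. Qed.
Lemma smooth2_kux y : smooth2 (kux y). Proof. by move=> k; smt. Qed.
Lemma smooth2_kuy y : smooth2 (kuy y). Proof. by move=> k; smt. Qed.
Lemma smooth2_kvy y : smooth2 (kvy y). Proof. by move=> k; smt. Qed.
Lemma smooth2_kuxy y : smooth2 (kuxy y). Proof. by move=> k; smt. Qed.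
Lemma smooth2_kvxy y : smooth2 (kvxy y). Proof. by move=> k; smt. Qed.

End kernels.

End kernel_derivatives.

(** * Integral kernels on the plane *)

Section plane_measure.
Context {R : realType}.
Notation mu := (@lebesgue_measure R).

Lemma leb2_sigma_finite : sigma_finite [set: plane R] leb2.
Proof.
have /sigma_finiteP[F [TF ndF Foo]] := sigma_finiteT mu.
exists (fun n => F n `*` F n).
 rewrite -setXTT TF predeqE => -[x y]; split.
    move=> [/= [n _ Fnx] [k _ Gky]]; exists (maxn n k) => //; split.
    - by move: x Fnx; exact/subsetPset/ndF/leq_maxl.
    - by move: y Gky; exact/subsetPset/ndF/leq_maxr.
  by move=> [n _ []/= ? ?]; split; exists n.
move=> k; have [mFk Fk] := Foo k.
split; first exact: measurableX.
have e := @product_measure1E _ _ _ _ R mu mu (F k) (F k) mFk mFk.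
change ((mu \x mu)%E (F k `*` F k) < +oo)%E.
by rewrite e lte_mul_pinfty// ge0_fin_numE.
Qed.

(* [leb2] with the sigma-finite structure required by the Fubini theorems *)
Definition lebf : set (plane R) -> \bar R := leb2.
HB.instance Definition _ := Measure.copy lebf leb2.
HB.instance Definition _ := Measure_isSigmaFinite.Build _ _ _ lebf leb2_sigma_finite.

(** The plane carries the product sigma-algebra, so an open set is exhibited as a countable union of
    rectangles: the squares with rational centre and rational radius that it contains. *)
Lemma open_plane_measurable (U : set (R * R)) : open U -> measurable (U : set (plane R)).
Proof.
move=> oU.
pose I (q : rat) (r : rat) : set R := `](ratr q - ratr r), (ratr q + ratr r)[%classic.
pose box (q : rat * rat * rat) : set (plane R) := I q.1.1 q.2 `*` I q.1.2 q.2.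
pose F q : set (plane R) := if pselect (box q `<=` U) then box q else set0.
suff -> : U = \bigcup_q F q.
  apply: (@countable_bigcupT_measurable _ (plane R) _ F); first exact: countableP.
  move=> q; rewrite /F; case: pselect => //= _.
  by apply: measurableX; exact: measurable_itv.
apply/seteqP; split => [[x y] Uxy|z [q _]]; last first.
  by rewrite /F; case: pselect => //= h; exact: h.
have /nbhs_ballP[e /= e0 eU] := open_nbhs_nbhs (conj oU Uxy).
have [r] := @rat_in_itvoo R 0 (e / 2) (divr_gt0 e0 (ltr0n _ 2)).
rewrite in_itv/= => /andP[r0 re].
have app (z : R) : exists q : rat, `|z - ratr q| < ratr r.
  have [q] := @rat_in_itvoo R (z - ratr r) z ltac:(by rewrite ltrBlDr ltrDl).
  rewrite in_itv/= => /andP[q1 q2]; exists q.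
  by rewrite gtr0_norm ?subr_gt0// ltrBlDr addrC -ltrBlDr.
have [p xp] := app x; have [q yq] := app y.
exists (p, q, r) => //; rewrite /F; case: pselect => [h|]; last first.
  case=> -[a b] [/=]; rewrite /I/= !in_itv/= => /andP[a1 a2] /andP[b1 b2].
  apply: eU; split => /=; rewrite /ball/=.
    by move: xp; rewrite !ltr_norml => /andP[? ?]; apply/andP; split; lra.
  by move: yq; rewrite !ltr_norml => /andP[? ?]; apply/andP; split; lra.
rewrite /box/I; split; rewrite /= in_itv/=.
  by move: xp; rewrite !ltr_norml => /andP[? ?]; apply/andP; split; lra.
by move: yq; rewrite !ltr_norml => /andP[? ?]; apply/andP; split; lra.
Qed.

Lemma continuous_plane_measurable (f : R * R -> R) : continuous f ->
  measurable_fun [set: plane R] (f : plane R -> R).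
Proof.
move=> /continuousP cf; apply: (measurability _ (RGenOpens.measurableE R)).
move=> _ [_ [a [b ->] <-]]; rewrite setTI; apply: open_plane_measurable.
exact/cf/interval_open.
Qed.

Definition inbox (B : R) (x : plane R) := (`|x.1| <= B) && (`|x.2| <= B).
Definition box B : set (plane R) := [set x | inbox B x].

Lemma boxE B : box B = `[- B, B] `*` `[- B, B].
Proof.
apply/seteqP; split => -[x y]; rewrite /box/inbox/= !in_itv/= !ler_norml.
  by move=> /andP[].
by move=> [-> ->].
Qed.

Lemma measurable_box B : measurable (box B).
Proof. by rewrite boxE; apply: measurableX; exact: measurable_itv. Qed.

Lemma compact_box B : compact (box B : set (R * R)).
Proof. by rewrite boxE; apply: compact_setX; exact: segment_compact. Qed.

Lemma leb2_box B : 0 <= B -> leb2 (box B) = ((2 * B) ^+ 2)%:E.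
Proof.
move=> B0; rewrite boxE.
have mI : measurable (`[- B, B]%classic : set R) by exact: measurable_itv.
have e := @product_measure1E _ _ _ _ R mu mu _ _ mI mI.
change ((mu \x mu)%E (`[- B, B] `*` `[- B, B]) = ((2 * B) ^+ 2)%:E).
rewrite e /= lebesgue_measure_itv/= lte_fin.
have [b0|b0] := ltP (- B) B; first by rewrite -EFinD -EFinM; congr EFin; ring.
have -> : B = 0 by lra.
by rewrite mule0; congr EFin; ring.
Qed.

Lemma leb2_box_lty B : (leb2 (box B) < +oo)%E.
Proof.
have [B0|B0] := leP 0 B; first by rewrite leb2_box// ltry.
rewrite (_ : box B = set0) ?measure0//.
rewrite -subset0 => x /= /andP[x1 _].
by have := le_trans x1 (ltW B0); rewrite normr_le0 => /eqP h; move: x1; rewrite h normr0 leNgt B0.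
Qed.

Definition integ (f : plane R -> R) := leb2.-integrable setT (EFin \o f).

Definition L1loc (f : plane R -> R) := measurable_fun setT f /\
  forall B, leb2.-integrable (box B) (EFin \o f).

(** The class of test functions: it pairs with every [L1loc] function, is stable under [Tr], and
    contains the discontinuous truncations used in the duality argument. *)
Definition bms (f : plane R -> R) := measurable_fun setT f /\
  exists M B, forall x, `|f x| <= M /\ (~~ inbox B x -> f x = 0).

Lemma L1locM_integ a f : L1loc a -> bms f -> integ (fun x => a x * f x).
Proof.
move=> [ma ia] [mf [M [B H]]].
have := (integrable_mkcond (EFin \o a) (measurable_box B)).1 (ia B).
move/(integrableZl measurableT M); apply: le_integrable => //.
  by apply/measurable_EFinP; exact: measurable_funM.
move=> x _ /=; rewrite patchE; have [fM f0] := H x.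
have [xB|xB] := boolP (inbox B x).
  rewrite mem_set// lee_fin !normrM mulrC ler_wpM2r//.
  by rewrite (le_trans fM)// ler_norm.
by rewrite memNset ?f0// ?mulr0 ?normr0 ?abse_ge0//; apply/negP.
Qed.

Lemma L1loc_bounded (f : plane R -> R) : measurable_fun setT f ->
  (forall B, exists M, forall x, inbox B x -> `|f x| <= M) -> L1loc f.
Proof.
move=> mf H; split => // B; have [M HM] := H B.
apply: measurable_bounded_integrable; [exact: measurable_box|exact: leb2_box_lty| |].
  exact: measurable_funTS.
by exists M; split; rewrite ?num_real// => N MN x xB; apply: le_trans (HM x xB) _; exact: ltW.
Qed.

Lemma L1loc_cst c : L1loc (fun=> c).
Proof. by apply: L1loc_bounded => // B; exists `|c|. Qed.

Lemma bms_L1loc f : bms f -> L1loc f.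
Proof.
by move=> [mf [M [B H]]]; apply: L1loc_bounded => // B'; exists M => x _; have [] := H x.
Qed.

Lemma bms_integ f : bms f -> integ f.
Proof.
by move=> /(L1locM_integ _ _ (L1loc_cst 1)); congr integrable; apply/funext => x/=; rewrite mul1r.
Qed.

Lemma inboxS B C x : B <= C -> inbox B x -> inbox C x.
Proof. by move=> BC /andP[h1 h2]; rewrite /inbox !(le_trans _ BC). Qed.

Lemma bmsM f g : L1loc f -> (forall B, exists M, forall x, inbox B x -> `|f x| <= M) -> bms g ->
  bms (fun x => f x * g x).
Proof.
move=> [mf _] Hf [mg [M [B H]]]; split; first exact: measurable_funM.
have [N HN] := Hf B; exists (`|N| * M), B => x; have [gM g0] := H x; split => [|xB].
  have [xB|xB] := boolP (inbox B x).
    by rewrite normrM ler_pM// (le_trans (HN _ xB))// ler_norm.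
  by rewrite g0// mulr0 normr0 mulr_ge0// (le_trans _ gM).
by rewrite g0// mulr0.
Qed.

End plane_measure.

Section fubini_real.
Context d1 d2 (T1 : measurableType d1) (T2 : measurableType d2) (R : realType).
Variable m1 : {sigma_finite_measure set T1 -> \bar R}.
Variable m2 : {sigma_finite_measure set T2 -> \bar R}.

(** Integrability of every section lets [fine] be undone pointwise, which reduces the claim to
    Fubini's theorem for extended-real integrals. *)
Lemma Rintegral_swap (f : T1 * T2 -> R) :
  (m1 \x m2)%E.-integrable setT (EFin \o f) ->
  (forall x, m2.-integrable setT (fun y => (f (x, y))%:E)) ->
  (forall y, m1.-integrable setT (fun x => (f (x, y))%:E)) ->
  \int[m1]_x (\int[m2]_y f (x, y)) = \int[m2]_y (\int[m1]_x f (x, y)).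
Proof.
move=> fi f1 f2; rewrite /Rintegral; congr fine.
transitivity (\int[m1]_x \int[m2]_y (f (x, y))%:E)%E.
  apply: eq_integral => x _; rewrite fineK//.
  by apply: (integrable_fin_num _ (f1 x)).
transitivity (\int[m2]_y \int[m1]_x (f (x, y))%:E)%E; first exact: (Fubini fi).
apply: eq_integral => y _; rewrite fineK//.
by apply: (integrable_fin_num _ (f2 y)).
Qed.

Lemma integrable_prod_dom (f : T1 * T2 -> R) (g : T1 -> R) (h : T2 -> R) :
  measurable_fun setT f -> m1.-integrable setT (EFin \o g) ->
  m2.-integrable setT (EFin \o h) ->
  (forall x y, `|f (x, y)| <= `|g x| * `|h y|) ->
  (m1 \x m2)%E.-integrable setT (EFin \o f).
Proof.
move=> mf ig ih fgh.
have mh : measurable_fun setT h by case/integrableP: ih => /measurable_EFinP.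
have mg : measurable_fun setT g by case/integrableP: ig => /measurable_EFinP.
apply/integrable12ltyP; first exact/measurable_EFinP.
have C0 : (\int[m2]_y `|(h y)%:E| < +oo)%E by case/integrableP: ih.
have Cf : (\int[m2]_y `|(h y)%:E|)%E \is a fin_num.
  by rewrite ge0_fin_numE// integral_ge0.
apply: (@le_lt_trans _ _ (\int[m1]_x (`|(g x)%:E| * \int[m2]_y `|(h y)%:E|))%E).
  apply: ge0_le_integral => //.
  - by move=> x _; exact: integral_ge0.
  - apply: (measurable_fun_fubini_tonelli_F (fun z => `|(f z)%:E|%E)) => //.
    by apply/measurable_EFinP; exact: measurableT_comp.
  - rewrite -(fineK Cf); apply/measurable_EFinP/measurable_funM => //.
    exact: measurableT_comp.
  - move=> x _; rewrite -ge0_integralZl//; last by apply/measurable_EFinP; exact: measurableT_comp.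
    apply: ge0_le_integral => //.
    + apply/measurable_EFinP; apply: measurableT_comp => //.
      exact: (measurableT_comp mf).
    + apply/measurable_EFinP; apply: measurable_funM => //; exact: measurableT_comp.
    + by move=> y _ /=; rewrite lee_fin.
rewrite ge0_integralZr//; last 2 first.
  by apply/measurable_EFinP; exact: measurableT_comp.
  by rewrite integral_ge0.
rewrite lte_mul_pinfty ?integral_ge0// ge0_fin_numE ?integral_ge0//.
by case/integrableP: ig.
Qed.

End fubini_real.

(** * Integral operators with symmetric kernels of finite range *)

Section transforms.
Context {R : realType}.
Implicit Types (a th : plane R -> R) (K : plane R -> plane R -> R) (x y : plane R).

Definition near_box B y x := (`|dx y x| <= B) && (`|dy y x| <= B).

(** The finite range makes every integral a local one, and the symmetry makes [Tr K] self-adjoint,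
    which takes the place of the commutation of convolutions. *)
Definition kern K := [/\ measurable_fun setT (fun z : plane R * plane R => K z.1 z.2),
  exists M B, forall y x, `|K y x| <= M /\ (~~ near_box B y x -> K y x = 0) &
  forall y x, K y x = K x y].

Definition Tr K a y : R := \int[leb2]_x (a x * K y x).

Lemma near_boxD B C y x : near_box B y x -> inbox C y -> inbox (B + C) x.
Proof.
move=> /andP[h1 h2] /andP[h3 h4]; apply/andP; split.
  by rewrite -(subrK y.1 x.1) (le_trans (ler_normD _ _))// lerD.
by rewrite -(subrK y.2 x.2) (le_trans (ler_normD _ _))// lerD.
Qed.

Lemma kern_bms K y : kern K -> bms (K y).
Proof.
move=> [mK [M [B H]] _]; split; first exact: (measurableT_comp mK (pair1_measurable y)).
exists M, (B + Num.max `|y.1| `|y.2|) => x; have [H1 H2] := H y x; split => // xB.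
apply: H2; apply: contra xB => /near_boxD; apply.
by rewrite /inbox !le_max !lexx orbT.
Qed.

Lemma Tr_integ K a y : kern K -> L1loc a -> integ (fun x => a x * K y x).
Proof. by move=> /(kern_bms _ y) kK la; exact: L1locM_integ. Qed.

Lemma integrable_kern2 K a f : kern K -> L1loc a -> bms f ->
  (lebf \x lebf)%E.-integrable setT
    (EFin \o (fun z : plane R * plane R => f z.1 * (a z.2 * K z.1 z.2))).
Proof.
move=> kK la bf; have [mK [M [B HK]] _] := kK; have [mf [N [C Hf]]] := bf.
have bI : bms (\1_(box (B + C)) : plane R -> R).
  split; first exact: measurable_indic (measurable_box _).
  exists 1, (B + C) => x; rewrite indicE; split; first by case: (_ \in _); rewrite ?normr1 ?normr0.
  by move=> xB; rewrite memNset//; apply/negP.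
apply: (@integrable_prod_dom _ _ _ _ _ _ _ _ f
  (fun x => M * (a x * \1_(box (B + C)) x))).
- apply: measurable_funM; first exact: (measurableT_comp mf measurable_fst).
  apply: measurable_funM => //; exact: (measurableT_comp la.1 measurable_snd).
- exact: bms_integ.
- have /(integrableZl measurableT M) := L1locM_integ _ _ la bI.
  by congr integrable; apply/funext => x.
move=> y x /=; rewrite normrM.
have [yC|yC] := boolP (inbox C y); last first.
  by have [_ ->] := Hf y; rewrite // normr0 !mul0r.
rewrite ler_wpM2l//; have [H1 H2] := HK y x.
have [xB|xB] := boolP (near_box B y x); last by rewrite H2// mulr0 normr0.
rewrite indicE mem_set ?mulr1; last exact: near_boxD xB yC.
by rewrite !normrM mulrC ler_wpM2r// (le_trans H1)// ler_norm.
Qed.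

Lemma Tr_integM K a f : kern K -> L1loc a -> bms f -> integ (fun y => f y * Tr K a y).
Proof.
move=> kK la bf; have := integrable_fubini_F (integrable_kern2 _ _ _ kK la bf).
congr integrable; apply/funext => y /=; rewrite /fubini_F /=.
transitivity (\int[leb2]_x ((f y)%:E * (a x * K y x)%:E))%E => //.
rewrite integralZl//; last exact: Tr_integ.
rewrite EFinM /Tr /Rintegral fineK//.
by apply: (integrable_fin_num _ (Tr_integ _ _ _ kK la)).
Qed.

Lemma Tr_adj K a f : kern K -> L1loc a -> bms f ->
  \int[leb2]_y (f y * Tr K a y) = \int[leb2]_x (a x * Tr K f x).
Proof.
move=> kK la bf.
have fi := integrable_kern2 _ _ _ kK la bf.
have i1 y : lebf.-integrable setT (fun x => (f y * (a x * K y x))%:E).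
  exact: (integrableZl measurableT (f y) (Tr_integ _ _ y kK la)).
have i2 x : lebf.-integrable setT (fun y => (f y * (a x * K y x))%:E).
  have := integrableZl measurableT (a x) (Tr_integ _ _ x kK (bms_L1loc _ bf)).
  congr integrable; apply/funext => y /=; rewrite -EFinM; congr EFin.
  by have [_ _ ->] := kK; ring.
have := @Rintegral_swap _ _ _ _ R lebf lebf _ fi i1 i2.
move=> e; transitivity (\int[leb2]_y (\int[leb2]_x (f y * (a x * K y x)))).
  by apply: eq_Rintegral => y _; rewrite RintegralZl//; exact: Tr_integ.
rewrite [LHS]e; apply: eq_Rintegral => x _.
rewrite /Tr -RintegralZl//; last exact: (Tr_integ _ _ _ kK (bms_L1loc _ bf)).
by apply: eq_Rintegral => y _ /=; have [_ _ ->] := kK; ring.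
Qed.

Lemma bms_indic_box B : bms (\1_(box B) : plane R -> R).
Proof.
split; first exact: measurable_indic (measurable_box _).
exists 1, B => x; rewrite indicE; split; first by case: (_ \in _); rewrite ?normr1 ?normr0.
by move=> xB; rewrite memNset//; apply/negP.
Qed.

Lemma Tr_eq0 K f B C y : (forall y x, ~~ near_box B y x -> K y x = 0) ->
  (forall x, ~~ inbox C x -> f x = 0) -> ~~ inbox (B + C) y -> Tr K f y = 0.
Proof.
move=> HK Hf yBC; rewrite /Tr; under eq_Rintegral => x _.
  rewrite (_ : f x * K y x = 0); first over.
  have [xC|xC] := boolP (inbox C x); last by rewrite Hf ?mul0r.
  rewrite HK ?mulr0//; apply: contra yBC => h; apply: (near_boxD _ _ x _) => //.
  by move: h; rewrite /near_box /dx /dy ![`|y.1 - _|]distrC ![`|y.2 - _|]distrC.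
by rewrite Rintegral_cst// mul0r.
Qed.

Lemma Tr_bound K f M y : (forall y x, `|K y x| <= M) -> kern K -> bms f ->
  `|Tr K f y| <= M * \int[leb2]_x `|f x|.
Proof.
move=> HM kK bf; rewrite /Tr.
have i := Tr_integ _ _ y kK (bms_L1loc _ bf).
have iabs : integ (fun x => `|f x|).
  by have := integrable_abse (bms_integ _ bf).
apply: le_trans (le_normr_Rintegral _ i) _ => //.
rewrite -RintegralZl//; apply: le_Rintegral => //.
- by have := integrable_abse i.
- exact: (integrableZl measurableT M iabs).
by move=> x _; rewrite normrM mulrC ler_wpM2r.
Qed.

Lemma Tr_bms K f : kern K -> bms f -> bms (Tr K f).
Proof.
move=> kK bf; have [mK [M [B HK]] sK] := kK; have [mf [N [C Hf]]] := bf.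
have H0 y : ~~ inbox (B + C) y -> Tr K f y = 0.
  by apply: Tr_eq0 => [y' x|x]; [have [] := HK y' x|have [] := Hf x].
split; last first.
  exists (M * \int[leb2]_x `|f x|), (B + C) => x; split; last exact: H0.
  by apply: Tr_bound => // y' x'; have [] := HK y' x'.
(* Measurability is extracted from Fubini's theorem: the product of [Tr K f] with the indicator of a
   box is integrable, and it equals [Tr K f], which vanishes outside that box. *)
have /integrableP[/measurable_EFinP + _] := Tr_integM _ _ _ kK (bms_L1loc _ bf) (bms_indic_box (B + C)).
apply: eq_measurable_fun => y _; rewrite indicE.
have [yB|yB] := boolP (inbox (B + C) y); first by rewrite mem_set// mul1r.
by rewrite H0// mulr0.
Qed.

Lemma TrD K a b y : kern K -> L1loc a -> L1loc b ->
  Tr K (fun x => a x + b x) y = Tr K a y + Tr K b y.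
Proof.
move=> kK la lb; rewrite /Tr -RintegralD//; try exact: Tr_integ.
by apply: eq_Rintegral => x _; rewrite mulrDl.
Qed.

End transforms.

(** * Integration by parts on the plane *)

Section integration_by_parts.
Context {R : realType}.
Notation mu := (@lebesgue_measure R).

Lemma integral_deriv0 (F f : R -> R) (B : R) : (forall t : R, is_derive t 1 F (f t)) ->
  continuous f -> (forall t, B < `|t| -> F t = 0) -> (forall t, B < `|t| -> f t = 0) ->
  (\int[mu]_t (f t)%:E = 0)%E.
Proof.
(* [C] exceeds [B] strictly, so that [F] vanishes at both end points of the interval. *)
move=> dF cf F0 f0; pose C : R := `|B| + 1.
have BC : B < C by rewrite /C (le_lt_trans (ler_norm _))// ltrDl.
have C0 : 0 < C by rewrite /C ltr_wpDl.
have CC : - C < C by rewrite (@lt_trans _ _ 0) ?oppr_lt0.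
rewrite (_ : \int[mu]_t _ = \int[mu]_(t in `[(- C)%R, C]) (f t)%:E)%E.
  rewrite (@continuous_FTC2 _ f F)//.
  - by rewrite (F0 C) ?(F0 (- C)) ?sube0 ?normrN ?gtr0_norm.
  - by apply: continuous_subspaceT.
  - have cF t : F @ t --> F t.
      by apply/differentiable_continuous/derivable1_diffP; case: (dF t).
    split; first by move=> t _; case: (dF t).
      by apply: cvg_at_right_filter; exact: cF.
    by apply: cvg_at_left_filter; exact: cF.
  - by move=> t _; rewrite derive1E; exact: derive_val.
rewrite [RHS]integral_mkcond; apply: eq_integral => t _; rewrite patchE.
case: ifPn => //; rewrite notin_setE /= => h; congr EFin; apply: f0.
rewrite ltNge; apply/negP => tB; apply: h.
by rewrite in_itv/= -ler_norml (le_trans tB)// ltW.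
Qed.

Lemma is_derive_line (f : R * R -> R) x v (df : R) :
  is_derive x v f df -> is_derive (0 : R) 1 (fun t : R => f (t *: v + x)) df.
Proof.
move=> [h1 h2]; apply: DeriveDef; first by apply/(derivable1P f x v).1.
rewrite -h2 /derive; set p := fun _ => _; set q := fun _ => _.
suff -> : p = q by [].
apply/funext => t; rewrite /p /q /= scale0r add0r addr0.
by rewrite (_ : t *: 1 = t)// /GRing.scale/= mulr1.
Qed.

Lemma is_derive_row (f : R * R -> R) (s y df : R) :
  is_derive (s, y) (e_ 0) f df -> is_derive s 1 (fun t : R => f (t, y)) df.
Proof.
move=> /is_derive_line h.
have e : is_derive s 1 (fun t : R => t - s) 1.
  by apply: (is_derive_eq (is_derive_addf _ _ _ _ _ _ (is_derive_id s 1) (is_derive_cstf (- s) s 1))); rewrite addr0.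
rewrite -(subrr s) in h.
have := is_derive_compf _ _ _ _ _ _ e h; rewrite mulr1; congr is_derive.
apply/funext => t; rewrite /e_ /=; congr f.
by rewrite /GRing.scale/= /GRing.add/= /add_pair /= /GRing.scale/= mulr1 mulr0 add0r subrK.
Qed.

Lemma is_derive_col (f : R * R -> R) (s y df : R) :
  is_derive (s, y) (e_ 1) f df -> is_derive y 1 (fun t : R => f (s, t)) df.
Proof.
move=> /is_derive_line h.
have e : is_derive y 1 (fun t : R => t - y) 1.
  by apply: (is_derive_eq (is_derive_addf _ _ _ _ _ _ (is_derive_id y 1) (is_derive_cstf (- y) y 1))); rewrite addr0.
rewrite -(subrr y) in h.
have := is_derive_compf _ _ _ _ _ _ e h; rewrite mulr1; congr is_derive.
apply/funext => t; rewrite /e_ /=; congr f.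
by rewrite /GRing.scale/= /GRing.add/= /add_pair /= /GRing.scale/= mulr1 mulr0 add0r subrK.
Qed.

Lemma deriv_outside (f psi : R * R -> R) v B : (forall x, is_derive x v f (psi x)) ->
  (forall x, ~~ inbox B x -> f x = 0) -> forall x, ~~ inbox B x -> psi x = 0.
Proof.
move=> df f0 x xB.
have oB : open (~` box B : set (R * R)).
  apply: closed_openC; apply: compact_closed; last exact: compact_box.
  exact: norm_hausdorff.
have e : \near x, (fun=> 0) x = f x.
  have := open_nbhs_nbhs (conj oB (negP xB : (~` box B) x)).
  by apply: filterS => z /negP zB; rewrite f0.
have h := near_eq_is_derive e (is_derive_cstf 0 x v).
have h' := df x; rewrite -(derive_val (is_derive := h')).
by rewrite (derive_val (is_derive := h)).
Qed.

Lemma continuous_locally_bounded (f : R * R -> R) B : continuous f ->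
  exists M, forall x, inbox B x -> `|f x| <= M.
Proof.
move=> cf.
have /compact_bounded[M [_ HM]] : compact [set f x | x in box B].
  apply: continuous_compact; last exact: compact_box.
  exact: continuous_subspaceT.
exists (`|M| + 1) => x xB; apply: (HM (`|M| + 1)); last by exists x.
by rewrite (le_lt_trans (ler_norm _))// ltrDl.
Qed.

Lemma continuous_L1loc (f : R * R -> R) : continuous f -> L1loc f.
Proof.
move=> cf; apply: L1loc_bounded; first exact: continuous_plane_measurable.
by move=> B; exact: continuous_locally_bounded.
Qed.

Lemma continuous_bms (f : R * R -> R) B : continuous f ->
  (forall x, ~~ inbox B x -> f x = 0) -> bms f.
Proof.
move=> cf f0; split; first exact: continuous_plane_measurable.
have [M HM] := continuous_locally_bounded _ B cf.
exists (`|M|), B => x; split; last exact: f0.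
have [xB|xB] := boolP (inbox B x); first by rewrite (le_trans (HM x xB))// ler_norm.
by rewrite f0// normr0.
Qed.

Lemma Rintegral_deriv0 j (w psi : R * R -> R) B : continuous psi ->
  (forall x, is_derive x (e_ j) w (psi x)) -> (forall x, ~~ inbox B x -> w x = 0) ->
  \int[leb2]_x psi x = 0.
Proof.
move=> cpsi dw w0; have psi0 := deriv_outside _ _ _ _ dw w0.
have ipsi : (mu \x mu)%E.-integrable setT (EFin \o (psi : plane R -> R)).
  exact: bms_integ (continuous_bms _ _ cpsi psi0).
have out1 (s t : R) : B < `|s| -> ~~ inbox B (s, t) by move=> sB; rewrite /inbox/= leNgt sB.
have out2 (s t : R) : B < `|t| -> ~~ inbox B (s, t).
  by move=> sB; rewrite /inbox/= andbC leNgt sB.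
rewrite /Rintegral.
have [ej|ej] : e_ j = e_ 0 :> R * R \/ e_ j = e_ 1 :> R * R.
- by rewrite /e_ /=; case: (j == 0); [left|right].
- rewrite ej in dw; suff -> : (\int[leb2]_x (psi x)%:E = 0)%E by [].
  rewrite [LHS](esym (integral21_prod_meas1 ipsi)).
  apply: integral0_eq => y _; rewrite /fubini_G/=.
  apply: (@integral_deriv0 (fun s => w (s, y)) (fun s => psi (s, y)) B).
  + by move=> s; exact: is_derive_row.
  + move=> s; apply: (@continuous_comp _ _ _ (fun s : R => (s, y)) psi); last exact: cpsi.
    exact: (cvg_pair (cvg_id (F := nbhs s)) (cvg_cst y)).
  + by move=> s sB; exact/w0/out1.
  + by move=> s sB; exact/psi0/out1.
- rewrite ej in dw; suff -> : (\int[leb2]_x (psi x)%:E = 0)%E by [].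
  rewrite [LHS](esym (integral12_prod_meas1 ipsi)).
  apply: integral0_eq => s _; rewrite /fubini_F/=.
  apply: (@integral_deriv0 (fun y => w (s, y)) (fun y => psi (s, y)) B).
  + by move=> y; exact: is_derive_col.
  + move=> y; apply: (@continuous_comp _ _ _ (fun y : R => (s, y)) psi); last exact: cpsi.
    exact: (cvg_pair (cvg_cst s) (cvg_id (F := nbhs y))).
  + by move=> y sB; exact/w0/out2.
  + by move=> y sB; exact/psi0/out2.
Qed.

Lemma parts2 j (f g f' g' : R * R -> R) B : continuous f -> continuous g ->
  continuous f' -> continuous g' ->
  (forall x, is_derive x (e_ j) f (f' x)) -> (forall x, is_derive x (e_ j) g (g' x)) ->
  (forall x, ~~ inbox B x -> g x = 0) ->
  \int[leb2]_x (f x * g' x) = - \int[leb2]_x (f' x * g x).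
Proof.
move=> cf cg cf' cg' df dg g0.
have g'0 := deriv_outside _ _ _ _ dg g0.
have i1 : integ (fun x => f x * g' x).
  by apply: L1locM_integ; [exact: continuous_L1loc|exact: continuous_bms cg' g'0].
have i2 : integ (fun x => f' x * g x).
  by apply: L1locM_integ; [exact: continuous_L1loc|exact: continuous_bms cg g0].
apply/eqP; rewrite -addr_eq0 -RintegralD//; apply/eqP.
under eq_Rintegral do rewrite addrC.
apply: (@Rintegral_deriv0 j (fun x : R * R => f x * g x)
  (fun x : R * R => f' x * g x + f x * g' x) B).
- by move=> x; apply: cvgD; apply: cvgM; do ?[exact: cf|exact: cg|exact: cf'|exact: cg'].
- by move=> x; exact: is_derive_mulf.
- by move=> x xB; rewrite g0// mulr0.
Qed.

End integration_by_parts.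

(** * Truncated Beurling kernels *)

Section kernels.
Context {R : realType}.
Implicit Types (x y z : plane R).

(** Moving the derivative off [g] turns both sides into minus the integral of [fxy] times [g]. *)
Lemma null_lagrangian (fx fy fxy g gx gy : R * R -> R) B :
  continuous fx -> continuous fy -> continuous fxy -> continuous g ->
  continuous gx -> continuous gy ->
  (forall x, is_derive x (e_ 1) fx (fxy x)) ->
  (forall x, is_derive x (e_ 0) fy (fxy x)) ->
  (forall x, is_derive x (e_ 0) g (gx x)) ->
  (forall x, is_derive x (e_ 1) g (gy x)) ->
  (forall x, ~~ inbox B x -> g x = 0) ->
  \int[leb2]_x (fx x * gy x) = \int[leb2]_x (fy x * gx x).
Proof.
move=> cfx cfy cfxy cg cgx cgy dfx dfy dg0 dg1 g0.
rewrite (@parts2 _ 1 fx g fxy gy B)//.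
by rewrite (@parts2 _ 0 fy g fxy gx B).
Qed.

Lemma sqd_sym y x : sqd y x = sqd x y.
Proof. by rewrite /sqd /dx /dy; ring. Qed.

Lemma sqd_far B y x : 0 <= B -> ~~ near_box B y x -> B ^+ 2 < sqd y x.
Proof.
move=> B0; rewrite negb_and -!ltNge /sqd => /orP[] h.
- rewrite ltr_wpDr ?sqr_ge0// -(real_normK (num_real (dx y x))).
  by rewrite ltr_pXn2r ?nnegrE.
- rewrite ltr_wpDl ?sqr_ge0// -(real_normK (num_real (dy y x))).
  by rewrite ltr_pXn2r ?nnegrE.
Qed.

Let mdx : measurable_fun setT (fun z : plane R * plane R => dx z.1 z.2).
Proof.
apply: measurable_funB.
  exact: (measurableT_comp measurable_fst measurable_snd).
exact: (measurableT_comp measurable_fst measurable_fst).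
Qed.

Let mdy : measurable_fun setT (fun z : plane R * plane R => dy z.1 z.2).
Proof.
apply: measurable_funB.
  exact: (measurableT_comp measurable_snd measurable_snd).
exact: (measurableT_comp measurable_snd measurable_fst).
Qed.

Let mcomp (g : R -> R) : continuous g ->
  measurable_fun setT (fun z : plane R * plane R => g (sqd z.1 z.2)).
Proof.
move=> cg; apply: (measurableT_comp (continuous_measurable_fun cg)).
by apply: measurable_funD; exact: measurable_funX.
Qed.

Lemma kern_radial (g : R -> R) B : 0 <= B -> continuous g ->
  (forall s, B ^+ 2 < s -> g s = 0) -> kern (fun y x => g (sqd y x)).
Proof.
move=> B0 cg g0; split; first exact: mcomp.
- pose o : R * R := (0, 0).
  have [M HM] := continuous_locally_bounded (fun x => g (sqd o x)) B
    (smooth_cont _ _ (smooth_comp _ _ 0 _ _ (conj cg I) (smooth2_sqd o 0%N))).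
  exists (`|M|), B => y x; split; last by move=> h; rewrite g0// sqd_far.
  have [h|h] := boolP (near_box B y x); last by rewrite g0 ?normr0// sqd_far.
  rewrite (le_trans _ (ler_norm M))// (_ : sqd y x = sqd o (x.1 - y.1, x.2 - y.2)).
    exact: HM.
  by rewrite /sqd /dx /dy /= !subr0.
- by move=> y x; rewrite sqd_sym.
Qed.

Section multiplier.
Variables (m m1 m2 : R -> R) (B : R).
Hypothesis B0 : 0 <= B.
Hypothesis dm : forall s : R, is_derive s 1 m (m1 s).
Hypothesis dm1 : forall s : R, is_derive s 1 m1 (m2 s).
Hypothesis sm : smooth1 m.
Hypothesis sm1 : smooth1 m1.
Hypothesis sm2 : smooth1 m2.
Hypothesis m_out : forall s, B ^+ 2 < s -> m s = 0.

Let deriv_out (f f' : R -> R) : (forall s : R, is_derive s 1 f (f' s)) ->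
  (forall s, B ^+ 2 < s -> f s = 0) -> forall s, B ^+ 2 < s -> f' s = 0.
Proof.
move=> df f0 s Bs.
have e : \near s, (fun=> 0) s = f s.
  by near=> r; rewrite f0//; near: r; exact: lt_nbhsr.
have h := near_eq_is_derive e (is_derive_cstf 0 s 1).
have h' := df s; rewrite -(derive_val (is_derive := h')).
by rewrite (derive_val (is_derive := h)).
Unshelve. all: by end_near. Qed.

Let m1_out := deriv_out _ _ dm m_out.

(** The trace and, as [ksg] and [kta], twice the two components of the trace-free part of the
    symmetric gradient matrix of the field [(ku, kv)]. *)
Definition kZ y x := kux m m1 y x + kvy m m1 y x.
Definition ksg y x := kux m m1 y x - kvy m m1 y x.
Definition kta y x := 2 * kuy m1 y x.

Let kux' := kux m m1. Let kvy' := kvy m m1. Let kuy' := kuy m1.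

Let kux_out y x : ~~ near_box B y x -> kux' y x = 0.
Proof. by move=> /(sqd_far _ _ _ B0) h; rewrite /kux' /kux m_out// m1_out// mulr0 addr0. Qed.
Let kvy_out y x : ~~ near_box B y x -> kvy' y x = 0.
Proof. by move=> /(sqd_far _ _ _ B0) h; rewrite /kvy' /kvy m_out// m1_out// mulr0 addr0. Qed.
Let kuy_out y x : ~~ near_box B y x -> kuy' y x = 0.
Proof. by move=> /(sqd_far _ _ _ B0) h; rewrite /kuy' /kuy m1_out// mulr0. Qed.

Let cm := smooth_cont _ _ (sm 0%N).
Let cm1 := smooth_cont _ _ (sm1 0%N).

Let bounded_m (g : R -> R) : continuous g -> (forall s, B ^+ 2 < s -> g s = 0) ->
  exists2 M, 0 <= M & forall y x, `|g (sqd y x)| <= M.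
Proof.
move=> cg g0; have [_ [M [C H]] _] := kern_radial g B B0 cg g0.
exists `|M| => // y x; have [h _] := H y x; exact: le_trans h (ler_norm _).
Qed.

Let kern_dd (p : plane R -> plane R -> R) :
  measurable_fun setT (fun z : plane R * plane R => p z.1 z.2) ->
  (forall y x, near_box B y x -> `|p y x| <= 2 * B ^+ 2) ->
  (forall y x, p y x = p x y) -> kern (fun y x => p y x * m1 (sqd y x)).
Proof.
move=> mp pB ps; have [M1 M10 H1] := bounded_m _ cm1 m1_out.
split.
- by apply: measurable_funM => //; exact: mcomp.
- exists (2 * B ^+ 2 * M1), B => y x; split => [|/(sqd_far _ _ _ B0) h]; last first.
    by rewrite m1_out// mulr0.
  have [h|/(sqd_far _ _ _ B0) h] := boolP (near_box B y x).
    by rewrite normrM ler_pM// pB.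
  by rewrite m1_out// mulr0 normr0 !mulr_ge0// exprn_ge0.
- by move=> y x; rewrite ps sqd_sym.
Qed.

Lemma kernD K L : kern K -> kern L -> kern (fun y x => K y x + L y x :> R).
Proof.
move=> [mK [M [C HK]] sK] [mL [N [D HL]] sL]; split.
- exact: measurable_funD.
- exists (M + N), (Num.max C D) => y x.
  have [K1 K0] := HK y x; have [L1 L0] := HL y x.
  split; first by rewrite (le_trans (ler_normD _ _))// lerD.
  rewrite /near_box !le_max => h; rewrite K0 ?L0 ?addr0//.
    by apply: contra h => /andP[-> ->]; rewrite !orbT.
  by apply: contra h => /andP[-> ->].
- by move=> y x; rewrite sK sL.
Qed.

Let nb_dx y x : near_box B y x -> dx y x ^+ 2 <= B ^+ 2.
Proof.
by move=> /andP[h _]; rewrite -(real_normK (num_real (dx y x))) ler_pXn2r ?nnegrE.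
Qed.
Let nb_dy y x : near_box B y x -> dy y x ^+ 2 <= B ^+ 2.
Proof.
by move=> /andP[_ h]; rewrite -(real_normK (num_real (dy y x))) ler_pXn2r ?nnegrE.
Qed.

Lemma kern_kux : kern (kux m m1).
Proof.
apply: kernD; first exact: (kern_radial m B).
apply: kern_dd.
- by apply: measurable_funM => //; exact: measurable_funX.
- move=> y x h; rewrite normrM normrX real_normK ?num_real// (ger0_norm (ler0n _ 2)).
  by rewrite ler_pM2l// nb_dx.
- by move=> y x; rewrite /dx; ring.
Qed.

Lemma kern_kvy : kern (kvy m m1).
Proof.
apply: kernD; first exact: (kern_radial m B).
apply: kern_dd.
- by apply: measurable_funM => //; exact: measurable_funX.
- move=> y x h; rewrite normrM normrX real_normK ?num_real// (ger0_norm (ler0n _ 2)).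
  by rewrite ler_pM2l// nb_dy.
- by move=> y x; rewrite /dy; ring.
Qed.

Lemma kern_kuy : kern (kuy m1).
Proof.
apply: kern_dd.
- by apply: measurable_funM => //; exact: measurable_funM.
- move=> y x /andP[h1 h2]; rewrite -mulrA !normrM (ger0_norm (ler0n _ 2)).
  by rewrite ler_pM2l// expr2 ler_pM.
- by move=> y x; rewrite /dx /dy; ring.
Qed.

Lemma kernZ c K : kern K -> kern (fun y x => c * K y x).
Proof.
move=> [mK [M [C HK]] sK]; split.
- exact: measurable_funM.
- exists (`|c| * M), C => y x; have [K1 K0] := HK y x.
  by split; [rewrite normrM ler_wpM2l|move=> h; rewrite K0// mulr0].
- by move=> y x; rewrite sK.
Qed.

Lemma kern_kZ : kern kZ.
Proof. by apply: kernD; [exact: kern_kux|exact: kern_kvy]. Qed.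

Lemma kern_ksg : kern ksg.
Proof.
apply: kernD; first exact: kern_kux.
have := kernZ (-1) _ kern_kvy; congr kern.
by apply/funext => y; apply/funext => x; rewrite mulN1r.
Qed.

Lemma kern_kta : kern kta.
Proof. by apply: kernZ; exact: kern_kuy. Qed.


Let rad_of y : R := B + Num.max `|y.1| `|y.2|.

Let out_near y x : ~~ inbox (rad_of y) x -> ~~ near_box B y x.
Proof.
apply: contra => /near_boxD; apply.
by rewrite /inbox !le_max !lexx orbT.
Qed.

Let ku_out y x : ~~ inbox (rad_of y) x -> ku m y x = 0.
Proof. by move=> /out_near /(sqd_far _ _ _ B0) h; rewrite /ku m_out// mulr0. Qed.

Let kv_out y x : ~~ inbox (rad_of y) x -> kv m y x = 0.
Proof. by move=> /out_near /(sqd_far _ _ _ B0) h; rewrite /kv m_out// mulr0. Qed.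

Let c2 (f : R * R -> R) : smooth2 f -> continuous f.
Proof. by move=> sf; exact: (smooth_cont _ _ (sf 0%N)). Qed.

Let cku y := c2 _ (smooth2_ku m sm y).
Let ckv y := c2 _ (smooth2_kv m sm y).
Let ckux y := c2 _ (smooth2_kux m m1 sm sm1 y).
Let ckuy y := c2 _ (smooth2_kuy m1 sm1 y).
Let ckvy y := c2 _ (smooth2_kvy m m1 sm sm1 y).
Let ckuxy y := c2 _ (smooth2_kuxy m1 m2 sm1 sm2 y).
Let ckvxy y := c2 _ (smooth2_kvxy m1 m2 sm1 sm2 y).

Let du0 y x := is_derive_ku m m1 dm y x 0.
Let du1 y x := is_derive_ku m m1 dm y x 1.
Let dv0 y x := is_derive_kv m m1 dm y x 0.
Let dv1 y x := is_derive_kv m m1 dm y x 1.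
Let duy0 y x := is_derive_kuy m1 m2 dm1 y x 0.
Let duy1 y x := is_derive_kuy m1 m2 dm1 y x 1.

Let NLu y z : \int[leb2]_x (kux' y x * kvy' z x) = \int[leb2]_x (kuy' y x * kuy' z x).
Proof.
apply: (@null_lagrangian (kux' y) (kuy' y) (kuxy m1 m2 y) (kv m z) (kuy' z) (kvy' z) (rad_of z)).
- exact: ckux.
- exact: ckuy.
- exact: ckuxy.
- exact: ckv.
- exact: ckuy.
- exact: ckvy.
- exact: is_derive_kux.
- exact: duy0.
- exact: dv0.
- exact: dv1.
- exact: kv_out.
Qed.

Let NLuu y z : \int[leb2]_x (kux' y x * kuy' z x) = \int[leb2]_x (kuy' y x * kux' z x).
Proof.
apply: (@null_lagrangian (kux' y) (kuy' y) (kuxy m1 m2 y) (ku m z) (kux' z) (kuy' z) (rad_of z)).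
- exact: ckux.
- exact: ckuy.
- exact: ckuxy.
- exact: cku.
- exact: ckux.
- exact: ckuy.
- exact: is_derive_kux.
- exact: duy0.
- exact: du0.
- exact: du1.
- exact: ku_out.
Qed.

Let NLvv y z : \int[leb2]_x (kuy' y x * kvy' z x) = \int[leb2]_x (kvy' y x * kuy' z x).
Proof.
apply: (@null_lagrangian (kuy' y) (kvy' y) (kvxy m1 m2 y) (kv m z) (kuy' z) (kvy' z) (rad_of z)).
- exact: ckuy.
- exact: ckvy.
- exact: ckvxy.
- exact: ckv.
- exact: ckuy.
- exact: ckvy.
- exact: duy1.
- exact: is_derive_kvy.
- exact: dv0.
- exact: dv1.
- exact: kv_out.
Qed.

Let ii K L y z : kern K -> kern L -> integ (fun x => K y x * L z x).
Proof.
by move=> kK kL; apply: L1locM_integ; [exact/bms_L1loc/kern_bms|exact: kern_bms].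
Qed.

(** For a symmetric matrix, with X, Y on the diagonal and W off it, (X + Y)^2 - (X - Y)^2 - (2 W)^2
    is four times the determinant. Polarised for the fields centred at [y] and [z], it becomes a sum
    of two mixed determinants, each of integral zero. *)
Lemma energy_diag y z :
  Tr ksg (ksg z) y + Tr kta (kta z) y = Tr kZ (kZ z) y.
Proof.
have [iZ ig ia] := And3 (ii _ _ z y kern_kZ kern_kZ) (ii _ _ z y kern_ksg kern_ksg)
  (ii _ _ z y kern_kta kern_kta).
rewrite /Tr -RintegralD//; apply/eqP; rewrite -subr_eq0 -RintegralB//; last first.
  exact: (integrableD measurableT ig ia).
rewrite (@eq_Rintegral _ _ _ _ _ (fun x =>
  -2 * ((kux' z x * kvy' y x - kuy' z x * kuy' y x) +
        (kux' y x * kvy' z x - kuy' y x * kuy' z x)))); last first.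
  by move=> x _; rewrite /ksg /kta /kZ -/kux' -/kvy' -/kuy'; ring.
have i1 u w : integ (fun x => kux' u x * kvy' w x) := ii _ _ u w kern_kux kern_kvy.
have i2 u w : integ (fun x => kuy' u x * kuy' w x) := ii _ _ u w kern_kuy kern_kuy.
have i3 u w : integ (fun x => kux' u x * kvy' w x - kuy' u x * kuy' w x).
  exact: (integrableB measurableT (i1 u w) (i2 u w)).
rewrite RintegralZl//; last exact: (integrableD measurableT (i3 z y) (i3 y z)).
rewrite RintegralD//; [|exact: i3|exact: i3].
rewrite !RintegralB//; try (exact: i1); try (exact: i2).
by rewrite !NLu !subrr addr0 mulr0.
Qed.

(** This is the vanishing of the imaginary part of the autocorrelation of sg - i ta. Each component
    of the field contributes a null Lagrangian of its own, formed from its copies centred at [y] and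
    [z]. *)
Lemma energy_cross y z : Tr kta (ksg z) y = Tr ksg (kta z) y.
Proof.
have [iZ ig] := conj (ii _ _ z y kern_ksg kern_kta) (ii _ _ z y kern_kta kern_ksg).
rewrite /Tr; apply/eqP; rewrite -subr_eq0 -RintegralB//.
rewrite (@eq_Rintegral _ _ _ _ _ (fun x =>
  2 * ((kux' z x * kuy' y x - kuy' z x * kux' y x) +
        (kuy' z x * kvy' y x - kvy' z x * kuy' y x)))); last first.
  by move=> x _; rewrite /ksg /kta -/kux' -/kvy' -/kuy'; ring.
have i1 u w : integ (fun x => kux' u x * kuy' w x) := ii _ _ u w kern_kux kern_kuy.
have i2 u w : integ (fun x => kuy' u x * kux' w x) := ii _ _ u w kern_kuy kern_kux.
have i3 u w : integ (fun x => kuy' u x * kvy' w x) := ii _ _ u w kern_kuy kern_kvy.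
have i4 u w : integ (fun x => kvy' u x * kuy' w x) := ii _ _ u w kern_kvy kern_kuy.
rewrite RintegralZl//; last first.
  exact: (integrableD measurableT (integrableB measurableT (i1 z y) (i2 z y))
                                  (integrableB measurableT (i3 z y) (i4 z y))).
rewrite RintegralD//; last 2 first.
- exact: (integrableB measurableT (i1 z y) (i2 z y)).
- exact: (integrableB measurableT (i3 z y) (i4 z y)).
rewrite !RintegralB//; try (exact: i1); try (exact: i2); try (exact: i3); try (exact: i4).
by rewrite NLuu NLvv !subrr addr0 mulr0.
Qed.

(** A compactly supported divergence integrates to zero; this gives the mollifiers at all scales the
    same mass. *)
Lemma Rintegral_kZ y : \int[leb2]_x kZ y x = 0.
Proof.
rewrite RintegralD//; last 2 first.
- exact: bms_integ (kern_bms _ y kern_kux).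
- exact: bms_integ (kern_bms _ y kern_kvy).
have -> : \int[leb2]_x kux m m1 y x = 0.
  exact: (@Rintegral_deriv0 _ 0 (ku m y) (kux' y) (rad_of y) (ckux y) (du0 y) (ku_out y)).
rewrite add0r.
exact: (@Rintegral_deriv0 _ 1 (kv m y) (kvy' y) (rad_of y) (ckvy y) (dv1 y) (kv_out y)).
Qed.

Let test_functionS (f : R * R -> R) C : smooth2 f ->
  (forall x, ~~ inbox C x -> f x = 0) -> test_function f.
Proof.
move=> sf f0; split; first by move=> k; exact/smooth2_Ck/sf.
have cC : closed (box C : set (R * R)).
  by apply: compact_closed; [exact: norm_hausdorff|exact: compact_box].
apply: (@subclosed_compact _ _ (box C)); [exact: closed_closure|exact: compact_box|].
rewrite (closure_id (box C)).1//; apply: closureS => x /= fx.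
by apply: contraNT fx => /f0 ->.
Qed.

Section weak_gradient.
Variables (u : plane R -> 'cV[R]_2) (G : plane R -> 'M[R]_2).
Hypothesis uG : W12loc u G.

Let GL1 i j : L1loc (fun x => G x i j).
Proof.
have [_ /(_ i j)[mG iG] _] := uG; split => // B'.
have h := iG _ (compact_box B').
have h1 : leb2.-integrable (box B') (EFin \o (fun=> 1 : R)).
  exact: (L1loc_cst 1).2.
have := integrableD (measurable_box B') h h1.
apply: le_integrable => //; first exact: measurable_box.
  by apply/measurable_EFinP; exact: measurable_funTS.
move=> x _ /=; rewrite lee_fin.
have : 0 <= (`|G x i j| - 1) ^+ 2 by exact: sqr_ge0.
have : 0 <= (G x i j) ^+ 2 by exact: sqr_ge0.
move=> h3 h4; apply: (le_trans _ (ler_norm _)); move: h3 h4.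
have := real_normK (num_real (G x i j)) => <-; nra.
Qed.

(* [cfa + i cfb] and [cfal + i cfbe] are the complex derivatives f_z and f_zbar. *)
Definition cfa x := (G x 0 0 + G x 1 1) / 2.
Definition cfb x := (G x 1 0 - G x 0 1) / 2.
Definition cfal x := (G x 0 0 - G x 1 1) / 2.
Definition cfbe x := (G x 1 0 + G x 0 1) / 2.

(* The rows of [G] are curl-free, since mixed derivatives of test functions agree. *)
Let curl i (f0 f1 f01 : R * R -> R) C : smooth2 f0 -> smooth2 f1 ->
  (forall x, is_derive x (e_ 1) f0 (f01 x)) ->
  (forall x, is_derive x (e_ 0) f1 (f01 x)) ->
  (forall x, ~~ inbox C x -> f0 x = 0) -> (forall x, ~~ inbox C x -> f1 x = 0) ->
  \int[leb2]_x (G x i 0 * f1 x) = \int[leb2]_x (G x i 1 * f0 x).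
Proof.
move=> s0 s1 d0 d1 o0 o1; have [_ _ W] := uG.
apply: oppr_inj; rewrite -(W i 0 f1 (test_functionS _ _ s1 o1)).
rewrite -(W i 1 f0 (test_functionS _ _ s0 o0)).
apply: eq_Rintegral => x _; congr (_ * _).
have h1 := d1 x; have h0 := d0 x.
by rewrite (derive_val (is_derive := h1)) (derive_val (is_derive := h0)).
Qed.

Let kux_out' y x : ~~ inbox (rad_of y) x -> kux' y x = 0.
Proof. by move=> /out_near; exact: kux_out. Qed.
Let kuy_out' y x : ~~ inbox (rad_of y) x -> kuy' y x = 0.
Proof. by move=> /out_near; exact: kuy_out. Qed.
Let kvy_out' y x : ~~ inbox (rad_of y) x -> kvy' y x = 0.
Proof. by move=> /out_near; exact: kvy_out. Qed.

(** [kux] and [kuy] are the derivatives of [ku], so this is the curl of row [i] tested against [ku];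
    [curlv] does the same with [kv]. *)
Let curlu i y : \int[leb2]_x (G x i 0 * kuy' y x) = \int[leb2]_x (G x i 1 * kux' y x).
Proof.
apply: (@curl i (kux' y) (kuy' y) (kuxy m1 m2 y) (rad_of y)).
- exact: smooth2_kux.
- exact: smooth2_kuy.
- exact: is_derive_kux.
- exact: duy0.
- exact: kux_out'.
- exact: kuy_out'.
Qed.

Let curlv i y : \int[leb2]_x (G x i 0 * kvy' y x) = \int[leb2]_x (G x i 1 * kuy' y x).
Proof.
apply: (@curl i (kuy' y) (kvy' y) (kvxy m1 m2 y) (rad_of y)).
- exact: smooth2_kuy.
- exact: smooth2_kvy.
- exact: duy1.
- exact: is_derive_kvy.
- exact: kuy_out'.
- exact: kvy_out'.
Qed.

Let halfL f g : L1loc f -> L1loc g -> L1loc (fun x => (f x + g x) / 2 : R).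
Proof.
move=> [mf fi] [mg gi]; split; first by apply: measurable_funM => //; exact: measurable_funD.
move=> C; have := integrableZl (measurable_box C) (2^-1)
  (integrableD (measurable_box C) (fi C) (gi C)).
by congr integrable; apply/funext => x /=; rewrite mulrC.
Qed.

Let NL f : L1loc f -> L1loc (fun x => - f x : R).
Proof.
move=> [mf fi]; split; first exact: measurableT_comp.
move=> C; have := integrableN (fi C).
by congr integrable; apply/funext => x /=.
Qed.

Lemma L1loc_cfa : L1loc cfa. Proof. exact: halfL. Qed.
Lemma L1loc_cfb : L1loc cfb. Proof. by apply: halfL => //; exact: NL. Qed.
Lemma L1loc_cfal : L1loc cfal. Proof. by apply: halfL => //; exact: NL. Qed.
Lemma L1loc_cfbe : L1loc cfbe. Proof. exact: halfL. Qed.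

(** The real part of the relation between f_z and f_zbar. The difference of the two sides collects
    into the curl of row 0 tested with [kv] and that of row 1 tested with [ku]; for the imaginary
    part, [beurling_b], the two fields exchange their roles. *)
Lemma beurling_a y : Tr kZ cfa y = Tr ksg cfal y + Tr kta cfbe y.
Proof.
rewrite /Tr; have ia := Tr_integ _ _ y kern_kZ L1loc_cfa.
have isg := Tr_integ _ _ y kern_ksg L1loc_cfal.
have it := Tr_integ _ _ y kern_kta L1loc_cfbe.
have ist := integrableD measurableT isg it.
rewrite -RintegralD//; apply/eqP; rewrite -subr_eq0 -RintegralB//.
rewrite (@eq_Rintegral _ _ _ _ _ (fun x =>
  (G x 0 0 * kvy' y x - G x 0 1 * kuy' y x) -
  (G x 1 0 * kuy' y x - G x 1 1 * kux' y x))); last first.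
  by move=> x _; rewrite /cfa /cfal /cfbe /ksg /kta /kZ -/kux' -/kvy' -/kuy'; field.
have iG i j K : kern K -> integ (fun x => G x i j * K y x).
  by move=> kK; exact: Tr_integ.
have i1 := integrableB measurableT (iG 0 0 _ kern_kvy) (iG 0 1 _ kern_kuy).
have i2 := integrableB measurableT (iG 1 0 _ kern_kuy) (iG 1 1 _ kern_kux).
rewrite RintegralB// !RintegralB//; try (exact: iG kern_kvy); try (exact: iG kern_kuy);
  try (exact: iG kern_kux).
by rewrite curlv curlu !subrr.
Qed.

Lemma beurling_b y : Tr kZ cfb y = Tr ksg cfbe y - Tr kta cfal y.
Proof.
rewrite /Tr; have ia := Tr_integ _ _ y kern_kZ L1loc_cfb.
have isg := Tr_integ _ _ y kern_ksg L1loc_cfbe.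
have it := Tr_integ _ _ y kern_kta L1loc_cfal.
have ist := integrableB measurableT isg it.
rewrite -RintegralB//; apply/eqP; rewrite -subr_eq0 -RintegralB//.
rewrite (@eq_Rintegral _ _ _ _ _ (fun x =>
  (G x 0 0 * kuy' y x - G x 0 1 * kux' y x) +
  (G x 1 0 * kvy' y x - G x 1 1 * kuy' y x))); last first.
  by move=> x _; rewrite /cfb /cfal /cfbe /ksg /kta /kZ -/kux' -/kvy' -/kuy'; field.
have iG i j K : kern K -> integ (fun x => G x i j * K y x).
  by move=> kK; exact: Tr_integ.
have i1 := integrableB measurableT (iG 0 0 _ kern_kuy) (iG 0 1 _ kern_kux).
have i2 := integrableB measurableT (iG 1 0 _ kern_kvy) (iG 1 1 _ kern_kuy).
rewrite RintegralD// !RintegralB//; try (exact: iG kern_kvy); try (exact: iG kern_kuy);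
  try (exact: iG kern_kux).
by rewrite curlv curlu !subrr addr0.
Qed.

End weak_gradient.

End multiplier.
End kernels.

(** * Mollifiers and their masses *)

Section mollifier.
Context {R : realType}.
Implicit Types (x y z : plane R) (lam mu c : R).

(* A mollifier of mass proportional to [c] at the length scale [1 / lam]. *)
Definition zeta c lam y x : R := c * (2 * lam ^+ 2 * cslope (lam ^+ 2 * sqd y x)).

Lemma zeta_ge0 c lam y x : 0 <= c -> 0 <= zeta c lam y x.
Proof. by move=> c0; rewrite mulr_ge0// mulr_ge0 ?cslope_ge0// mulr_ge0// sqr_ge0. Qed.

Lemma zeta_out c lam y x : 0 < lam -> ~~ near_box (2 / lam) y x -> zeta c lam y x = 0.
Proof.
move=> l0 h; have l0' : 0 <= 2 / lam by rewrite divr_ge0// ltW.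
have := sqd_far _ _ _ l0' h; rewrite expr_div_n ltr_pdivrMr ?exprn_gt0// => h2.
by rewrite /zeta cslope_eq0r ?mulr0// mulrC; apply: ltW; apply: lt_trans h2; lra.
Qed.

Lemma kern_zeta c lam : 0 < lam -> kern (zeta c lam).
Proof.
move=> l0; apply: (@kern_radial _ (fun s => c * (2 * lam ^+ 2 * cslope (lam ^+ 2 * s))) (2 / lam)).
- by rewrite divr_ge0// ltW.
- have sm : smooth1 (fun s => c * (2 * lam ^+ 2 * @cslope R (lam ^+ 2 * s))).
    move=> k; apply: smoothZ; apply: smoothZ; apply: smooth1_comp => [|k'].
      exact: smooth1_cslope.
    by apply: smoothZ; exact: smooth1_id.
  exact: (smooth_cont _ _ (sm 0%N)).
move=> s; rewrite expr_div_n ltr_pdivrMr ?exprn_gt0// => h2.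
by rewrite cslope_eq0r ?mulr0// mulrC; apply: ltW; apply: lt_trans h2; lra.
Qed.

Lemma zeta_bounded : exists2 C : R, 0 < C & forall c lam y x, 0 <= c ->
  `|zeta c lam y x| <= c * C * lam ^+ 2.
Proof.
have [C C0 HC] := @cslope_bounded R; exists (2 * C); first by rewrite mulr_gt0.
move=> c lam y x c0; rewrite ger0_norm ?zeta_ge0// -mulrA ler_wpM2l//.
by rewrite mulrAC ler_wpM2r ?sqr_ge0// ler_pM2l.
Qed.

Definition origin : plane R := (0, 0).

(** Both centres lie within 1 / mu of the origin in each coordinate, so both bumps live in the box
    of radius 2 / mu + 1 / mu; there the profile is Lipschitz in the squared distance. *)
Lemma zeta_translate : exists2 L : R, 0 < L & forall c mu Y y x, 0 <= c -> 0 < mu ->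
  mu * Y <= 1 -> inbox Y y ->
  `|zeta c mu y x - zeta c mu origin x| <= c * L * Y * mu ^+ 3 * \1_(box (3 / mu)) x.
Proof.
(* 28 = 2 * 14: the factor 2 of [zeta], and two coordinates, each of which changes the squared
   distance by at most Y (Y + 6 / mu) <= 7 Y / mu. *)
have [L L0 HL] := @cslope_lipschitz R; exists (28 * L); first by rewrite mulr_gt0.
move=> c mu Y y x c0 mu0 muY yY.
have Y0 : 0 <= Y by case/andP: yY => h _; exact: le_trans h.
have Ymu : Y <= 1 / mu by rewrite ler_pdivlMr// mulrC.
have mui : 0 < 1 / mu by rewrite divr_gt0.
have e3 : 3 / mu = 2 / mu + 1 / mu by rewrite -mulrDl; congr (_ / _); lra.
have [xB|xB] := boolP (inbox (3 / mu) x); last first.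
  rewrite indicE memNset ?mulr0; last by apply/negP.
  rewrite !zeta_out ?subrr ?normr0//; apply: contra xB => /near_boxD.
    move=> /(_ (1 / mu)); rewrite e3; apply; rewrite /inbox/= !normr0.
    by rewrite ltW.
  by move=> /(_ (1 / mu)); rewrite e3; apply; exact: inboxS yY.
rewrite indicE mem_set// mulr1.
have m2 : 0 <= 2 * mu ^+ 2 by rewrite mulr_ge0// sqr_ge0.
have -> : zeta c mu y x - zeta c mu origin x = c * (2 * mu ^+ 2 *
    (cslope (mu ^+ 2 * sqd y x) - cslope (mu ^+ 2 * sqd origin x))).
  by rewrite /zeta; ring.
rewrite normrM (ger0_norm c0) normrM (ger0_norm m2) -2!(mulrA c) ler_wpM2l//.
have h := HL (mu ^+ 2 * sqd y x) (mu ^+ 2 * sqd origin x).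
have [/andP[y1 y2] /andP[x1 x2]] := conj yY xB.
have hs : `|sqd y x - sqd origin x| <= 14 * Y / mu.
  have -> : sqd y x - sqd origin x = y.1 * (y.1 - 2 * x.1) + y.2 * (y.2 - 2 * x.2).
    by rewrite /sqd /dx /dy /=; ring.
  have hh (a b : R) : `|a| <= Y -> `|b| <= 3 / mu -> `|a * (a - 2 * b)| <= 7 * Y / mu.
    move=> aY bm; rewrite normrM.
    rewrite (_ : 7 * Y / mu = Y * (1 / mu + 2 * (3 / mu))); last by field; rewrite gt_eqF.
    rewrite ler_pM// (le_trans (ler_normB _ _))// lerD//; first exact: le_trans Ymu.
    by rewrite normrM (ger0_norm (ler0n _ 2)) ler_pM2l.
  rewrite (_ : 14 * Y / mu = 7 * Y / mu + 7 * Y / mu); last by field; rewrite gt_eqF.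
  by rewrite (le_trans (ler_normD _ _))// lerD// hh.
apply: (@le_trans _ _ (2 * mu ^+ 2 * (L * (mu ^+ 2 * (14 * Y / mu))))).
  rewrite ler_wpM2l//; apply: le_trans h _.
  rewrite ler_pM2l// -mulrBr normrM (ger0_norm (sqr_ge0 mu)).
  by rewrite ler_pM2l ?exprn_gt0.
rewrite le_eqVlt; apply/orP; left; apply/eqP; field; exact: lt0r_neq0.
Qed.

End mollifier.

Section beurling_kernels.
Context {R : realType}.
Implicit Types (x y z : plane R) (lam mu c : R).

(** The multiplier is [radm] at the squared scales, because profiles are functions of the squared
    distance. The derivatives up to [m2] are exposed since the null Lagrangian involves mixed second
    derivatives of the field. *)
Lemma beurling_multiplier c mu lam : 0 < mu -> mu < lam ->
  exists (m m1 m2 : R -> R) (B : R),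
  [/\ 0 <= B /\ (forall s, B ^+ 2 < s -> m s = 0),
      (forall s : R, is_derive s 1 m (m1 s)) /\ (forall s : R, is_derive s 1 m1 (m2 s)),
      [/\ smooth1 m, smooth1 m1 & smooth1 m2] &
      forall y x, kZ m m1 y x = zeta c lam y x - zeta c mu y x].
Proof.
move=> mu0 mulam; have l0 : 0 < lam := lt_trans mu0 mulam.
have mu20 : 0 < mu ^+ 2 by rewrite exprn_gt0.
have mul2 : mu ^+ 2 < lam ^+ 2 by rewrite ltr_pXn2r// nnegrE ltW.
have [r1 dr sr1] := smooth1_deriv _ (smooth1_radm _ _ mu20 mul2).
have [r2 dr1 sr2] := smooth1_deriv _ sr1.
have dZ (f f' : R -> R) (s : R) : is_derive s 1 f (f' s) ->
    is_derive s 1 (fun s => c * f s) (c * f' s).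
  move=> df; apply: (is_derive_eq (is_derive_mulf _ _ _ _ _ _ (is_derive_cstf c s 1) df)).
  by rewrite mul0r add0r.
exists (fun s => c * radm (mu ^+ 2) (lam ^+ 2) s), (fun s => c * r1 s), (fun s => c * r2 s), (2 / mu).
split.
- split => [|s]; first by rewrite divr_ge0// ltW.
  rewrite expr_div_n ltr_pdivrMr// => h.
  by rewrite radm_eq0r ?mulr0// mulrC; apply: ltW; apply: lt_trans h; lra.
- by split => s; apply: dZ.
- by split => k; apply: smoothZ => //; exact: smooth1_radm.
move=> y x; have := is_derive_radmM _ _ _ _ mu20 mul2 (dr (sqd y x)).
rewrite /kZ /kux /kvy /zeta => e.
transitivity (2 * c * (radm (mu ^+ 2) (lam ^+ 2) (sqd y x) + sqd y x * r1 (sqd y x))).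
  set p := radm _ _ _; set q := r1 _.
  by rewrite (_ : sqd y x = dx y x ^+ 2 + dy y x ^+ 2)//; ring.
by rewrite e; ring.
Qed.

(* With complex notation S = sg - i ta, the fields say that f_zbar * S equals
   f_z * (zeta lam - zeta mu): S is a truncation of the Beurling kernel. *)
Lemma beurling_kernel c mu lam : 0 < mu -> mu < lam ->
  exists sg ta : plane R -> plane R -> R,
  [/\ kern sg, kern ta,
      (forall K, (forall y x, K y x = zeta c lam y x - zeta c mu y x) ->
        (forall y z, Tr sg (sg z) y + Tr ta (ta z) y = Tr K (K z) y) /\
        (forall u G, W12loc u G -> forall y,
          Tr K (cfa G) y = Tr sg (cfal G) y + Tr ta (cfbe G) y /\
          Tr K (cfb G) y = Tr sg (cfbe G) y - Tr ta (cfal G) y)),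
      (forall y z, Tr ta (sg z) y = Tr sg (ta z) y) &
      (forall y, \int[leb2]_x (zeta c lam y x - zeta c mu y x) = 0)].
Proof.
move=> mu0 mulam.
have [m [m1 [m2 [B [[B0 m_out] [dm dm1] [sm sm1 sm2] KE]]]]] := beurling_multiplier c _ _ mu0 mulam.
exists (ksg m m1), (kta m1); split.
- exact: (kern_ksg m m1 B).
- exact: (kern_kta m m1 B).
- move=> K HK; have -> : K = kZ m m1.
    by apply/funext => y; apply/funext => x; rewrite HK KE.
  split; first exact: (energy_diag m m1 m2 B).
  move=> u G uG y; split; first exact: (beurling_a m m1 m2 B B0 dm dm1 sm sm1 m_out u G uG y).
  exact: (beurling_b m m1 m2 B B0 dm dm1 sm sm1 m_out u G uG y).
- exact: (energy_cross m m1 m2 B).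
- move=> y; rewrite -(Rintegral_kZ m m1 B B0 dm sm sm1 m_out y).
  by apply: eq_Rintegral => x _; rewrite KE.
Qed.

Lemma zeta_integ c lam y : 0 < lam -> integ (zeta c lam y).
Proof. by move=> l0; exact: bms_integ (kern_bms _ y (kern_zeta c lam l0)). Qed.

Let mass c lam y := \int[leb2]_x zeta c lam y x.

Let mass_scale c mu lam y : 0 < mu -> mu < lam -> mass c lam y = mass c mu y.
Proof.
move=> mu0 mulam; have [sg [ta [_ _ _ _ /(_ y)]]] := beurling_kernel c mu lam mu0 mulam.
have i1 := zeta_integ c lam y (lt_trans mu0 mulam); have i2 := zeta_integ c mu y mu0.
rewrite (RintegralB measurableT i1 i2).
by move/eqP; rewrite subr_eq0 => /eqP.
Qed.

Lemma Rintegral_indic_box B : 0 <= B -> \int[leb2]_x (\1_(box B) (x : plane R)) = (2 * B) ^+ 2 :> R.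
Proof.
move=> B0; rewrite /Rintegral integral_indic//; last exact: measurable_box.
by rewrite setIT leb2_box.
Qed.

Lemma max_inbox y : inbox (Num.max `|y.1| `|y.2|) y.
Proof. by rewrite /inbox !le_max !lexx orbT. Qed.

(** In place of a change of variables, the mass is computed at a smaller scale parameter mu, where
    moving the centre changes the kernel by O(mu^3) on a box of area 36 / mu^2, and hence the mass
    by O(mu). *)
Let mass_center lam y : 0 < lam -> mass 1 lam y = mass 1 lam origin.
Proof.
move=> l0; have [L L0 HL] := @zeta_translate R.
pose Y := Num.max `|y.1| `|y.2|.
have Y0 : 0 <= Y by rewrite le_max normr_ge0.
have key mu : 0 < mu -> mu < lam -> mu * Y <= 1 ->
    `|mass 1 lam y - mass 1 lam origin| <= 36 * L * Y * mu.
  move=> mu0 mulam muY; rewrite !(mass_scale _ mu lam)//.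
  have i1 := zeta_integ 1 mu y mu0; have i0 := zeta_integ 1 mu origin mu0.
  rewrite -RintegralB//; apply: le_trans (le_normr_Rintegral _ (integrableB measurableT i1 i0)) _ => //.
  have iB := bms_integ _ (bms_indic_box (3 / mu)).
  have m3 : 0 <= 3 / mu by rewrite divr_ge0// ltW.
  apply: (@le_trans _ _ (\int[leb2]_x (L * Y * mu ^+ 3 * \1_(box (3 / mu)) x))).
    apply: le_Rintegral => //.
    - exact: (integrable_abse (integrableB measurableT i1 i0)).
    - exact: (integrableZl measurableT (L * Y * mu ^+ 3) iB).
    - move=> x _; have := HL 1 mu Y y x ler01 mu0 muY (max_inbox y).
      by rewrite mul1r.
  rewrite RintegralZl// Rintegral_indic_box//.
  by rewrite le_eqVlt; apply/orP; left; apply/eqP; field; exact: lt0r_neq0.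
apply/eqP; rewrite -subr_eq0 -normr_le0; apply/ler_addgt0Pl => e e0; rewrite addr0.
pose D := 36 * L * Y + 1.
have D0 : 0 < D by rewrite ltr_wpDl// !mulr_ge0// ltW.
pose mu := Num.min (lam / 2) (Num.min (1 / (Y + 1)) (e / D)).
have mu0 : 0 < mu by rewrite !lt_min !divr_gt0// ltr_wpDl.
have mulam : mu < lam.
  by rewrite /mu gt_min; apply/orP; left; rewrite ltr_pdivrMr// ltr_pMr// ltr1n.
have muY : mu * Y <= 1.
  apply: (@le_trans _ _ (1 / (Y + 1) * Y)).
    by rewrite ler_wpM2r// /mu !ge_min lexx /= orbT.
  by rewrite mulrAC mul1r ler_pdivrMr ?mul1r ?lerDl// ltr_wpDl.
apply: le_trans (key mu mu0 mulam muY) _.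
apply: (@le_trans _ _ (D * (e / D))); last by rewrite mulrC divfK// gt_eqF.
rewrite ler_pM//; [by rewrite !mulr_ge0// ltW|exact: ltW|by rewrite /D lerDl|].
by rewrite /mu !ge_min lexx !orbT.
Qed.

Let mass_gt0 : 0 < mass 1 1 origin.
Proof.
(* On the rectangle [1.1, 1.2] x [0, 0.1] the squared distance to the origin lies in [1.21, 1.45],
   inside the interval (1, 2) where [cslope] is positive. *)
pose I1 : set R := `[11 / 10, 12 / 10]%classic; pose I2 : set R := `[0, 1 / 10]%classic.
have mI1 : measurable I1 by exact: measurable_itv.
have mI2 : measurable I2 by exact: measurable_itv.
pose D : set (plane R) := I1 `*` I2.
have mD : measurable D by exact: measurableX.
have muD : leb2 D = (1 / 100)%:E.
  have e := @product_measure1E _ _ _ _ R lebesgue_measure lebesgue_measure _ _ mI1 mI2.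
  change ((lebesgue_measure \x lebesgue_measure)%E (I1 `*` I2) = (1 / 100)%:E).
  rewrite e /I1 /I2 /= !lebesgue_measure_itv/= !lte_fin.
  rewrite ifT; last by lra.
  rewrite ifT; last by lra.
  by rewrite -!EFinD -EFinM; congr EFin; field.
have cs : {within `[121 / 100, 145 / 100], continuous (@cslope R)}.
  by apply: continuous_subspaceT; exact: (smooth_cont _ _ (smooth1_cslope 0%N)).
have h : 121 / 100 <= 145 / 100 :> R by lra.
have [s0 s0I s0m] := EVT_min h cs.
have k0 : 0 < cslope s0.
  by move: s0I; rewrite in_itv/= => /andP[h1 h2]; apply: cslope_gt0; lra.
have bD : bms (\1_D : plane R -> R).
  split; first exact: measurable_indic.
  exists 1, 2 => x; rewrite indicE; split; first by case: (_ \in _); rewrite ?normr1 ?normr0.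
  move=> xB; rewrite memNset// => -[]; rewrite /I1 /I2 /= !in_itv/= => /andP[a1 a2] /andP[a3 a4].
  by move/negP: xB; apply; rewrite /inbox !ger0_norm; try lra; apply/andP; split; lra.
have iD := bms_integ _ bD.
apply: (@lt_le_trans _ _ (\int[leb2]_x (2 * cslope s0 * \1_D (x : plane R)))).
  rewrite RintegralZl// /Rintegral integral_indic// setIT muD.
  have h2 : 0 < 1 / 100 :> R by lra.
  exact: mulr_gt0 (mulr_gt0 (ltr0Sn R 1) k0) h2.
apply: le_Rintegral => //.
- exact: (integrableZl measurableT (2 * cslope s0) iD).
- exact: zeta_integ.
move=> x _; rewrite /zeta mul1r expr1n mulr1 mul1r indicE.
have [xD|xD] := pselect (D x); last by rewrite memNset// mulr0 mulr_ge0// cslope_ge0.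
rewrite mem_set// mulr1 ler_pM2l//; apply: s0m.
have [] := xD; rewrite /I1 /I2 /= !in_itv/= => /andP[a1 a2] /andP[a3 a4].
by rewrite /sqd /dx /dy /= !subr0; apply/andP; split; nra.
Qed.

Definition unit_mass : R := (mass 1 1 origin)^-1.

Lemma unit_mass_gt0 : 0 < unit_mass. Proof. by rewrite invr_gt0 mass_gt0. Qed.

Lemma Rintegral_zeta lam y : 0 < lam -> \int[leb2]_x zeta unit_mass lam y x = 1.
Proof.
move=> l0.
have -> : \int[leb2]_x zeta unit_mass lam y x = unit_mass * mass 1 lam y.
  rewrite /mass -RintegralZl//; last exact: zeta_integ.
  by apply: eq_Rintegral => x _; rewrite /zeta mul1r.
rewrite mass_center// /unit_mass (_ : mass 1 lam origin = mass 1 1 origin).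
  by rewrite mulVf// gt_eqF// mass_gt0.
have [h|h|->//] := ltgtP lam 1; first by rewrite (mass_scale 1 lam 1).
by rewrite (mass_scale 1 1 lam).
Qed.

End beurling_kernels.

(** * The Beurling estimate *)

Section inner_product.
Context {R : realType}.
Implicit Types (f g h a : plane R -> R) (K : plane R -> plane R -> R) (x y z : plane R).

Definition ip f g := \int[leb2]_x (f x * g x).

Lemma ipE f g : ip f g = \int[leb2]_x (f x * g x).
Proof. by []. Qed.

Lemma TrE K a y : Tr K a y = \int[leb2]_x (a x * K y x).
Proof. by []. Qed.

(* Otherwise unification unfolds [ip] and [Tr] down to the measure. *)
#[local] Opaque ip Tr unit_mass zeta.

Lemma bmsD f g : bms f -> bms g -> bms (fun x => f x + g x).
Proof.
move=> [mf [M [B Hf]]] [mg [N [C Hg]]]; split; first exact: measurable_funD.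
exists (M + N), (Num.max B C) => x; have [f1 f0] := Hf x; have [g1 g0] := Hg x.
split; first by rewrite (le_trans (ler_normD _ _))// lerD.
move=> h; rewrite f0 ?g0 ?addr0//; apply: contra h; apply: inboxS;
  by rewrite le_max lexx ?orbT.
Qed.

Lemma bmsZ c f : bms f -> bms (fun x => c * f x).
Proof.
move=> [mf [M [B Hf]]]; split; first exact: measurable_funM.
exists (`|c| * M), B => x; have [f1 f0] := Hf x; split.
  by rewrite normrM ler_wpM2l.
by move=> h; rewrite f0// mulr0.
Qed.

Lemma bmsB f g : bms f -> bms g -> bms (fun x => f x - g x).
Proof.
move=> bf /(bmsZ (-1)) bg; have := bmsD _ _ bf bg.
by congr bms; apply/funext => x; rewrite mulN1r.
Qed.

Lemma bms_norm f : bms f -> bms (fun x => `|f x|).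
Proof.
move=> [mf [M [B Hf]]]; split; first exact: measurableT_comp.
exists M, B => x; have [f1 f0] := Hf x; split; first by rewrite normr_id.
by move=> h; rewrite f0// normr0.
Qed.

Lemma bms_mul f g : bms f -> bms g -> bms (fun x => f x * g x).
Proof.
move=> bf bg; apply: bmsM => //; first exact: bms_L1loc.
by move=> B; have [_ [M [B' Hf]]] := bf; exists M => x _; have [] := Hf x.
Qed.

Lemma ip_integ f g : L1loc f -> bms g -> integ (fun x => f x * g x).
Proof. exact: L1locM_integ. Qed.

Lemma ipC f g : ip f g = ip g f.
Proof. by rewrite !ipE; apply: eq_Rintegral => x _; rewrite mulrC. Qed.

Lemma ipDr f g h : L1loc f -> bms g -> bms h ->
  ip f (fun x => g x + h x) = ip f g + ip f h.
Proof.
move=> lf bg bh; rewrite !ipE -(RintegralD measurableT (ip_integ _ _ lf bg) (ip_integ _ _ lf bh)).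
by apply: eq_Rintegral => x _; rewrite mulrDr.
Qed.

Lemma ipBr f g h : L1loc f -> bms g -> bms h ->
  ip f (fun x => g x - h x) = ip f g - ip f h.
Proof.
move=> lf bg bh; rewrite !ipE -(RintegralB measurableT (ip_integ _ _ lf bg) (ip_integ _ _ lf bh)).
by apply: eq_Rintegral => x _; rewrite mulrBr.
Qed.

Lemma ip_addE h p q r : integ (fun x => h x * p x) -> integ (fun x => h x * q x) ->
  (forall x, r x = p x + q x) -> ip h r = ip h p + ip h q.
Proof.
move=> ip1 iq rE; rewrite !ipE -(RintegralD measurableT ip1 iq).
by apply: eq_Rintegral => x _; rewrite rE mulrDr.
Qed.

Lemma ip_subE h p q r : integ (fun x => h x * p x) -> integ (fun x => h x * q x) ->
  (forall x, r x = p x - q x) -> ip h r = ip h p - ip h q.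
Proof.
move=> ip1 iq rE; rewrite !ipE -(RintegralB measurableT ip1 iq).
by apply: eq_Rintegral => x _; rewrite rE mulrBr.
Qed.

Lemma Tr_adjoint K a f : kern K -> L1loc a -> bms f -> ip f (Tr K a) = ip a (Tr K f).
Proof. exact: Tr_adj. Qed.

Lemma TrB K a b y : kern K -> L1loc a -> L1loc b ->
  Tr K (fun x => a x - b x) y = Tr K a y - Tr K b y.
Proof.
move=> kK la lb; rewrite !TrE.
rewrite -(RintegralB measurableT (Tr_integ _ _ y kK la) (Tr_integ _ _ y kK lb)).
by apply: eq_Rintegral => x _; rewrite mulrBl.
Qed.

Lemma Tr_kernB K L a y : kern K -> kern L -> L1loc a ->
  Tr (fun y x => K y x - L y x) a y = Tr K a y - Tr L a y.
Proof.
move=> kK kL la; rewrite !TrE.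
rewrite -(RintegralB measurableT (Tr_integ _ _ y kK la) (Tr_integ _ _ y kL la)).
by apply: eq_Rintegral => x _; rewrite mulrBr.
Qed.

Lemma kernB K L : kern K -> kern L -> kern (fun y x => K y x - L y x :> R).
Proof.
move=> kK kL; have := kernD _ _ kK (kernZ (-1) _ kL); congr kern.
by apply/funext => y; apply/funext => x; rewrite mulN1r.
Qed.

(** This stands in for the associativity of convolution: applied to [f], the two operators act as
    the single kernel [Tr L (K y)]. *)
Lemma Tr_comp K L f y : kern K -> kern L -> bms f ->
  Tr K (Tr L f) y = ip f (Tr L (K y)).
Proof.
move=> kK kL bf; rewrite -Tr_adjoint//; [|exact: bms_L1loc|exact: kern_bms].
by rewrite !TrE ipC.
Qed.

Lemma ip_eq f g h : g =1 h -> ip f g = ip f h.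
Proof. by move=> e; rewrite !ipE; apply: eq_Rintegral => x _; rewrite e. Qed.

(* |S * theta| and |Z * theta| have the same L^2 norm because the two
   kernels have the same autocorrelation. *)
Lemma energy_conv (sg ta Z : plane R -> plane R -> R) f g :
  kern sg -> kern ta -> kern Z ->
  (forall y z, Tr sg (sg z) y + Tr ta (ta z) y = Tr Z (Z z) y) ->
  (forall y z, Tr ta (sg z) y = Tr sg (ta z) y) -> bms f -> bms g ->
  let A x := Tr sg f x - Tr ta g x in let B x := Tr ta f x + Tr sg g x in
  ip A A + ip B B = ip (Tr Z f) (Tr Z f) + ip (Tr Z g) (Tr Z g).
Proof.
move=> ks kt kZ KE KC bf bg A B.
have bT K h : kern K -> bms h -> bms (Tr K h) by exact: Tr_bms.
have [sf sg' tf tg] := And4 (bT _ _ ks bf) (bT _ _ ks bg) (bT _ _ kt bf) (bT _ _ kt bg).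
have r1 (p q r : R) : p - q + (r + q) = p + r by ring.
have r2 (p q r : R) : p + q - (p - r) = q + r by ring.
have r3 (p1 p2 p3 p4 : R) : p1 - p2 + (p3 + p4) = p1 + p3 + (p4 - p2) by ring.
have bA : bms A by exact: bmsB.
have bB : bms B by exact: bmsD.
have lA := bms_L1loc _ bA; have lB := bms_L1loc _ bB.
have [lf lg] := conj (bms_L1loc _ bf) (bms_L1loc _ bg).
have eA y : Tr sg A y + Tr ta B y = Tr Z (Tr Z f) y.
  rewrite /A /B TrB ?TrD//; try exact: bms_L1loc.
  rewrite !Tr_comp//.
  have e1 : ip f (Tr Z (Z y)) = ip f (Tr sg (sg y)) + ip f (Tr ta (ta y)).
    rewrite -ipDr//; [|apply: bT => //; exact: kern_bms|apply: bT => //; exact: kern_bms].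
    by apply: ip_eq => x; rewrite KE.
  have e2 : ip g (Tr ta (sg y)) = ip g (Tr sg (ta y)) by apply: ip_eq => x; rewrite KC.
  rewrite e1 e2; exact: r1.
have eB y : Tr sg B y - Tr ta A y = Tr Z (Tr Z g) y.
  rewrite /A /B TrB ?TrD//; try exact: bms_L1loc.
  rewrite !Tr_comp//.
  have e1 : ip g (Tr Z (Z y)) = ip g (Tr sg (sg y)) + ip g (Tr ta (ta y)).
    rewrite -ipDr//; [|apply: bT => //; exact: kern_bms|apply: bT => //; exact: kern_bms].
    by apply: ip_eq => x; rewrite KE.
  have e2 : ip f (Tr ta (sg y)) = ip f (Tr sg (ta y)) by apply: ip_eq => x; rewrite KC.
  rewrite e1 e2; exact: r2.
have adjZ h : bms h -> ip (Tr Z h) (Tr Z h) = ip h (Tr Z (Tr Z h)).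
  by move=> bh; rewrite (Tr_adjoint _ _ _ kZ (bms_L1loc _ (bT _ _ kZ bh)) bh).
rewrite !adjZ// -(ip_eq _ _ _ eA) -(ip_eq _ _ _ eB).
rewrite (ipDr f _ _ lf (bT _ _ ks bA) (bT _ _ kt bB)) (ipBr g _ _ lg (bT _ _ ks bB) (bT _ _ kt bA)).
rewrite (Tr_adjoint sg A f)// (Tr_adjoint ta B f)// (Tr_adjoint sg B g)// (Tr_adjoint ta A g)//.
rewrite [ip A A](ipBr A _ _ lA sf tg) [ip B B](ipDr B _ _ lB tf sg').
exact: r3.
Qed.

Notation zn := (zeta (@unit_mass R)).

Let um0 := ltW (@unit_mass_gt0 R).

Lemma Tr_zn_ge0 lam f y : (forall x, 0 <= f x) -> 0 <= Tr (zn lam) f y.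
Proof. by move=> f0; rewrite TrE; apply: Rintegral_ge0 => x _; rewrite mulr_ge0// zeta_ge0. Qed.

Lemma Tr_zn_norm lam f y : 0 < lam -> L1loc f ->
  `|Tr (zn lam) f y| <= Tr (zn lam) (fun x => `|f x|) y.
Proof.
move=> l0 lf; have i := Tr_integ _ _ y (kern_zeta unit_mass lam l0) lf.
rewrite !TrE; apply: le_trans (le_normr_Rintegral _ i) _ => //.
rewrite le_eqVlt; apply/orP; left; apply/eqP; apply: eq_Rintegral => x _.
by rewrite normrM [`|zn _ _ _|]ger0_norm// zeta_ge0.
Qed.

Lemma Tr_zn_cst lam c y : 0 < lam -> Tr (zn lam) (fun=> c) y = c.
Proof.
by move=> l0; rewrite !TrE RintegralZl// ?Rintegral_zeta ?mulr1//; exact: zeta_integ.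
Qed.

Lemma Rintegral_Tr_zn lam f : 0 < lam -> bms f ->
  \int[leb2]_x Tr (zn lam) f x = \int[leb2]_x f x.
Proof.
move=> l0 bf; transitivity (ip (fun=> 1) (Tr (zn lam) f)).
  by rewrite ipE; apply: eq_Rintegral => x _; rewrite mul1r.
rewrite -Tr_adjoint//; [|exact: kern_zeta|exact: L1loc_cst].
by rewrite ipE; apply: eq_Rintegral => x _; rewrite Tr_zn_cst// mulr1.
Qed.

Lemma Rintegral_Tr_zn_norm lam f : 0 < lam -> bms f ->
  \int[leb2]_x `|Tr (zn lam) f x| <= \int[leb2]_x `|f x|.
Proof.
move=> l0 bf; have kz := kern_zeta unit_mass lam l0.
rewrite -(Rintegral_Tr_zn lam (fun x => `|f x|))//; last exact: bms_norm.
apply: le_Rintegral => //.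
- exact/bms_integ/bms_norm/Tr_bms.
- exact/bms_integ/Tr_bms/bms_norm.
- by move=> x _; apply: Tr_zn_norm => //; exact: bms_L1loc.
Qed.

(** Jensen's inequality for the probability density [zn lam y], read off from the non-negative mean
    of (f - p)^2, where p is the mean of f. *)
Lemma Tr_zn_sqr lam f y : 0 < lam -> bms f ->
  Tr (zn lam) f y ^+ 2 <= Tr (zn lam) (fun x => f x * f x) y.
Proof.
move=> l0 bf; have kz := kern_zeta unit_mass lam l0.
set p := Tr (zn lam) f y.
have := Tr_zn_ge0 lam (fun x => (f x - p) ^+ 2) y (fun x => sqr_ge0 _).
rewrite (_ : (fun x => _) = (fun x => (f x * f x + p ^+ 2) - (2 * p) * f x)); last first.
  by apply/funext => x; ring.
have l2 : L1loc (fun x => f x * f x) := bms_L1loc _ (bms_mul _ _ bf bf).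
have lc := L1loc_cst (p ^+ 2).
have lz := bms_L1loc _ (bmsZ (2 * p) _ bf).
have lD : L1loc (fun x => f x * f x + p ^+ 2).
  split; first by apply: measurable_funD => //; exact: l2.1.
  by move=> B; exact: (integrableD (measurable_box B) (l2.2 B) (lc.2 B)).
rewrite TrB// TrD// Tr_zn_cst//.
have -> : Tr (zn lam) (fun x => 2 * p * f x) y = 2 * p * p.
  have pE : p = \int[leb2]_x (f x * zn lam y x) by rewrite /p TrE.
  rewrite TrE [X in _ = _ * X]pE.
  rewrite -(RintegralZl (2 * p) measurableT (Tr_integ _ _ y kz (bms_L1loc _ bf))).
  by apply: eq_Rintegral => x _; rewrite mulrA.
by rewrite expr2; lra.
Qed.

Lemma Tr_zn_energy lam f : 0 < lam -> bms f ->
  ip (Tr (zn lam) f) (Tr (zn lam) f) <= ip f f.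
Proof.
move=> l0 bf; have kz := kern_zeta unit_mass lam l0.
have b2 := bms_mul _ _ bf bf.
rewrite [leRHS](_ : _ = \int[leb2]_x Tr (zn lam) (fun x => f x * f x) x); last first.
  by rewrite Rintegral_Tr_zn// ipE.
rewrite ipE; apply: le_Rintegral => //.
- by apply: bms_integ; apply: bms_mul; exact: Tr_bms.
- exact/bms_integ/Tr_bms.
- by move=> x _; rewrite -expr2; exact: Tr_zn_sqr.
Qed.

(** The coefficient of [ip f f] has to stay 1. The average with parameter mu is at most a multiple
    of mu^2 times the L^1 norm of [f], so it adds only an error that vanishes with mu. *)
Lemma Tr_znB_energy : exists2 C : R, 0 <= C & forall mu lam f, 0 < mu -> mu < lam -> bms f ->
  let q := Tr (fun y x => zn lam y x - zn mu y x) f in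
  ip q q <= ip f f + C * mu ^+ 2 * (\int[leb2]_x `|f x|) ^+ 2.
Proof.
(* With E a uniform bound for |q|, (p - q)^2 <= p^2 + 2 E |p| + E |q|. Mollification does not
   increase the L^1 norm, so the last two terms contribute three times E times the norm of [f]. *)
have [C C0 HC] := @zeta_bounded R; exists (3 * (unit_mass * C)).
  by rewrite mulr_ge0// mulr_ge0// ltW.
move=> mu lam f mu0 mulam bf; have l0 := lt_trans mu0 mulam; rewrite /=.
set N := \int[leb2]_x `|f x|.
have N0 : 0 <= N by apply: Rintegral_ge0.
have [kl km] := conj (kern_zeta unit_mass lam l0) (kern_zeta unit_mass mu mu0).
have [p pE] : exists p, p = Tr (zn lam) f := ex_intro _ _ erefl.
have [q qE] : exists q, q = Tr (zn mu) f := ex_intro _ _ erefl.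
have [bp bq] : bms p /\ bms q by rewrite pE qE; split; exact: Tr_bms.
have [E EE] : exists E, E = unit_mass * C * mu ^+ 2 * N
  by exists (unit_mass * C * mu ^+ 2 * N).
have qb x : `|q x| <= E.
  by rewrite EE qE; apply: Tr_bound => // y x'; exact: HC.
have E0 : 0 <= E by exact: le_trans (qb origin).
have b1 : bms (fun x => 2 * E * `|p x| + E * `|q x|) :=
  bmsD _ _ (bmsZ (2 * E) _ (bms_norm _ bp)) (bmsZ E _ (bms_norm _ bq)).
have bB : bms (Tr (fun y x => zn lam y x - zn mu y x) f) := Tr_bms _ _ (kernB _ _ kl km) bf.
have bpp := bms_mul _ _ bp bp.
apply: (@le_trans _ _ (\int[leb2]_x (p x * p x + (2 * E * `|p x| + E * `|q x|)))).
  rewrite ipE; apply: le_Rintegral => //.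
  - exact: bms_integ _ (bms_mul _ _ bB bB).
  - exact: bms_integ _ (bmsD _ _ bpp b1).
  move=> x _; rewrite (Tr_kernB _ _ _ x kl km (bms_L1loc _ bf)).
  rewrite -pE -qE; move: (p x) (q x) (qb x) => P Q QE.
  have := ler_norm (- (P * Q)); rewrite normrN normrM => h0.
  have e : `|Q| * `|Q| = Q * Q by rewrite -!expr2 real_normK ?num_real.
  have h5 : `|P| * `|Q| <= `|P| * E by rewrite ler_wpM2l.
  have h6 : `|Q| * `|Q| <= E * `|Q| by rewrite ler_wpM2r.
  lra.
have i1 := bms_integ _ bpp.
have i2 := bms_integ _ (bms_norm _ bp); have i3 := bms_integ _ (bms_norm _ bq).
have i4 := bms_integ _ (bmsZ (2 * E) _ (bms_norm _ bp)).
have i5 := bms_integ _ (bmsZ E _ (bms_norm _ bq)).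
have ib1 := bms_integ _ b1.
rewrite (RintegralD measurableT i1 ib1) (RintegralD measurableT i4 i5).
rewrite (RintegralZl (2 * E) measurableT i2) (RintegralZl E measurableT i3).
apply: lerD; first by rewrite -(ipE p p) pE; exact: Tr_zn_energy.
apply: (@le_trans _ _ (2 * E * N + E * N)).
  by rewrite pE qE; apply: lerD; rewrite ler_wpM2l ?mulr_ge0//; exact: Rintegral_Tr_zn_norm.
by rewrite EE le_eqVlt; apply/orP; left; apply/eqP; ring.
Qed.

Let fin (C X Q a b d n1 n2 w1 w2 v : R) : d = a + b -> a <= n1 + C * v * w1 ->
  b <= n2 + C * v * w2 -> X <= Q / 2 + d / 2 ->
  X <= Q / 2 + (n1 + n2) / 2 + C / 2 * v * (w1 + w2).
Proof. by move=> ->; lra. Qed.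

Let amgm (a b p q : R) : a * p + b * q <= (a ^+ 2 + b ^+ 2) / 2 + (p * p + q * q) / 2.
Proof. by have := sqr_ge0 (a - p); have := sqr_ge0 (b - q); nra. Qed.

(** Moving the kernels onto the test pair leaves q paired with the pair (A, B), whose energy is that
    of Z applied to the test pair, hence at most that of the test pair up to O(mu^2), independently
    of lam. Young's inequality with weights 1/2 finishes. *)
Lemma main_inequality : exists2 C : R, 0 <= C &
  forall (u : plane R -> 'cV[R]_2) (G : plane R -> 'M[R]_2) mu lam f g,
  W12loc u G -> integ (fun x => cfal G x ^+ 2 + cfbe G x ^+ 2) ->
  0 < mu -> mu < lam -> bms f -> bms g ->
  ip f (Tr (zn lam) (cfa G)) + ip g (Tr (zn lam) (cfb G)) -
  (ip f (Tr (zn mu) (cfa G)) + ip g (Tr (zn mu) (cfb G))) <=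
  (\int[leb2]_x (cfal G x ^+ 2 + cfbe G x ^+ 2)) / 2 + (ip f f + ip g g) / 2 +
  C * mu ^+ 2 * ((\int[leb2]_x `|f x|) ^+ 2 + (\int[leb2]_x `|g x|) ^+ 2).
Proof.
have [C C0 HC] := Tr_znB_energy; exists (C / 2); first by rewrite divr_ge0.
move=> u G mu lam f g uG iq mu0 mulam bf bg; have l0 := lt_trans mu0 mulam.
have [kl km] := conj (kern_zeta unit_mass lam l0) (kern_zeta unit_mass mu mu0).
have [sg [ta [ks kt H KC _]]] := beurling_kernel unit_mass mu lam mu0 mulam.
have [K KE0] : exists K, K = (fun y x => zn lam y x - zn mu y x) by eexists.
have kK : kern K by rewrite KE0; exact: kernB.
have [KE /(_ u G uG) HB] : _ /\ _ := H K (fun y x => congr1 (fun k => k y x) KE0).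
have [la lb lal lbe] := And4 (L1loc_cfa _ _ uG) (L1loc_cfb _ _ uG) (L1loc_cfal _ _ uG) (L1loc_cfbe _ _ uG).
have [lf lg] := conj (bms_L1loc _ bf) (bms_L1loc _ bg).
have bT K' h : kern K' -> bms h -> bms (Tr K' h) by exact: Tr_bms.
pose A x := Tr sg f x - Tr ta g x; pose B x := Tr ta f x + Tr sg g x.
have bA : bms A := bmsB _ _ (bT _ _ ks bf) (bT _ _ kt bg).
have bB : bms B := bmsD _ _ (bT _ _ kt bf) (bT _ _ ks bg).
have iTr T a h : kern T -> L1loc a -> bms h -> integ (fun x => h x * Tr T a x).
  exact: Tr_integM.
have ipB h a : bms h -> L1loc a ->
    ip h (Tr (zn lam) a) - ip h (Tr (zn mu) a) = ip h (Tr K a).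
  move=> bh la'; symmetry.
  apply: (ip_subE h _ _ _ (iTr _ _ _ kl la' bh) (iTr _ _ _ km la' bh)) => x.
  by rewrite KE0; exact: Tr_kernB.
have r4 (p q r s : R) : p + q + (r - s) = p - s + (q + r) by ring.
have e0 (p q r s : R) : p + q - (r + s) = (p - r) + (q - s) by ring.
have -> : ip f (Tr (zn lam) (cfa G)) + ip g (Tr (zn lam) (cfb G)) -
  (ip f (Tr (zn mu) (cfa G)) + ip g (Tr (zn mu) (cfb G))) =
  ip f (Tr K (cfa G)) + ip g (Tr K (cfb G)).
  by rewrite -(ipB f _ bf la) -(ipB g _ bg lb); exact: e0.
have e1 : ip f (Tr K (cfa G)) = ip f (Tr sg (cfal G)) + ip f (Tr ta (cfbe G)).
  by apply: (ip_addE f _ _ _ (iTr _ _ _ ks lal bf) (iTr _ _ _ kt lbe bf)) => x; have [] := HB x.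
have e2 : ip g (Tr K (cfb G)) = ip g (Tr sg (cfbe G)) - ip g (Tr ta (cfal G)).
  by apply: (ip_subE g _ _ _ (iTr _ _ _ ks lbe bg) (iTr _ _ _ kt lal bg)) => x; have [] := HB x.
have -> : ip f (Tr K (cfa G)) + ip g (Tr K (cfb G)) = ip (cfal G) A + ip (cfbe G) B.
  rewrite e1 e2 (Tr_adjoint sg (cfal G) f)// (Tr_adjoint ta (cfbe G) f)//.
  rewrite (Tr_adjoint sg (cfbe G) g)// (Tr_adjoint ta (cfal G) g)//.
  rewrite (ipBr _ _ _ lal (bT _ _ ks bf) (bT _ _ kt bg)).
  rewrite (ipDr _ _ _ lbe (bT _ _ kt bf) (bT _ _ ks bg)).
  exact: r4.
have EN : ip A A + ip B B = ip (Tr K f) (Tr K f) + ip (Tr K g) (Tr K g).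
  exact: energy_conv.
have h1 := HC mu lam f mu0 mulam bf; have h2 := HC mu lam g mu0 mulam bg.
rewrite /= -KE0 in h1 h2.
suff : ip (cfal G) A + ip (cfbe G) B <=
    (\int[leb2]_x (cfal G x ^+ 2 + cfbe G x ^+ 2)) / 2 + (ip A A + ip B B) / 2.
  exact: (fin _ _ _ _ _ _ _ _ _ _ _ EN h1 h2).
have [iA iB] := conj (ip_integ _ _ lal bA) (ip_integ _ _ lbe bB).
have [iAA iBB] := conj (bms_integ _ (bms_mul _ _ bA bA)) (bms_integ _ (bms_mul _ _ bB bB)).
have iAB := integrableD measurableT iAA iBB.
rewrite !ipE -(RintegralD measurableT iA iB) -(RintegralD measurableT iAA iBB).
rewrite -(RintegralZr _ measurableT iq) -(RintegralZr _ measurableT iAB).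
have iq2 := integrableZr measurableT (2^-1) iq; have iAB2 := integrableZr measurableT (2^-1) iAB.
rewrite -(RintegralD measurableT iq2 iAB2).
apply: le_Rintegral => //.
- exact: (integrableD measurableT iA iB).
- exact: (integrableD measurableT iq2 iAB2).
Qed.

End inner_product.

(** * Averages at large scales *)

Section large_scale_limit.
Context {R : realType}.
Implicit Types (f g w d : plane R -> R) (x y z : plane R) (mu lam : R).
Notation zn := (zeta (@unit_mass R)).
Let um0 := ltW (@unit_mass_gt0 R).
#[local] Opaque ip Tr unit_mass zeta.

Lemma ler_small (X Y A mu0 : R) : 0 < mu0 ->
  (forall mu, 0 < mu -> mu < mu0 -> X <= Y + A * mu) -> X <= Y.
Proof.
move=> mu00 H; apply/ler_addgt0Pl => e e0.
pose mu := Num.min (mu0 / 2) (e / (`|A| + 1)).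
have A0 : 0 < `|A| + 1 by rewrite ltr_wpDl.
have m0 : 0 < mu by rewrite lt_min !divr_gt0.
have m1 : mu < mu0.
  by rewrite /mu gt_min ltr_pdivrMr// ltr_pMr// ltr1n.
have m2 : mu <= e / (`|A| + 1) by rewrite /mu ge_min lexx orbT.
apply: le_trans (H mu m0 m1) _; rewrite addrC lerD2r.
apply: (@le_trans _ _ ((`|A| + 1) * mu)).
  by rewrite ler_wpM2r ?(ltW m0)// (le_trans (ler_norm A))// lerDl.
by rewrite mulrC -ler_pdivlMr.
Qed.

(** Averages of a function bounded by a constant plus an integrable function vary by O(mu) over a
    fixed box: the kernel changes by O(mu^3), on a region of area O(1 / mu^2). *)
Lemma Tr_translate : exists2 L : R, 0 < L & forall w d D mu Y y, L1loc w ->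
  integ d -> \int[leb2]_x d x <= D -> (forall x, `|w x| <= 2 + d x) -> (forall x, 0 <= d x) ->
  0 < mu -> mu <= 1 -> mu * Y <= 1 -> inbox Y y ->
  `|Tr (zn mu) w y - Tr (zn mu) w origin| <= L * Y * (72 + D) * mu.
Proof.
have [L L0 HL] := @zeta_translate R.
exists (unit_mass * L); first by rewrite mulr_gt0// unit_mass_gt0.
move=> w d D mu Y y lw id dD wd d0 mu0 mu1 muY yY.
have Y0 : 0 <= Y by case/andP: yY => h _; exact: le_trans h.
have kz := kern_zeta unit_mass mu mu0.
have i1 := Tr_integ _ _ y kz lw; have i0 := Tr_integ _ _ origin kz lw.
have iB := bms_integ _ (bms_indic_box (3 / mu)).
have m3 : 0 <= 3 / mu by rewrite divr_ge0// ltW.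
have i2B := integrableZl measurableT 2 iB.
have iS := integrableD measurableT i2B id.
pose E := unit_mass * L * Y * mu ^+ 3.
have E0 : 0 <= E by rewrite !mulr_ge0 ?exprn_ge0// ltW// unit_mass_gt0.
rewrite !TrE -(RintegralB measurableT i1 i0).
have i10 := integrableB measurableT i1 i0.
apply: le_trans (le_normr_Rintegral measurableT i10) _.
apply: (@le_trans _ _ (\int[leb2]_x (E * (2 * \1_(box (3 / mu)) x + d x)))).
  apply: le_Rintegral => //.
  - exact: (integrable_abse i10).
  - exact: (integrableZl measurableT E iS).
  move=> x _; rewrite -mulrBr normrM mulrC.
  have := HL unit_mass mu Y y x um0 mu0 muY yY; rewrite -/E indicE.
  have [xB|xB] := boolP (inbox (3 / mu) x).
    by rewrite mem_set// !mulr1 => h; rewrite ler_pM.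
  rewrite memNset ?mulr0; last by apply/negP.
  by rewrite normr_le0 => /eqP ->; rewrite normr0 mul0r mulr_ge0// add0r.
rewrite (RintegralZl E measurableT iS) (RintegralD measurableT i2B id).
rewrite (RintegralZl 2 measurableT iB) Rintegral_indic_box//.
(* 72 = 2 * 36: the bound 2 times the area 36 / mu^2 of the box. As mu <= 1, the integral of [d] may
   be enlarged by the same factor 1 / mu^2. *)
apply: (@le_trans _ _ (E * (72 / mu ^+ 2 + D / mu ^+ 2))).
  rewrite ler_wpM2l// lerD//.
    by rewrite le_eqVlt; apply/orP; left; apply/eqP; field; exact: lt0r_neq0.
  have D0 : 0 <= D by apply: le_trans dD; apply: Rintegral_ge0.
  by rewrite (le_trans dD)// ler_pdivlMr ?exprn_gt0// ler_piMr// exprn_ile1// ltW.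
rewrite /E le_eqVlt; apply/orP; left; apply/eqP; field; exact: lt0r_neq0.
Qed.

(** With F lam the average at the origin, any two of the intervals [F lam - C lam, F lam + C lam]
    meet, so the supremum of the left ends lies in all of them. This gives the limit together with a
    linear rate, which [Tr_translate] carries from the origin to boxes. *)
Lemma limit_at_large_scale w d C : L1loc w -> integ d -> (forall x, `|w x| <= 2 + d x) ->
  (forall x, 0 <= d x) ->
  (forall mu lam, 0 < mu -> mu < lam ->
    `|Tr (zn lam) w origin - Tr (zn mu) w origin| <= C * lam) ->
  exists c, forall Y, exists2 A, 0 <= A & exists2 mu0, 0 < mu0 &
    forall mu y, 0 < mu -> mu < mu0 -> inbox Y y -> `|Tr (zn mu) w y - c| <= A * mu.
Proof.
move=> lw id wd d0 HC.
have C0 : 0 <= C.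
  have h : (1:R) < 2 by rewrite ltr1n.
  have := le_trans (normr_ge0 _) (HC 1 2 ltr01 h).
  by rewrite pmulr_lge0.
pose F mu := Tr (zn mu) w origin.
have HF mu lam : 0 < mu -> mu <= lam -> `|F lam - F mu| <= C * lam.
  move=> mu0; rewrite le_eqVlt => /predU1P[<-|]; last exact: HC.
  by rewrite subrr normr0 mulr_ge0// ltW.
pose S := [set F lam - C * lam | lam in [set lam : R | 0 < lam]].
have S0 : S !=set0 by exists (F 1 - C * 1), 1 => //=.
have ubS mu : 0 < mu -> ubound S (F mu + C * mu).
  move=> mu0 _ [lam /= lam0 <-]; rewrite lerBlDr.
  have [h|h] := leP mu lam.
    have := HF mu lam mu0 h; rewrite ler_norml => /andP[_]; rewrite lerBlDr => h1.
    apply: le_trans h1 _; rewrite addrC -addrA lerD2l lerDr.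
    by rewrite mulr_ge0// ltW.
  have := HF lam mu lam0 (ltW h); rewrite ler_norml => /andP[+ _].
  rewrite lerBrDr addrC lerBlDr => h1; apply: le_trans h1 _.
  by rewrite lerDl mulr_ge0// ltW.
pose c := sup S.
have cF mu : 0 < mu -> `|F mu - c| <= C * mu.
  move=> mu0; have h1 : c <= F mu + C * mu by apply: ge_sup => //; exact: ubS.
  have h2 : F mu - C * mu <= c.
    apply: ub_le_sup; last by exists mu.
    by exists (F mu + C * mu); exact: ubS.
  by move: (F mu) (C * mu) c h1 h2 => p q r; rewrite ler_norml => *; apply/andP; split; lra.
exists c => Y; have [L L0 HL] := Tr_translate.
pose D := \int[leb2]_x d x; have D0 : 0 <= D by exact: Rintegral_ge0.
exists (L * `|Y| * (72 + D) + C).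
  by rewrite addr_ge0// !mulr_ge0 ?addr_ge0// ltW.
exists (Num.min 1 (1 / (`|Y| + 1))).
  by rewrite lt_min ltr01 divr_gt0// ltr_wpDl.
move=> mu y mu0; rewrite lt_min => /andP[mu1 muY] yY.
have yY' : inbox `|Y| y by apply: inboxS yY; exact: ler_norm.
have muY' : mu * `|Y| <= 1.
  have := ltW muY; rewrite ler_pdivlMr ?ltr_wpDl// => /(le_trans _); apply.
  by rewrite ler_wpM2l ?(ltW mu0)// lerDl.
rewrite mulrDl -(subrKA (F mu)); apply: le_trans (ler_normD _ _) _; apply: lerD.
  exact: (HL w d D mu `|Y| y lw id (lexx _) wd d0 mu0 (ltW mu1) muY' yY').
exact: cF.
Qed.

End large_scale_limit.

Section gradient_limit.
Context {R : realType}.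
Implicit Types (f g w d p q : plane R -> R) (x y z : plane R) (mu lam : R).
Notation zn := (zeta (@unit_mass R)).
Let um0 := ltW (@unit_mass_gt0 R).
#[local] Opaque ip Tr unit_mass zeta.

Let amgm2 (lam a b p q : R) : 0 < lam ->
  `|a * p + b * q| <= lam / 2 * (a ^+ 2 + b ^+ 2) + (2 * lam)^-1 * (p * p + q * q).
Proof.
move=> l0.
have e : lam / 2 * (a ^+ 2 + b ^+ 2) + (2 * lam)^-1 * (p * p + q * q) =
  (lam / 2) * ((a + p / lam) ^+ 2 + (b + q / lam) ^+ 2) - (a * p + b * q).
  by field; exact: lt0r_neq0.
have e' : lam / 2 * (a ^+ 2 + b ^+ 2) + (2 * lam)^-1 * (p * p + q * q) =
  (lam / 2) * ((a - p / lam) ^+ 2 + (b - q / lam) ^+ 2) + (a * p + b * q).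
  by field; exact: lt0r_neq0.
have l2 : 0 <= lam / 2 by rewrite divr_ge0// ltW.
rewrite ler_norml; apply/andP; split.
  by rewrite e opprB lerBlDr -lerBlDl subrr mulr_ge0// addr_ge0// sqr_ge0.
by rewrite e' lerDr mulr_ge0// addr_ge0// sqr_ge0.
Qed.

Lemma ip_young lam a b p q : 0 < lam -> L1loc a -> L1loc b -> bms p -> bms q ->
  integ (fun x => a x ^+ 2 + b x ^+ 2) ->
  `|ip a p + ip b q| <=
    lam / 2 * \int[leb2]_x (a x ^+ 2 + b x ^+ 2) + (2 * lam)^-1 * (ip p p + ip q q).
Proof.
move=> l0 la lb bp bq iab.
have [i1 i2] := conj (ip_integ _ _ la bp) (ip_integ _ _ lb bq).
have i12 : integ (fun x => a x * p x + b x * q x) := integrableD measurableT i1 i2.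
have [j1 j2] := conj (bms_integ _ (bms_mul _ _ bp bp)) (bms_integ _ (bms_mul _ _ bq bq)).
have j12 : integ (fun x => p x * p x + q x * q x) := integrableD measurableT j1 j2.
have k1 : integ (fun x => lam / 2 * (a x ^+ 2 + b x ^+ 2)) := integrableZl measurableT (lam / 2) iab.
have k2 : integ (fun x => (2 * lam)^-1 * (p x * p x + q x * q x)) :=
  integrableZl measurableT (2 * lam)^-1 j12.
rewrite !ipE -(RintegralD measurableT i1 i2) -(RintegralD measurableT j1 j2).
rewrite -(RintegralZl _ measurableT iab) -(RintegralZl _ measurableT j12).
rewrite -(RintegralD measurableT k1 k2).
apply: le_trans (le_normr_Rintegral measurableT i12) _.
apply: (le_Rintegral measurableT).
- exact: (integrable_abse i12).
- exact: (integrableD measurableT k1 k2).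
- by move=> x _; exact: amgm2.
Qed.

Variables (u : plane R -> 'cV[R]_2) (G : plane R -> 'M[R]_2).
Hypothesis uG : W12loc u G.
Hypothesis iq : integ (fun x => cfal G x ^+ 2 + cfbe G x ^+ 2).

Let Q := \int[leb2]_x (cfal G x ^+ 2 + cfbe G x ^+ 2).

Let scale_bound (lam X N E : R) : 0 < lam -> 0 <= E -> N <= E * lam ^+ 2 ->
  X <= lam / 2 * Q + (2 * lam)^-1 * N -> X <= (Q / 2 + E / 2) * lam.
Proof.
move=> l0 E0 NE XN; apply: le_trans XN _.
rewrite [leRHS]mulrDl; apply: lerD.
  by rewrite le_eqVlt; apply/orP; left; apply/eqP; ring.
rewrite ler_pdivrMl ?mulr_gt0//; apply: le_trans NE _.
by rewrite le_eqVlt; apply/orP; left; apply/eqP; field.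
Qed.

(** The kernel S centred at the origin has the energy of Z = zeta lam - zeta mu, which is at most
    sup |Z| times the L^1 norm of Z, hence O(lam^2) uniformly in mu. Young's inequality with weight
    lam bounds the pairing of q with S by O(lam). *)
Let scale_step : exists C : R, forall mu lam, 0 < mu -> mu < lam ->
  `|Tr (zn lam) (cfa G) origin - Tr (zn mu) (cfa G) origin| <= C * lam /\
  `|Tr (zn lam) (cfb G) origin - Tr (zn mu) (cfb G) origin| <= C * lam.
Proof.
have [C C0 HC] := @zeta_bounded R.
(* 4 = 2 * 2: sup |Z| is at most twice [unit_mass * C * lam ^+ 2], and the L^1 norm of Z is at most
   2, the sum of two unit masses. *)
pose E := 4 * (unit_mass * C).
have E0 : 0 <= E by rewrite !mulr_ge0// ltW.
exists (Q / 2 + E / 2) => mu lam mu0 mulam; have l0 := lt_trans mu0 mulam.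
have [kl km] := conj (kern_zeta unit_mass lam l0) (kern_zeta unit_mass mu mu0).
have [sg [ta [ks kt H KC _]]] := beurling_kernel unit_mass mu lam mu0 mulam.
have [K KE0] : exists K, K = (fun y x => zn lam y x - zn mu y x) := ex_intro _ _ erefl.
have kK : kern K by rewrite KE0; exact: kernB.
have [KE /(_ u G uG origin) [Ba Bb]] : _ /\ _ := H K (fun y x => congr1 (fun k => k y x) KE0).
have [la lb lal lbe] := And4 (L1loc_cfa _ _ uG) (L1loc_cfb _ _ uG) (L1loc_cfal _ _ uG) (L1loc_cfbe _ _ uG).
have [bs bt] := conj (kern_bms _ origin ks) (kern_bms _ origin kt).
have nE : ip (sg origin) (sg origin) + ip (ta origin) (ta origin) <= E * lam ^+ 2.
  have h := KE origin origin; rewrite !TrE in h; rewrite !ipE h -TrE.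
  apply: le_trans (ler_norm _) _.
  have Kb y x : `|K y x| <= 2 * (unit_mass * C * lam ^+ 2).
    rewrite KE0; apply: le_trans (ler_normB _ _) _.
    rewrite [leRHS](_ : _ = unit_mass * C * lam ^+ 2 + unit_mass * C * lam ^+ 2); last by ring.
    apply: lerD; first exact: HC.
    apply: le_trans (HC unit_mass mu y x um0) _.
    apply: ler_wpM2l; first by rewrite mulr_ge0// ltW.
    by rewrite ler_pXn2r ?nnegrE//; do ?exact: ltW.
  apply: le_trans (Tr_bound _ _ _ origin Kb kK (kern_bms _ origin kK)) _.
  have N2 : \int[leb2]_x `|K origin x| <= 2.
    have [zl zm] := conj (zeta_integ unit_mass lam origin l0) (zeta_integ unit_mass mu origin mu0).
    have zlm : integ (fun x => zn lam origin x + zn mu origin x) := integrableD measurableT zl zm.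
    apply: (@le_trans _ _ (\int[leb2]_x (zn lam origin x + zn mu origin x))).
      apply: (le_Rintegral measurableT _ zlm).
        exact: bms_integ _ (bms_norm _ (kern_bms _ origin kK)).
      move=> x _; rewrite KE0; apply: le_trans (ler_normB _ _) _.
      by rewrite !ger0_norm// zeta_ge0.
    by rewrite (RintegralD measurableT zl zm) !Rintegral_zeta.
  apply: (@le_trans _ _ (2 * (unit_mass * C * lam ^+ 2) * 2)).
    by rewrite ler_wpM2l// !mulr_ge0 ?sqr_ge0// ltW.
  by rewrite /E le_eqVlt; apply/orP; left; apply/eqP; ring.
have TK w : L1loc w -> Tr (zn lam) w origin - Tr (zn mu) w origin = Tr K w origin.
  by move=> lw; rewrite KE0 Tr_kernB.
rewrite !TK// Ba Bb; split; apply: (scale_bound _ _ _ _ l0 E0 nE).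
  rewrite (TrE sg) (TrE ta) -(ipE (cfal G)) -(ipE (cfbe G)).
  exact: ip_young.
have iq' : integ (fun x => cfbe G x ^+ 2 + cfal G x ^+ 2).
  by move: iq; congr integ; apply/funext => x; rewrite addrC.
have bt' := bmsZ (-1) _ bt.
have := ip_young lam _ _ _ _ l0 lbe lal bs bt' iq'.
have -> : \int[leb2]_x (cfbe G x ^+ 2 + cfal G x ^+ 2) = Q.
  by apply: eq_Rintegral => x _; rewrite addrC.
have -> : ip (fun x => -1 * ta origin x) (fun x => -1 * ta origin x) = ip (ta origin) (ta origin).
  by rewrite !ipE; apply: eq_Rintegral => x _; ring.
have -> : ip (cfal G) (fun x => -1 * ta origin x) = - ip (cfal G) (ta origin).
  rewrite !ipE -[RHS]mulN1r -(RintegralZl (-1) measurableT (ip_integ _ _ lal bt)).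
  by apply: eq_Rintegral => x _; ring.
by rewrite (TrE sg) (TrE ta) -(ipE (cfal G)) -(ipE (cfbe G)).
Qed.

Definition modulus x : R := Num.sqrt (cfa G x ^+ 2 + cfb G x ^+ 2).

Hypothesis id2 : integ (fun x => (modulus x - 1) ^+ 2).

(** Here |p| - 1 in L^2 enters: p is bounded by 2 plus an integrable function, as [Tr_translate]
    requires. *)
Let sqrt_bound (a b : R) : `|a| <= 2 + (Num.sqrt (a ^+ 2 + b ^+ 2) - 1) ^+ 2.
Proof.
have h : `|a| <= Num.sqrt (a ^+ 2 + b ^+ 2).
  by rewrite -sqrtr_sqr ler_wsqrtr// lerDl sqr_ge0.
apply: le_trans h _; move: (Num.sqrt _) => r.
by have := sqr_ge0 (r - 3 / 2); nra.
Qed.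

Let fin (A1 A2 CW mu X1 X2 x1 x2 k1 k2 q n v : R) : x1 - k1 <= A1 * mu ->
  x2 - k2 <= A2 * mu -> X1 + X2 - (x1 + x2) <= q + n + v -> v <= CW * mu ->
  X1 + X2 - (k1 + k2) <= q + n + (A1 + A2 + CW) * mu.
Proof. by lra. Qed.

(** This is [main_inequality] as mu tends to 0 at fixed lam: the test functions have bounded
    support, on which the averages at scale 1 / mu converge uniformly to the constants. *)
Lemma gradient_limit : exists c1 c2 : R, forall lam f g, 0 < lam -> bms f -> bms g ->
  ip f (Tr (zn lam) (cfa G)) + ip g (Tr (zn lam) (cfb G)) -
  (c1 * \int[leb2]_x f x + c2 * \int[leb2]_x g x) <= Q / 2 + (ip f f + ip g g) / 2.
Proof.
have [C0 HC0] := scale_step.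
have [la lb] := conj (L1loc_cfa _ _ uG) (L1loc_cfb _ _ uG).
have d0 x : 0 <= (modulus x - 1) ^+ 2 by exact: sqr_ge0.
have ab x : `|cfa G x| <= 2 + (modulus x - 1) ^+ 2 by exact: sqrt_bound.
have bb x : `|cfb G x| <= 2 + (modulus x - 1) ^+ 2.
  by rewrite /modulus addrC [cfa G x ^+ 2 + _]addrC addrC; exact: sqrt_bound.
have [c1 H1] := limit_at_large_scale _ _ C0 la id2 ab d0 (fun mu lam m0 ml => (HC0 mu lam m0 ml).1).
have [c2 H2] := limit_at_large_scale _ _ C0 lb id2 bb d0 (fun mu lam m0 ml => (HC0 mu lam m0 ml).2).
exists c1, c2 => lam f g l0 bf bg.
have [C C0' HC] := @main_inequality R.
have lim w c h : L1loc w -> bms h ->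
    (forall Y, exists2 A, 0 <= A & exists2 mu0, 0 < mu0 &
    forall mu y, 0 < mu -> mu < mu0 -> inbox Y y -> `|Tr (zn mu) w y - c| <= A * mu) ->
    exists2 A, 0 <= A & exists2 mu0, 0 < mu0 & forall mu, 0 < mu -> mu < mu0 ->
      ip h (Tr (zn mu) w) - c * \int[leb2]_x h x <= A * mu.
  move=> lw bh H; have [_ [M [Y Hh]]] := bh; have [A A0 [mu0 mu00 HA]] := H Y.
  have N0 : 0 <= \int[leb2]_x `|h x| by exact: Rintegral_ge0.
  exists (A * \int[leb2]_x `|h x|); first by rewrite mulr_ge0.
  exists mu0 => // mu m0 m1; have kz := kern_zeta unit_mass mu m0.
  have i1 := Tr_integM _ _ _ kz lw bh; have i2 := bms_integ _ (bmsZ c _ bh).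
  have i3 := bms_integ _ bh; have i4 := bms_integ _ (bms_norm _ bh).
  have i12 : integ (fun x => h x * Tr (zn mu) w x - c * h x) := integrableB measurableT i1 i2.
  rewrite -(RintegralZl c measurableT i3) ipE -(RintegralB measurableT i1 i2).
  rewrite mulrAC -(RintegralZl (A * mu) measurableT i4).
  apply: (le_Rintegral measurableT i12); first exact: (integrableZl measurableT (A * mu) i4).
  move=> x _; have [_ h0] := Hh x.
  have [xY|xY] := boolP (inbox Y x); last by rewrite h0// normr0 !mul0r !mulr0 subr0.
  rewrite [c * _]mulrC -mulrBr; apply: le_trans (ler_norm _) _.
  by rewrite normrM mulrC ler_wpM2r//; exact: HA.
have [A1 A10 [m1 m10 HA1]] := lim _ _ _ la bf H1.
have [A2 A20 [m2 m20 HA2]] := lim _ _ _ lb bg H2.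
pose W := (\int[leb2]_x `|f x|) ^+ 2 + (\int[leb2]_x `|g x|) ^+ 2.
have W0 : 0 <= W by rewrite addr_ge0// sqr_ge0.
apply: (@ler_small _ _ _ (A1 + A2 + C * W) (Num.min (Num.min m1 m2) (Num.min lam 1))).
  by rewrite !lt_min m10 m20 l0 ltr01.
move=> mu mu0; rewrite !lt_min => /andP[/andP[mm1 mm2] /andP[ml mo]].
have h1 := HA1 mu mu0 mm1; have h2 := HA2 mu mu0 mm2.
have h3 := HC u G mu lam f g uG iq mu0 ml bf bg; rewrite -/W -/Q in h3.
have h4 : C * mu ^+ 2 * W <= C * W * mu.
  rewrite mulrAC ler_wpM2l ?mulr_ge0// expr2 ler_piMr//; exact: ltW.
exact: (fin _ _ _ _ _ _ _ _ _ _ _ _ _ h1 h2 h3 h4).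
Qed.

End gradient_limit.

(** * Removal of the mollifier *)

Section small_scale_limit.
Context {R : realType}.
Implicit Types (f g w d p q : plane R -> R) (x y z : plane R) (mu lam : R).
Notation zn := (zeta (@unit_mass R)).
Let um0 := ltW (@unit_mass_gt0 R).
#[local] Opaque ip Tr unit_mass zeta.

Definition lip f := exists2 L, 0 <= L &
  forall x y, `|f x - f y| <= L * (`|x.1 - y.1| + `|x.2 - y.2|).

Lemma Tr_zn_lip f L lam x : 0 < lam -> 0 <= L -> bms f ->
  (forall x y, `|f x - f y| <= L * (`|x.1 - y.1| + `|x.2 - y.2|)) ->
  `|Tr (zn lam) f x - f x| <= 4 * L / lam.
Proof.
move=> l0 L0 bf Hf; have kz := kern_zeta unit_mass lam l0.
have lf := bms_L1loc _ bf; have lc := L1loc_cst (f x).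
have zi := zeta_integ unit_mass lam x l0.
have ifc : integ (fun y => (f y - f x) * zn lam x y).
  have h : L1loc (fun y => f y - f x).
    split; first by apply: measurable_funB => //; exact: lf.1.
    by move=> B; exact: (integrableB (measurable_box B) (lf.2 B) (lc.2 B)).
  exact: Tr_integ.
have -> : Tr (zn lam) f x - f x = \int[leb2]_y ((f y - f x) * zn lam x y).
  by rewrite -[X in _ - X](Tr_zn_cst lam (f x) x l0) -(TrB _ _ _ x kz lf lc) TrE.
apply: le_trans (le_normr_Rintegral measurableT ifc) _.
have zi2 : integ (fun y => 4 * L / lam * zn lam x y) := integrableZl measurableT (4 * L / lam) zi.
apply: (@le_trans _ _ (\int[leb2]_y (4 * L / lam * zn lam x y))); last first.
  by rewrite (RintegralZl _ measurableT zi) Rintegral_zeta ?mulr1.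
apply: (le_Rintegral measurableT _ zi2); first exact: (integrable_abse ifc).
move=> y _; rewrite normrM [`|zn _ _ _|]ger0_norm ?zeta_ge0//.
have [/andP[h1 h2]|h] := boolP (near_box (2 / lam) x y); last first.
  by rewrite zeta_out// !mulr0.
rewrite ler_wpM2r ?zeta_ge0//; apply: le_trans (Hf y x) _.
rewrite (_ : 4 * L / lam = L * (2 / lam + 2 / lam)); last by ring.
by rewrite ler_wpM2l// lerD.
Qed.

(** The mollifier is moved onto [f], where it is uniformly close to the identity, while [w] need
    only be integrable near the support of [f]. For lam >= 1 the mollified function stays in the box
    of radius 2 + B. *)
Lemma lipschitz_limit w f : L1loc w -> bms f -> lip f ->
  exists A, forall lam, 1 <= lam -> ip w f - ip f (Tr (zn lam) w) <= A / lam.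
Proof.
move=> lw bf [L L0 Hf]; have [_ [M [B HB]]] := bf.
have ib := ip_integ _ _ (lw) (bms_indic_box (2 + B)).
have iw : integ (fun x => `|w x * \1_(box (2 + B)) x|) := integrable_abse ib.
exists (4 * L * \int[leb2]_x `|w x * \1_(box (2 + B)) x|) => lam lam1.
have l0 : 0 < lam by exact: lt_le_trans lam1.
have kz := kern_zeta unit_mass lam l0.
have bT := Tr_bms _ _ kz bf.
rewrite (Tr_adjoint _ _ _ kz lw bf).
have [i1 i2] := conj (ip_integ _ _ lw bf) (ip_integ _ _ lw bT).
have i12 : integ (fun x => w x * f x - w x * Tr (zn lam) f x) := integrableB measurableT i1 i2.
rewrite !ipE -(RintegralB measurableT i1 i2) mulrAC -(RintegralZl _ measurableT iw).
apply: (le_Rintegral measurableT i12); first exact: (integrableZl measurableT (4 * L / lam) iw).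
move=> x _; rewrite -mulrBr; apply: le_trans (ler_norm _) _; rewrite !normrM.
have [xB|xB] := boolP (inbox (2 + B) x).
  rewrite indicE mem_set// normr1 mulr1 mulrC ler_wpM2r// distrC.
  exact: Tr_zn_lip.
have f0 : f x = 0.
  have [_ ->//] := HB x; apply: contra xB; apply: inboxS.
  by rewrite lerDr.
have T0 : Tr (zn lam) f x = 0.
  apply: (Tr_eq0 _ _ (2 / lam) B).
  - by move=> y z; exact: zeta_out.
  - by move=> y; have [] := HB y.
  - apply: contra xB; apply: inboxS; rewrite lerD2r ler_pdivrMr//.
    by rewrite ler_peMr.
by rewrite f0 T0 subrr normr0 mulr0 !mulr_ge0// invr_ge0 ltW.
Qed.

End small_scale_limit.

(** * Density of Lipschitz functions *)

Section averages1.
Context {R : realType}.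
Notation mu := (@lebesgue_measure R).
Implicit Types (k : R -> R) (s t y : R).

Definition win s y t : R := if `|t - y| < s then 1 else 0.

(** Means are taken in one variable at a time, so that differentiation of integrals is needed on the
    line only. *)
Definition avg1 s k y : R := (2 * s)^-1 * \int[mu]_t (k t * win s y t).

Lemma winE s y : win s y = \1_(ball y s) :> (R -> R).
Proof.
apply/funext => t; rewrite /win indicE; case: ifPn => h.
  by rewrite mem_set// -ball_normE /ball_/= distrC.
by rewrite memNset// -ball_normE /ball_/= distrC; exact/negP.
Qed.

Definition bms1 k := measurable_fun setT k /\
  exists M B, forall t, `|k t| <= M /\ (B < `|t| -> k t = 0).

Lemma bms1_integrable k : bms1 k -> mu.-integrable setT (EFin \o k).
Proof.
move=> [mk [M [B H]]].
have := integrableZl measurableT M (integrable_indic_itv (- B) B true false).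
apply: le_integrable => //; first exact/measurable_EFinP.
move=> t _ /=; rewrite indicE; have [kM k0] := H t.
have [tB|tB] := leP `|t| B.
  by rewrite mem_set ?mulr1 ?lee_fin ?(le_trans kM) ?ler_norm// /= in_itv/= -ler_norml.
by rewrite k0// normr0 lee_fin.
Qed.

Lemma win_integrable s y : mu.-integrable setT (EFin \o win s y).
Proof.
have [s0|s0] := leP s 0.
  rewrite winE (_ : ball y s = set0); last exact/ball0.
  by rewrite indic0; exact: integrable0.
by rewrite winE ball_itv; exact: integrable_indic_itv.
Qed.

Lemma Rintegral_win s y : 0 <= s -> \int[mu]_t win s y t = 2 * s.
Proof.
move=> s0; rewrite winE /Rintegral integral_indic//; last exact: measurable_ball.
rewrite setIT; have /= -> := lebesgue_measure_ball y s0.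
by rewrite /= mulr_natl.
Qed.

Lemma bms1_win k s y : bms1 k -> mu.-integrable setT (EFin \o (fun t => k t * win s y t)).
Proof.
move=> [mk [M [B H]]]; apply: bms1_integrable; split.
  apply: measurable_funM => //; rewrite winE; apply: measurable_indic.
  exact: measurable_ball.
exists M, B => t; have [kM k0] := H t; split; last by move=> /k0 ->; rewrite mul0r.
by rewrite normrM /win; case: ifP; rewrite ?normr1 ?mulr1// normr0 mulr0 (le_trans _ kM).
Qed.

Lemma avg1_bound k s y M : 0 < s -> bms1 k -> (forall t, `|k t| <= M) -> `|avg1 s k y| <= M.
Proof.
move=> s0 bk kM; have s2 : 0 < 2 * s by rewrite mulr_gt0.
rewrite normrM gtr0_norm ?invr_gt0// ler_pdivrMl// [leRHS]mulrC.
have i := bms1_win _ s y bk; have iw := win_integrable s y.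
rewrite -(Rintegral_win s y (ltW s0)) -(RintegralZl M measurableT iw).
apply: le_trans (le_normr_Rintegral measurableT i) _.
apply: (le_Rintegral measurableT); first exact: (integrable_abse i).
  exact: (integrableZl measurableT M iw).
move=> t _; rewrite normrM [`|win _ _ _|]ger0_norm; last by rewrite /win; case: ifP.
by rewrite ler_wpM2r//; rewrite /win; case: ifP.
Qed.

Lemma avg1_davg k s y : 0 < s -> bms1 k -> (`|avg1 s k y - k y|%:E <= davg k y s)%E.
Proof.
move=> s0 bk; have s2 : 0 < 2 * s by rewrite mulr_gt0.
have i := bms1_win _ s y bk; have iw := win_integrable s y.
have iw2 : mu.-integrable setT (EFin \o (fun t => k y * win s y t)) := integrableZl measurableT (k y) iw.
have i2 : mu.-integrable setT (EFin \o (fun t => k t * win s y t - k y * win s y t)).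
  exact: (integrableB measurableT i iw2).
have -> : avg1 s k y - k y = (2 * s)^-1 * \int[mu]_t (k t * win s y t - k y * win s y t).
  rewrite (RintegralB measurableT i iw2) (RintegralZl _ measurableT iw) Rintegral_win ?ltW//.
  by rewrite /avg1 mulrBr [k y * _]mulrC mulKf// gt_eqF.
rewrite normrM gtr0_norm ?invr_gt0// /davg /iavg lebesgue_measure_ball ?(ltW s0)//.
rewrite EFinM (EFin_normr_Rintegral measurableT i2) inver mulrn_eq0/= gt_eqF//=.
rewrite (_ : s *+ 2 = 2 * s); last by rewrite mulr_natl.
apply: lee_wpmul2l; first by rewrite lee_fin invr_ge0 ltW.
apply: le_trans (le_abse_integral mu measurableT (measurable_int _ i2)) _.
rewrite [leRHS]integral_mkcond le_eqVlt; apply/orP; left; apply/eqP.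
apply: eq_integral => t _ /=; rewrite patchE -mulrBl winE indicE.
by case: (t \in _); rewrite ?mulr1 ?mulr0 ?normr0.
Qed.

Lemma near_right_seq (P : R -> Prop) : (\forall r \near 0^'+, P r) ->
  \forall n \near \oo, P (n.+1%:R^-1).
Proof.
move=> [d /= d0 H]; near=> n; apply: H => /=; last by rewrite invr_gt0.
rewrite sub0r normrN ger0_norm ?invr_ge0//.
by near: n; exact: (near_infty_natSinv_lt (PosNum d0)).
Unshelve. all: by end_near. Qed.

Lemma avg1_cvg k : bms1 k -> {ae mu, forall y, avg1 (n.+1%:R^-1) k y @[n --> \oo] --> k y}.
Proof.
move=> bk; have [A [mA A0 subA]] := lebesgue_differentiation (open_integrable_locally openT (bms1_integrable _ bk)).
exists A; split => // y; apply: contra_notP => yA.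
have Ly : lebesgue_pt k y by apply: contrapT => h; apply: yA; apply: subA.
apply/cvgrPdistC_le => e e0.
have : \forall r \near 0^'+, (davg k y r < e%:E)%E.
  have := Ly [set x | (x < e%:E)%E]; apply.
  by apply: (@open_nbhs_nbhs _ 0%E); split; [exact: open_ereal_lt_ereal|rewrite /= lte_fin].
move=> /near_right_seq; apply: filterS => n h.
by rewrite -lee_fin; apply: le_trans (avg1_davg _ _ _ _ bk) (ltW h); rewrite invr_gt0.
Qed.

Lemma avg1_out k s y B : (forall t, B < `|t| -> k t = 0) -> B + s <= `|y| -> avg1 s k y = 0.
Proof.
move=> k0 yB; rewrite /avg1 (@eq_Rintegral _ _ _ _ _ (fun=> 0)).
  by rewrite Rintegral_cst// mul0r mulr0.
move=> t _; rewrite /win; case: ifPn => h; last by rewrite mulr0.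
rewrite k0 ?mul0r//; have := ler_normB y (y - t); rewrite opprB addrCA subrr addr0 => h2.
have : `|y| <= `|y - t| + `|t| by rewrite -{1}(subrK t y) ler_normD.
by rewrite distrC in h; lra.
Qed.

(** The two windows differ only within two intervals of length |y - z|, whose total length is then
    divided by the window length 2 s. *)
Lemma avg1_lip k s y z M : 0 < s -> bms1 k -> (forall t, `|k t| <= M) ->
  `|avg1 s k y - avg1 s k z| <= M / s * `|y - z|.
Proof.
move=> s0 bk kM; wlog yz : y z / y <= z.
  by move=> H; have [/H//|/ltW/H] := leP y z; rewrite distrC [`|z - _|]distrC.
have s2 : 0 < 2 * s by rewrite mulr_gt0.
have M0 : 0 <= M by exact: le_trans (kM 0).
have [iy iz] := conj (bms1_win _ s y bk) (bms1_win _ s z bk).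
have iyz : mu.-integrable setT (EFin \o (fun t => k t * win s y t - k t * win s z t)).
  exact: (integrableB measurableT iy iz).
pose I1 : set R := `[y - s, z - s]%classic; pose I2 : set R := `[y + s, z + s]%classic.
have i1 : mu.-integrable setT (EFin \o (\1_I1 : R -> R)) by exact: integrable_indic_itv.
have i2 : mu.-integrable setT (EFin \o (\1_I2 : R -> R)) by exact: integrable_indic_itv.
have i12 : mu.-integrable setT (EFin \o (fun t : R => \1_I1 t + \1_I2 t : R)).
  exact: (integrableD measurableT i1 i2).
have I12 (a b : R) : a <= b -> \int[mu]_t (\1_(`[a, b]%classic) (t : R)) = b - a :> R.
  move=> ab; rewrite /Rintegral integral_indic// setIT.
  have /= -> := lebesgue_measure_itv `[a, b]; rewrite lte_fin.
  by case: ltP => // ba; rewrite /=; lra.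
rewrite /avg1 -mulrBr normrM gtr0_norm ?invr_gt0// ler_pdivrMl//.
rewrite -(RintegralB measurableT iy iz); apply: le_trans (le_normr_Rintegral measurableT iyz) _.
apply: (@le_trans _ _ (\int[mu]_t (M * (\1_I1 t + \1_I2 t)))).
  apply: (le_Rintegral measurableT); first exact: (integrable_abse iyz).
    exact: (integrableZl measurableT M i12).
  move=> t _; rewrite -mulrBr normrM; apply: ler_pM => //.
  have b1 A : 0 <= \1_A (t : R) :> R by rewrite indicE.
  rewrite /win; case: ifPn => h1; case: ifPn => h2.
  - by rewrite subrr normr0 addr_ge0.
  - rewrite subr0 normr1 [\1_I1 t]indicE mem_set ?lerDl//.
    rewrite /I1 /= in_itv/=; move: h1 h2; rewrite ltr_norml -leNgt ler_normr => /andP[h1 h1'].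
    by move=> /orP[h2|h2]; apply/andP; split; lra.
  - rewrite sub0r normrN normr1 [\1_I2 t]indicE mem_set ?lerDr//.
    rewrite /I2 /= in_itv/=; move: h2 h1; rewrite ltr_norml -leNgt ler_normr => /andP[h2 h2'] h1.
    by move: h1 => /orP[h1|h1]; apply/andP; split; lra.
  - by rewrite subrr normr0 addr_ge0.
rewrite (RintegralZl M measurableT i12) (RintegralD measurableT i1 i2) !I12 ?lerD2r//.
rewrite distrC ger0_norm ?subr_ge0// le_eqVlt; apply/orP; left; apply/eqP.
by field; exact: lt0r_neq0.
Qed.

End averages1.

Section averages2.
Context {R : realType}.
Notation mu := (@lebesgue_measure R).
Implicit Types (h f : plane R -> R) (k : R -> R) (s t y M B : R) (x z : plane R).

(** This is [bms] with its bounds exposed: the uniform bound must survive the approximation, since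
    an L^1 estimate is later turned into estimates of squares and pairings. *)
Definition bmsMB M B h := measurable_fun setT h /\
  forall x, `|h x| <= M /\ (~~ inbox B x -> h x = 0).

Lemma bmsMB_bms M B h : bmsMB M B h -> bms h.
Proof. by move=> [mh H]; split => //; exists M, B. Qed.

Lemma bmsMB_section M B h y : bmsMB M B h -> bms1 (fun t => h (y, t)).
Proof.
move=> [mh H]; split; first exact: (measurableT_comp mh (pair1_measurable y)).
exists M, B => t; have [h1 h0] := H (y, t); split => // Bt.
by rewrite h0// /inbox/= andbC leNgt Bt.
Qed.

Definition avgy s h x := avg1 s (fun t => h (x.1, t)) x.2.

Lemma avgy_out M B h s x : 0 < s -> bmsMB M B h -> ~~ inbox (B + s) x -> avgy s h x = 0.
Proof.
move=> s0 [mh H]; rewrite negb_and -!ltNge => /orP[] xB; last first.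
  apply: (avg1_out _ _ _ B) => [t Bt|]; last exact: ltW.
  by have [_ ->//] := H (x.1, t); rewrite /inbox/= andbC leNgt Bt.
rewrite /avgy (_ : (fun t => _) = fun=> 0); last first.
  apply/funext => t; have [_ ->//] := H (x.1, t).
  by rewrite /inbox/= leNgt (lt_trans _ xB)// ltrDl.
apply: (avg1_out _ _ _ (`|x.2| - s)) => //; by rewrite subrK.
Qed.

Lemma avgy_bms M B h s : 0 < s -> bmsMB M B h -> bmsMB M (B + s) (avgy s h).
Proof.
move=> s0 bh; have [mh H] := bh; split; last first.
  move=> x; split; last exact: (avgy_out M).
  apply: avg1_bound => //; first exact: (bmsMB_section M B).
  by move=> t; have [] := H (x.1, t).
(* The last factor displays a domination by a function of [x] times a function of [t]; joint
   integrability, and with it measurability of the partial integral, follows. *)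
pose F (z : plane R * R) := h (z.1.1, z.2) * win s z.1.2 z.2 * \1_(box (B + s)) z.1.
have mwin : measurable_fun setT (fun z : plane R * R => win s z.1.2 z.2).
  apply: measurable_fun_ifT => //; apply: measurable_fun_ltr => //.
  apply: measurableT_comp => //; apply: measurable_funB; first exact: measurable_snd.
  exact: (measurableT_comp measurable_snd measurable_fst).
have mF : measurable_fun setT F.
  apply: measurable_funM; first apply: measurable_funM => //.
    apply: (measurableT_comp mh); apply/measurable_fun_pairP; split.
      exact: (measurableT_comp measurable_fst measurable_fst).
    exact: measurable_snd.
  have m1 : measurable_fun setT (\1_(box (B + s)) : plane R -> R).
    exact: measurable_indic (measurable_box (B + s)).
  exact: (measurableT_comp m1 measurable_fst).
have iF : (lebf \x mu)%E.-integrable setT (EFin \o F).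
  apply: (@integrable_prod_dom _ _ _ _ R lebf mu F (fun x => M * \1_(box (B + s)) x)
    (\1_(`[- B, B]%classic))) => //.
  - exact: (integrableZl measurableT M (bms_integ _ (bms_indic_box (B + s)))).
  - exact: integrable_indic_itv.
  move=> x t; rewrite /F /=; have [h1 h0] := H (x.1, t).
  have [tB|tB] := leP `|t| B; last first.
    have xB : ~~ inbox B (x.1, t) by rewrite /inbox/= andbC leNgt tB.
    by rewrite (h0 xB) !mul0r normr0 mulr_ge0.
  have tI : `[- B, B]%classic t by rewrite /= in_itv/= -ler_norml.
  rewrite [X in _ * `|X|]indicE (mem_set tI) normr1 mulr1 normrM [leRHS]normrM ler_wpM2r// normrM /win; case: ifP => _.
    by rewrite normr1 mulr1 (le_trans h1)// ler_norm.
  by rewrite normr0 mulr0.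
have mf := measurable_fubini_F iF.
have mf2 : measurable_fun setT (fun x => fine (fubini_F mu (EFin \o F) x)).
  by apply: (@measurableT_comp _ _ _ _ _ _ fine) => //; exact: fine_measurable.
have mavg : measurable_fun setT (fun x => (2 * s)^-1 * fine (fubini_F mu (EFin \o F) x)).
  exact: measurable_funM.
apply: eq_measurable_fun mavg => x _; rewrite /fubini_F /F /=.
have [xB|xB] := boolP (inbox (B + s) x).
  rewrite /avgy /avg1; congr (_ * fine _); apply: eq_integral => t _.
  by rewrite indicE mem_set// mulr1.
rewrite (avgy_out M B h s x s0 bh xB) (eq_integral (cst 0%E)) ?integral0 ?mulr0// => t _.
by rewrite indicE memNset ?mulr0//; exact/negP.
Qed.

Lemma avg1_eq0 s y : avg1 s (fun=> 0) y = 0 :> R.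
Proof.
rewrite /avg1; under eq_Rintegral do rewrite mul0r.
by rewrite Rintegral_cst// mul0r mulr0.
Qed.

Lemma integ_fubini (f : plane R -> R) : (forall x, 0 <= f x) -> measurable_fun setT f ->
  (\int[leb2]_x (f x)%:E = \int[mu]_a \int[mu]_t (f (a, t))%:E)%E.
Proof.
move=> f0 mf; rewrite [LHS](_ : _ = \int[mu \x mu]_x (f x)%:E)%E//.
have f0' x : (0 <= (f x)%:E)%E by rewrite lee_fin.
have mf' : measurable_fun setT (fun x => (f x)%:E) by exact/measurable_EFinP.
exact: (fubini_tonelli1 (m1 := mu) (m2 := mu) _ mf' f0').
Qed.

Lemma dominated_cvg_to0 (F : nat -> measurableTypeR R -> \bar R)
    (g : measurableTypeR R -> R) :
  (forall n, measurable_fun setT (F n)) -> (forall n y, (0 <= F n y <= (g y)%:E)%E) ->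
  {ae mu, forall y, F n y @[n --> \oo] --> 0%E} -> mu.-integrable setT (EFin \o g) ->
  (\int[mu]_y F n y)%E @[n --> \oo] --> 0%E.
Proof.
move=> mF Fg [A [mA A0 subA]] ig.
have mc : measurable_fun setT (cst 0%E : measurableTypeR R -> \bar R) by [].
have c0 : {ae mu, forall y, setT y -> F ^~ y @ \oo --> cst 0%E y}.
  exists A; split => // y; apply: contra_notP => xA _.
  by apply: contrapT => hx; apply: xA; exact: subA.
have b0 : {ae mu, forall y n, setT y -> (`|F n y| <= (EFin \o g) y)%E}.
  by apply: aeW => y n _ /=; have /andP[h1 h2] := Fg n y; rewrite gee0_abs.
have [_ _] := dominated_convergence measurableT mF mc c0 ig b0.
by rewrite integral0.
Qed.

(** Dominated convergence is used twice: in the averaged variable for each first coordinate, by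
    Lebesgue differentiation, and then in the first coordinate. The widths 1 / (n + 1) are at most
    1, so one dominating function serves all n. *)
Lemma avgy_approx M B h : 0 <= M -> 0 <= B -> bmsMB M B h -> forall e : R, 0 < e ->
  exists2 s, 0 < s <= 1 & \int[leb2]_x `|avgy s h x - h x| <= e.
Proof.
move=> M0 B0 bh e e0; pose sn n : R := n.+1%:R^-1.
have sn0 n : 0 < sn n by rewrite invr_gt0.
have sn1 n : sn n <= 1 by rewrite invf_le1 ?ler1n.
have bA n := avgy_bms _ _ _ _ (sn0 n) bh.
have bsec a := bmsMB_section M B h a bh.
have hB a t : B < `|t| -> h (a, t) = 0.
  by move=> tB; have [_ ->//] := bh.2 (a, t); rewrite /inbox/= andbC leNgt tB.
have hBa a t : B < `|a| -> h (a, t) = 0.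
  by move=> tB; have [_ ->//] := bh.2 (a, t); rewrite /inbox/= leNgt tB.
pose d n x := `|avgy (sn n) h x - h x|.
have md n : measurable_fun setT (d n).
  by apply: measurableT_comp => //; apply: measurable_funB; [exact: (bA n).1|exact: bh.1].
pose D t : R := 2 * M * \1_(`[- (B + 1), B + 1]%classic) t.
have iD : mu.-integrable setT (EFin \o D).
  exact: (integrableZl measurableT (2 * M) (integrable_indic_itv (- (B + 1)) (B + 1) true false)).
have D0 t : 0 <= D t by rewrite !mulr_ge0// indicE.
have dD n a t : d n (a, t) <= D t.
  rewrite /D indicE; have [tB|tB] := leP `|t| (B + 1).
    rewrite mem_set /=; last by rewrite in_itv/= -ler_norml.
    rewrite mulr1 (le_trans (ler_normB _ _))// mulr_natl mulr2n lerD//.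
      by have [] := (bA n).2 (a, t).
    by have [] := bh.2 (a, t).
  rewrite /d (avgy_out M B)// ?hB ?subrr ?normr0 ?mulr_ge0//.
    by rewrite (lt_trans _ tB)// ltrDl.
  by rewrite /inbox/= andbC leNgt (le_lt_trans _ tB)// lerD2l.
pose phi n a := (\int[mu]_t (d n (a, t))%:E)%E.
have phi0 a : phi n a @[n --> \oo] --> 0%E.
  have mda n : measurable_fun setT (fun t => (d n (a, t))%:E).
    by apply/measurable_EFinP; exact: (measurableT_comp (md n) (pair1_measurable a)).
  apply: (dominated_cvg_to0 _ D mda _ _ iD).
    by move=> n t; rewrite !lee_fin normr_ge0 dD.
  have [A [mA A0 subA]] := avg1_cvg _ (bsec a).
  exists A; split => // t; apply: contra_notP => tA.
  have ht : avg1 (sn n) (fun t => h (a, t)) t @[n --> \oo] --> h (a, t).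
    by apply: contrapT => hh; apply: tA; apply: subA.
  apply/cvg_EFin; first by near=> n.
  have ht2 : avg1 (sn n) (fun t => h (a, t)) t - h (a, t) @[n --> \oo] --> (0 : R).
    by rewrite -(subrr (h (a, t))); apply: cvgB => //; exact: cvg_cst.
  have : `|avg1 (sn n) (fun t => h (a, t)) t - h (a, t)| @[n --> \oo] --> `|0 : R|.
    exact: cvg_norm.
  by rewrite normr0.
pose I := fine (\int[mu]_t (D t)%:E)%E.
have ID : (\int[mu]_t (D t)%:E = I%:E)%E by rewrite fineK// (integrable_fin_num _ iD).
have I0 : 0 <= I by rewrite fine_ge0// integral_ge0// => t _; rewrite lee_fin.
pose DD a : R := I * \1_(`[- B, B]%classic) a.
have iDD : mu.-integrable setT (EFin \o DD).
  exact: (integrableZl measurableT I (integrable_indic_itv (- B) B true false)).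
have mphi n : measurable_fun setT (phi n).
  apply: (measurable_fun_fubini_tonelli_F (fun x => (d n x)%:E)) => //.
    exact/measurable_EFinP.
  by move=> x; rewrite lee_fin; exact: normr_ge0.
have phiD n a : (phi n a <= (DD a)%:E)%E.
  rewrite /DD indicE; have [aB|aB] := leP `|a| B.
    rewrite mem_set /=; last by rewrite in_itv/= -ler_norml.
    rewrite mulr1 -ID; apply: ge0_le_integral => //.
    - by move=> t _; rewrite lee_fin; exact: normr_ge0.
    - by apply/measurable_EFinP; exact: (measurableT_comp (md n) (pair1_measurable a)).
    - by case/integrableP: iD.
    - by move=> t _; rewrite lee_fin.
  rewrite /phi (eq_integral (cst 0%E)) ?integral0 ?lee_fin ?mulr_ge0// => t _.
  rewrite /d hBa// /avgy /= (_ : (fun t => h (a, t)) = fun=> 0); last by apply/funext => t'; rewrite hBa.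
  by rewrite avg1_eq0 subrr normr0.
have phi_ge0 n a : (0 <= phi n a)%E by apply: integral_ge0 => t _; rewrite lee_fin; exact: normr_ge0.
have cv : (\int[mu]_a phi n a)%E @[n --> \oo] --> 0%E.
  apply: (dominated_cvg_to0 _ DD mphi _ _ iDD).
    by move=> n a; rewrite phi_ge0 phiD.
  exact: aeW.
have [n Hn] : exists n, (\int[mu]_a phi n a < e%:E)%E.
  have : \forall n \near \oo, (\int[mu]_a phi n a < e%:E)%E.
    have := cv [set x | (x < e%:E)%E]; apply.
    by apply: (@open_nbhs_nbhs _ 0%E); split; [exact: open_ereal_lt_ereal|rewrite /= lte_fin].
  by move=> [n _ Hn]; exists n; apply: Hn => /=.
exists (sn n); first by rewrite sn0 sn1.
rewrite /Rintegral (integ_fubini (d n)) => [|x|//]; last exact: normr_ge0.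
rewrite -lee_fin fineK; first exact: ltW.
have ge : (0 <= \int[mu]_a phi n a)%E by exact: integral_ge0.
by rewrite ge0_fin_numE//; exact: lt_trans Hn (ltry _).
Unshelve. all: by end_near. Qed.

(** Exchanging the coordinates lets [avgy] average in the first one as well. *)
Definition sw x : plane R := (x.2, x.1).

Lemma measurable_sw : measurable_fun setT sw.
Proof. by apply/measurable_fun_pairP; split; [exact: measurable_snd|exact: measurable_fst]. Qed.

Lemma integral_sw f : (forall x, 0 <= f x) -> measurable_fun setT f ->
  \int[leb2]_x f (sw x) = \int[leb2]_x f x.
Proof.
move=> f0 mf; have H := integ_fubini (f \o sw) (fun x => f0 _) (measurableT_comp mf measurable_sw).
rewrite /Rintegral {}H.
have f0' x : (0 <= (f x)%:E)%E by rewrite lee_fin.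
have mf' : measurable_fun setT (fun x => (f x)%:E) by exact/measurable_EFinP.
congr (fine _); rewrite [RHS](_ : _ = \int[mu \x mu]_x (f x)%:E)%E//.
by rewrite (fubini_tonelli2 (m1 := mu) (m2 := mu) _ mf' f0').
Qed.

Lemma bmsMB_sw M B h : bmsMB M B h -> bmsMB M B (h \o sw).
Proof.
move=> [mh H]; split; first exact: measurableT_comp mh measurable_sw.
move=> x; have [h1 h2] := H (sw x); split => // xB; apply: h2.
by move: xB; rewrite /inbox/= andbC.
Qed.

Lemma avg1B k1 k2 s y : bms1 k1 -> bms1 k2 ->
  avg1 s k1 y - avg1 s k2 y = avg1 s (fun t => k1 t - k2 t) y.
Proof.
move=> b1 b2; rewrite /avg1 -mulrBr.
rewrite -(RintegralB measurableT (bms1_win _ s y b1) (bms1_win _ s y b2)).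
by congr (_ * _); apply: eq_Rintegral => t _; rewrite mulrBl.
Qed.

Lemma bms1B k1 k2 : bms1 k1 -> bms1 k2 -> bms1 (fun t => k1 t - k2 t).
Proof.
move=> [m1 [M1 [B1 H1]]] [m2 [M2 [B2 H2]]]; split; first exact: measurable_funB.
exists (M1 + M2), (Num.max B1 B2) => t; split.
  by rewrite (le_trans (ler_normB _ _))// lerD// ?(H1 t).1 ?(H2 t).1.
by rewrite gt_max => /andP[/(H1 t).2 -> /(H2 t).2 ->]; rewrite subrr.
Qed.

(** Averaging in the second coordinate and then in the first gives each variable its Lipschitz
    bound, because the second average preserves the bound produced by the first. Both widths are at
    most 1, hence the radius B + 2. *)
Lemma lip_dense M B h : 0 <= M -> 0 <= B -> bmsMB M B h -> forall e : R, 0 < e ->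
  exists f, [/\ bmsMB M (B + 2) f, lip f & \int[leb2]_x `|f x - h x| <= e].
Proof.
move=> M0 B0 bh e e0; have e2 : 0 < e / 2 by rewrite divr_gt0.
have [s /andP[s0 s1] Hs] := avgy_approx _ _ _ M0 B0 bh _ e2.
have bg := avgy_bms _ _ _ _ s0 bh; set g := avgy s h in Hs bg.
have bk := bmsMB_sw _ _ _ bg.
have [r /andP[r0 r1] Hr] := avgy_approx _ _ _ M0 (addr_ge0 B0 (ltW s0)) bk _ e2.
have bf' := bmsMB_sw _ _ _ (avgy_bms _ _ _ _ r0 bk).
have BB : B + s + r <= B + 2 by lra.
have bf : bmsMB M (B + 2) (avgy r (g \o sw) \o sw).
  have [mf Hf] := bf'; split => // x; have [h1 h2] := Hf x; split => // xB.
  by apply: h2; apply: contra xB; exact: inboxS.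
exists (avgy r (g \o sw) \o sw); split => //.
  exists (M / r + M / s); first by rewrite addr_ge0// divr_ge0// ltW.
  move=> x y; pose z : plane R := (y.1, x.2).
  rewrite -(subrKA ((avgy r (g \o sw) \o sw) z)) (le_trans (ler_normD _ _))//.
  have kb b : bms1 (fun t => g (t, b)) by exact: bmsMB_section bk.
  have gM t b : `|g (t, b)| <= M by have [] := bg.2 (t, b).
  have h1 : `|(avgy r (g \o sw) \o sw) x - (avgy r (g \o sw) \o sw) z| <= M / r * `|x.1 - y.1|.
    exact: (avg1_lip (fun t => g (t, x.2)) r x.1 y.1 M r0 (kb x.2) (fun t => gM t x.2)).
  have h2 : `|(avgy r (g \o sw) \o sw) z - (avgy r (g \o sw) \o sw) y| <= M / s * `|x.2 - y.2|.
    rewrite /avgy /sw /= avg1B//; apply: avg1_bound => //; first exact: bms1B.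
    move=> t; apply: avg1_lip => //; first exact: bmsMB_section bh.
    by move=> t'; have [] := bh.2 (t, t').
  apply: le_trans (lerD h1 h2) _; rewrite mulrDr !mulrDl.
  have a1 : 0 <= M / r * `|x.2 - y.2| by rewrite !mulr_ge0// invr_ge0 ltW.
  have a2 : 0 <= M / s * `|x.1 - y.1| by rewrite !mulr_ge0// invr_ge0 ltW.
  by lra.
have [cf cg] := conj (bmsMB_bms _ _ _ bf) (bmsMB_bms _ _ _ bg).
have ch := bmsMB_bms _ _ _ bh.
have i1 := bms_integ _ (bms_norm _ (bmsB _ _ cf cg)).
have i2 := bms_integ _ (bms_norm _ (bmsB _ _ cg ch)).
have i3 := bms_integ _ (bms_norm _ (bmsB _ _ cf ch)).
apply: (@le_trans _ _ (\int[leb2]_x (`|(avgy r (g \o sw) \o sw) x - g x| + `|g x - h x|))).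
  apply: (le_Rintegral measurableT i3); first exact: (integrableD measurableT i1 i2).
  by move=> x _; rewrite -(subrKA (g x)) ler_normD.
rewrite (RintegralD measurableT i1 i2) [e]splitr; apply: lerD Hs; apply: le_trans Hr.
pose D x := `|avgy r (g \o sw) x - (g \o sw) x|.
have mD : measurable_fun setT D.
  apply: measurableT_comp => //.
  exact: measurable_funB (avgy_bms _ _ _ _ r0 bk).1 bk.1.
rewrite -(integral_sw D (fun x => normr_ge0 _) mD) /D.
rewrite le_eqVlt; apply/orP; left; apply/eqP; apply: eq_Rintegral => -[x1 x2] _.
by [].
Qed.

End averages2.

(** * Duality with truncations of the gradient *)

Section duality.
Context {R : realType}.
Implicit Types (f g w d p q : plane R -> R) (x y z : plane R) (mu lam M B e : R).
Notation zn := (zeta (@unit_mass R)).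
#[local] Opaque ip Tr unit_mass zeta.

(** From |d| <= 2 M one gets d^2 <= 2 M |d|, so that L^1 smallness of a bounded [d] controls its
    pairing with a square integrable function. *)
Let amgm (eta M a d : R) : 0 < eta -> `|d| <= 2 * M ->
  `|a * d| <= eta * a ^+ 2 + M / (2 * eta) * `|d|.
Proof.
move=> e0 dM; have M0 : 0 <= M by have := normr_ge0 d; lra.
rewrite normrM -(real_normK (num_real a)); move: (normr_ge0 a) (normr_ge0 d) dM.
move: `|a| `|d| => {}a {}d a0 d0 dM.
have h : d ^+ 2 / (4 * eta) <= M / (2 * eta) * d.
  rewrite (_ : M / (2 * eta) * d = d * (2 * M) / (4 * eta)); last first.
    by field; exact: lt0r_neq0.
  by rewrite ler_pM2r ?invr_gt0 ?mulr_gt0// expr2 ler_wpM2l.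
have : 0 <= eta * (a - d / (2 * eta)) ^+ 2 by rewrite mulr_ge0 ?sqr_ge0// ltW.
have -> : eta * (a - d / (2 * eta)) ^+ 2 = eta * a ^+ 2 - a * d + d ^+ 2 / (4 * eta).
  by field; exact: lt0r_neq0.
by lra.
Qed.

Let sq_diff (a b M : R) : `|a| <= M -> `|b| <= M -> a * a - b * b <= 2 * M * `|a - b|.
Proof.
move=> aM bM; rewrite (_ : a * a - b * b = (a + b) * (a - b)); last by ring.
apply: le_trans (ler_norm _) _; rewrite normrM ler_wpM2r//.
by apply: le_trans (ler_normD _ _) _; lra.
Qed.

Let arith (e W M D : R) : 0 < e -> 0 <= W -> 0 <= M -> 0 <= D ->
  D <= Num.min e (Num.min (e / (2 * M + 1)) (e ^+ 2 / ((W + 1) * (2 * M + 1)))) ->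
  [/\ D <= e, 2 * M * D <= e & e / (2 * (W + 1)) * W + M / (2 * (e / (2 * (W + 1)))) * D <= e].
Proof.
move=> e0 W0 M0 D0; rewrite !le_min => /and3P[-> h1 h2].
have M1 : 0 < 2 * M + 1 by lra.
have W1 : 0 < W + 1 by lra.
split => //.
  by move: h1; rewrite ler_pdivlMr// => h1; lra.
move: h2; rewrite ler_pdivlMr ?mulr_gt0// => h2.
have h3 : e / (2 * (W + 1)) * W <= e / 2.
  rewrite (_ : e / (2 * (W + 1)) * W = e / 2 * (W / (W + 1))); last first.
    by field; exact: lt0r_neq0.
  by rewrite ler_piMr ?divr_ge0 ?(ltW e0)// ler_pdivrMr//; lra.
have h4 : M / (2 * (e / (2 * (W + 1)))) * D <= e / 2.
  rewrite (_ : M / (2 * (e / (2 * (W + 1)))) * D = M * D * (W + 1) / e); last first.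
    by field; rewrite !lt0r_neq0.
  rewrite ler_pdivrMr//; have : 0 <= D * (W + 1) by rewrite mulr_ge0// ltW.
  by nra.
by lra.
Qed.

Lemma lip_dense_ip w M B f : L1loc w -> L1loc (fun x => w x ^+ 2) ->
  0 <= M -> 0 <= B -> bmsMB M B f -> forall e, 0 < e -> exists h,
  [/\ bms h, lip h, `|ip w f - ip w h| <= e, `|\int[leb2]_x f x - \int[leb2]_x h x| <= e
    & ip h h - ip f f <= e].
Proof.
move=> lw lw2 M0 B0 bMf e e0; have bf := bmsMB_bms _ _ _ bMf.
have iw := ip_integ _ _ lw2 (bms_indic_box (B + 2)).
pose W := \int[leb2]_x (w x ^+ 2 * \1_(box (B + 2)) x).
have W0 : 0 <= W by apply: Rintegral_ge0 => x _; rewrite mulr_ge0 ?sqr_ge0// indicE.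
(* The three bounds serve the integral, the squares and the pairing in turn; W + 1 and 2 M + 1 keep
   the denominators positive. *)
pose de := Num.min e (Num.min (e / (2 * M + 1)) (e ^+ 2 / ((W + 1) * (2 * M + 1)))).
have de0 : 0 < de.
  by rewrite !lt_min e0 !divr_gt0 ?mulr_gt0 ?exprn_gt0 ?ltr_wpDl ?mulr_ge0.
have [h [bMh lh Hh]] := lip_dense _ _ _ M0 B0 bMf _ de0.
have bh := bmsMB_bms _ _ _ bMh; have bd := bmsB _ _ bh bf.
have idn := bms_integ _ (bms_norm _ bd).
have D0 : 0 <= \int[leb2]_x `|h x - f x| by exact: Rintegral_ge0.
have [a1 a2 a3] := arith e W M _ e0 W0 M0 D0 Hh.
exists h; split => //.
- rewrite distrC -(ipBr _ _ _ lw bh bf) ipE.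
  have ii := ip_integ _ _ lw bd.
  apply: le_trans (le_normr_Rintegral measurableT ii) _; apply: le_trans _ a3.
  have j1 := integrableZl measurableT (e / (2 * (W + 1))) iw.
  have j2 := integrableZl measurableT (M / (2 * (e / (2 * (W + 1))))) idn.
  rewrite /W -(RintegralZl _ measurableT iw) -(RintegralZl _ measurableT idn).
  rewrite -(RintegralD measurableT j1 j2).
  apply: (le_Rintegral measurableT (integrable_abse ii)).
    exact: (integrableD measurableT j1 j2).
  have [eta etaE] : exists eta, eta = e / (2 * (W + 1)) := ex_intro _ _ erefl.
  have eta0 : 0 < eta by rewrite etaE divr_gt0// mulr_gt0// ltr_wpDl.
  rewrite -etaE => x _; have [f1 f0] := bMf.2 x; have [h1 h0] := bMh.2 x.
  have dM : `|h x - f x| <= 2 * M by apply: le_trans (ler_normB _ _) _; lra.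
  have [xB|xB] := boolP (inbox (B + 2) x).
    by rewrite indicE mem_set// mulr1; exact: amgm.
  have fx0 : f x = 0 by apply: f0; apply: contra xB; apply: inboxS; rewrite lerDl.
  rewrite (h0 xB) fx0 subrr mulr0 normr0 mulr0 addr0.
  by apply: mulr_ge0; [exact: ltW|apply: mulr_ge0; [exact: sqr_ge0|rewrite indicE]].
- have [i1 i2] := conj (bms_integ _ bh) (bms_integ _ bf).
  rewrite distrC -(RintegralB measurableT i1 i2); apply: le_trans a1.
  exact: (le_normr_Rintegral measurableT (bms_integ _ bd)).
- have [i1 i2] := conj (bms_integ _ (bms_mul _ _ bh bh)) (bms_integ _ (bms_mul _ _ bf bf)).
  rewrite !ipE -(RintegralB measurableT i1 i2); apply: le_trans a2.
  rewrite -(RintegralZl _ measurableT idn).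
  apply: (le_Rintegral measurableT (integrableB measurableT i1 i2)).
    exact: (integrableZl measurableT (2 * M) idn).
  by move=> x _; apply: sq_diff; [have [] := bMh.2 x|have [] := bMf.2 x].
Qed.

Variables (u : plane R -> 'cV[R]_2) (G : plane R -> 'M[R]_2).
Hypothesis uG : W12loc u G.
Hypothesis iq : integ (fun x => cfal G x ^+ 2 + cfbe G x ^+ 2).
Hypothesis id2 : integ (fun x => (modulus G x - 1) ^+ 2).

Let Q := \int[leb2]_x (cfal G x ^+ 2 + cfbe G x ^+ 2).

Let fin1 (a1 a2 t1 t2 c q n A1 A2 mu : R) : a1 - t1 <= A1 * mu -> a2 - t2 <= A2 * mu ->
  t1 + t2 - c <= q + n -> a1 + a2 - c <= q + n + (A1 + A2) * mu.
Proof. by lra. Qed.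

Let fin2 (a1 a2 b1 b2 c1 c2 if1 ig ih ik q nf ng nh nk e : R) : 0 <= e ->
  `|a1 - b1| <= e -> `|a2 - b2| <= e -> `|if1 - ih| <= e -> `|ig - ik| <= e ->
  nh - nf <= e -> nk - ng <= e ->
  b1 + b2 - (c1 * ih + c2 * ik) <= q + (nh + nk) / 2 ->
  a1 + a2 - (c1 * if1 + c2 * ig) <= q + (nf + ng) / 2 + (3 + `|c1| + `|c2|) * e.
Proof.
move=> e0 /ler_normlW h1 /ler_normlW h2 h3 h4 h5 h6 h7.
have k1 : - (c1 * (if1 - ih)) <= `|c1| * e.
  by apply: le_trans (ler_norm _) _; rewrite normrN normrM ler_wpM2l.
have k2 : - (c2 * (ig - ik)) <= `|c2| * e.
  by apply: le_trans (ler_norm _) _; rewrite normrN normrM ler_wpM2l.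
by lra.
Qed.

Let bmsMBP f : bms f -> exists M B, [/\ 0 <= M, 0 <= B & bmsMB M B f].
Proof.
move=> [mf [M [B Hf]]]; exists M, (Num.max 0 B); split.
- by have [h _] := Hf origin; apply: le_trans h.
- by rewrite le_max lexx.
- split => // x; have [h1 h2] := Hf x; split => // xB; apply: h2.
  by apply: contra xB; apply: inboxS; rewrite le_max lexx orbT.
Qed.

Lemma gradient_duality : L1loc (fun x => cfa G x ^+ 2) -> L1loc (fun x => cfb G x ^+ 2) ->
  exists c1 c2 : R, forall f g, bms f -> bms g ->
  ip (cfa G) f + ip (cfb G) g - (c1 * \int[leb2]_x f x + c2 * \int[leb2]_x g x) <=
  Q / 2 + (ip f f + ip g g) / 2.
Proof.
move=> la2 lb2; have [la lb] := conj (L1loc_cfa _ _ uG) (L1loc_cfb _ _ uG).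
have [c1 [c2 H]] := gradient_limit u G uG iq id2; exists c1, c2.
have HL f g : bms f -> bms g -> lip f -> lip g ->
  ip (cfa G) f + ip (cfb G) g - (c1 * \int[leb2]_x f x + c2 * \int[leb2]_x g x) <=
  Q / 2 + (ip f f + ip g g) / 2.
  move=> bf bg lf lg.
  have [A1 HA1] := lipschitz_limit _ _ la bf lf.
  have [A2 HA2] := lipschitz_limit _ _ lb bg lg.
  (* Here [mu] is the inverse of the mollification parameter lam, which tends to infinity. *)
  apply: (@ler_small _ _ _ (A1 + A2) 1 ltr01) => mu m0 m1.
  have m1' : 1 <= mu^-1 by rewrite invf_ge1// ltW.
  have m0' : 0 < mu^-1 by rewrite invr_gt0.
  have h1 := HA1 _ m1'; have h2 := HA2 _ m1'; rewrite invrK in h1 h2.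
  exact: (fin1 _ _ _ _ _ _ _ _ _ _ h1 h2 (H _ f g m0' bf bg)).
move=> f g bf bg.
have [M [B [M0 B0 bMf]]] := bmsMBP _ bf; have [N [C [N0 C0 bMg]]] := bmsMBP _ bg.
apply: (@ler_small _ _ _ (3 + `|c1| + `|c2|) 1 ltr01) => e e0 _.
have [h [bh lh h1 h2 h3]] := lip_dense_ip _ _ _ _ la la2 M0 B0 bMf _ e0.
have [k [bk lk k1 k2 k3]] := lip_dense_ip _ _ _ _ lb lb2 N0 C0 bMg _ e0.
exact: (fin2 _ _ _ _ _ _ _ _ _ _ _ _ _ _ _ _ (ltW e0) h1 k1 h2 k2 h3 k3 (HL _ _ bh bk lh lk)).
Qed.

(** For a truncation of p - c the left-hand side of the duality inequality is the energy of the test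
    pair itself, so half of it can be absorbed. *)
Let arith2 (fa fb if1 ig c1 c2 nf ng q : R) : fa - c1 * if1 = nf -> fb - c2 * ig = ng ->
  fa + fb - (c1 * if1 + c2 * ig) <= q / 2 + (nf + ng) / 2 -> nf + ng <= q.
Proof. by lra. Qed.

(* The optimal test functions are truncations of [cfa G - c1], [cfb G - c2]. *)
Lemma gradient_bound : L1loc (fun x => cfa G x ^+ 2) -> L1loc (fun x => cfb G x ^+ 2) ->
  exists c1 c2 : R,
  (\int[leb2]_x ((cfa G x - c1) ^+ 2 + (cfb G x - c2) ^+ 2)%:E <= Q%:E)%E.
Proof.
move=> la2 lb2; have [la lb] := conj (L1loc_cfa _ _ uG) (L1loc_cfb _ _ uG).
have [c1 [c2 H]] := gradient_duality la2 lb2; exists c1, c2.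
(* Truncating both components on the same set makes them admissible test functions; the sets
   increase to the plane, ready for monotone convergence. *)
pose S (n : nat) : set (plane R) := box n%:R `&` [set x | `|cfa G x - c1| <= n%:R]
  `&` [set x | `|cfb G x - c2| <= n%:R].
have m1 : measurable_fun setT (fun x => cfa G x - c1).
  by apply: measurable_funB => //; exact: la.1.
have m2 : measurable_fun setT (fun x => cfb G x - c2).
  by apply: measurable_funB => //; exact: lb.1.
have mle w (n : nat) : measurable_fun setT w -> measurable [set x | `|w x| <= n%:R].
  move=> mw; have mw' : measurable_fun setT (fun x => `|w x|) by exact: measurableT_comp mw.
  have := mw' measurableT `]-oo, n%:R]%classic (measurable_itv _); rewrite setTI.
  by congr (measurable _); apply/seteqP; split => x /=; rewrite in_itv.
have mS n : measurable (S n).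
  apply: measurableI; [apply: measurableI|]; [exact: measurable_box|exact: mle|exact: mle].
have ndS : nondecreasing_seq S.
  move=> m n mn; apply/subsetPset => x [[h1 h2] h3].
  have le : m%:R <= n%:R :> R by rewrite ler_nat.
  split; [split|] => /=; [exact: inboxS h1|exact: le_trans le|exact: le_trans le].
have US : \bigcup_n S n = setT.
  rewrite -subTset => x _; pose b := Num.max (Num.max `|x.1| `|x.2|) (Num.max `|cfa G x - c1| `|cfb G x - c2|).
  have b0 : 0 <= b by rewrite !le_max normr_ge0.
  have := archi_boundP b0; set n := Num.bound b => /ltW; rewrite !ge_max.
  move=> /andP[/andP[h1 h2] /andP[h3 h4]]; exists n => //.
  by split; [split|] => //=; rewrite /box/= /inbox h1 h2.
have bS w n : measurable_fun setT w -> (forall x, S n x -> `|w x| <= n%:R) ->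
    bms (fun x => w x * \1_(S n) x).
  move=> mw Hw; split; first by apply: measurable_funM => //; exact: measurable_indic.
  exists n%:R, n%:R => x; rewrite indicE; have [xS|xS] := pselect (S n x).
    by rewrite mem_set// mulr1; split; [exact: Hw|move: xS => [[-> _] _]].
  by rewrite memNset// mulr0 normr0.
have hS w c n : L1loc w -> bms (fun x => (w x - c) * \1_(S n) x) ->
    let f x := (w x - c) * \1_(S n) x in ip w f - c * \int[leb2]_x f x = ip f f.
  move=> lw bf f; rewrite !ipE; have [i1 i2] := conj (ip_integ _ _ lw bf) (bms_integ _ bf).
  rewrite -(RintegralZl _ measurableT i2) -(RintegralB measurableT i1 (integrableZl measurableT c i2)).
  apply: eq_Rintegral => x _; rewrite /f indicE.
  by case: (x \in S n); rewrite ?mulr1 ?mulr0 ?subr0//; ring.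
have HS n : (\int[leb2]_(x in S n) ((cfa G x - c1) ^+ 2 + (cfb G x - c2) ^+ 2)%:E <= Q%:E)%E.
  have b1 : bms (fun x => (cfa G x - c1) * \1_(S n) x) by apply: bS => // x [[_ ?] _].
  have b2 : bms (fun x => (cfb G x - c2) * \1_(S n) x) by apply: bS => // x [[_ ?] ?].
  have h := arith2 _ _ _ _ _ _ _ _ _ (hS _ _ _ la b1) (hS _ _ _ lb b2) (H _ _ b1 b2).
  have [i1 i2] := conj (bms_integ _ (bms_mul _ _ b1 b1)) (bms_integ _ (bms_mul _ _ b2 b2)).
  have i12 := integrableD measurableT i1 i2.
  rewrite !ipE -(RintegralD measurableT i1 i2) -lee_fin in h.
  move: h; rewrite /Rintegral (fineK (integrable_fin_num measurableT i12)).
  congr (_ <= _)%E; rewrite [RHS]integral_mkcond; apply: eq_integral => x _.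
  rewrite patchE /= indicE.
  by case: (x \in S n); rewrite ?mulr1 ?mulr0 ?addr0// !expr2.
have mh : measurable_fun setT (fun x => ((cfa G x - c1) ^+ 2 + (cfb G x - c2) ^+ 2)%:E).
  by apply/measurable_EFinP; apply: measurable_funD; exact: measurable_funX.
have cv := ge0_nondecreasing_set_cvg_integral ndS mS
  (fun i => measurable_funS measurableT (@subsetT _ _) mh)
  (fun i x _ => lee_tofin (addr_ge0 (sqr_ge0 (cfa G x - c1)) (sqr_ge0 (cfb G x - c2)))).
have := cv leb2; rewrite US => {}cv; rewrite -(cvg_lim _ cv)//.
by apply: lime_le; [apply/cvg_ex; exists (\int[leb2]_x ((cfa G x - c1) ^+ 2 + (cfb G x - c2) ^+ 2)%:E)%E|exact: nearW].
Qed.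

End duality.

(** * From the Beurling estimate to rigidity *)

Section rotations.
Context {R : realType}.
Implicit Types A F : 'M[R]_2.

Definition rotmx (c1 c2 : R) : 'M[R]_2 := \matrix_(i, j)
  (if i == 0 then if j == 0 then c1 else - c2 else if j == 0 then c2 else c1).

Lemma frob_sqr A : frob A ^+ 2 = A 0 0 ^+ 2 + A 0 1 ^+ 2 + A 1 0 ^+ 2 + A 1 1 ^+ 2.
Proof.
have E : \tr (A^T *m A) = A 0 0 ^+ 2 + A 0 1 ^+ 2 + A 1 0 ^+ 2 + A 1 1 ^+ 2.
  rewrite /mxtrace !big_ord_recl !big_ord0 !mxE !big_ord_recl !big_ord0 !mxE.
  have -> : lift ord0 ord0 = 1 :> 'I_2 by apply/val_inj.
  have -> : (ord0 : 'I_2) = 0 by apply/val_inj.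
  by ring.
by rewrite /frob sqr_sqrtr E// !addr_ge0 ?sqr_ge0.
Qed.

Let det22 A : \det A = A 0 0 * A 1 1 - A 0 1 * A 1 0.
Proof.
rewrite (expand_det_row _ 0) !big_ord_recl big_ord0 /cofactor !det_mx11 !mxE /=.
have -> : lift ord0 ord0 = 1 :> 'I_2 by apply/val_inj.
have -> : lift 1 0 = 0 :> 'I_2 by apply/val_inj.
have -> : (ord0 : 'I_2) = 0 by apply/val_inj.
by rewrite expr0 (_ : bump 0 0 = 1%N) // expr1; ring.
Qed.

Lemma SO2_rot (c1 c2 : R) : c1 ^+ 2 + c2 ^+ 2 = 1 -> SO2 (rotmx c1 c2).
Proof.
move=> h; split; last by rewrite det22 !mxE /= -h; ring.
apply/matrixP => i j; rewrite !mxE !big_ord_recl !big_ord0 !mxE /=.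
by case: i => -[|[|//]] ?; case: j => -[|[|//]] ?; rewrite /= -?h; ring.
Qed.

Lemma SO2P A : SO2 A -> exists c1 c2, c1 ^+ 2 + c2 ^+ 2 = 1 /\ A = rotmx c1 c2.
Proof.
move=> [/matrixP H D]; exists (A 0 0), (A 1 0); move: D; rewrite det22 => D.
have := H 0 0; have := H 1 1; rewrite !mxE !big_ord_recl !big_ord0 !mxE.
have -> : lift ord0 ord0 = 1 :> 'I_2 by apply/val_inj.
have -> : (ord0 : 'I_2) = 0 by apply/val_inj.
rewrite /= !addr0 => h11 h00.
have hs : (A 1 1 - A 0 0) ^+ 2 + (A 0 1 + A 1 0) ^+ 2 = 0.
  have -> : (A 1 1 - A 0 0) ^+ 2 + (A 0 1 + A 1 0) ^+ 2 =
    (A 0 1 * A 0 1 + A 1 1 * A 1 1) + (A 0 0 * A 0 0 + A 1 0 * A 1 0) -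
    2 * (A 0 0 * A 1 1 - A 0 1 * A 1 0) by ring.
  by rewrite h11 h00 D; ring.
move/eqP: hs; rewrite paddr_eq0 ?sqr_ge0// !sqrf_eq0 subr_eq0 addr_eq0.
move=> /andP[/eqP e11 /eqP e01]; split; first by rewrite !expr2.
apply/matrixP => i j; rewrite !mxE.
by case: i => -[|[|//]] ?; case: j => -[|[|//]] ? /=; [|rewrite -e01| |rewrite -e11];
  congr (A _ _); apply/val_inj.
Qed.

End rotations.

Section norms.
Context {R : realType}.
Implicit Types (f : plane R -> R) (G : plane R -> 'M[R]_2).

Lemma frob_rot G x c1 c2 : frob (G x - rotmx c1 c2) ^+ 2 =
  2 * ((cfa G x - c1) ^+ 2 + (cfb G x - c2) ^+ 2 + (cfal G x ^+ 2 + cfbe G x ^+ 2)).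
Proof. by rewrite frob_sqr !mxE /= /cfa /cfb /cfal /cfbe; field. Qed.

Let cauchy (a b r c1 c2 : R) : 0 <= r -> r ^+ 2 = a ^+ 2 + b ^+ 2 -> c1 ^+ 2 + c2 ^+ 2 = 1 ->
  a * c1 + b * c2 <= r.
Proof.
move=> r0 r2 h; apply: le_trans (ler_norm _) _; rewrite -(ler_pXn2r (n := 2)) ?nnegrE//.
rewrite real_normK ?num_real// r2 -[leRHS]mulr1 -h -subr_ge0.
have -> : (a ^+ 2 + b ^+ 2) * (c1 ^+ 2 + c2 ^+ 2) - (a * c1 + b * c2) ^+ 2 =
  (a * c2 - b * c1) ^+ 2 by ring.
exact: sqr_ge0.
Qed.

Let polar (a b r : R) : 0 <= r -> r ^+ 2 = a ^+ 2 + b ^+ 2 ->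
  exists c1 c2, c1 ^+ 2 + c2 ^+ 2 = 1 /\ a * c1 + b * c2 = r.
Proof.
move=> r0 r2; have [rz|rz] := eqVneq r 0.
  exists 1, 0; split; first by ring.
  move/eqP: r2; rewrite rz expr0n/= eq_sym paddr_eq0 ?sqr_ge0// !sqrf_eq0.
  by move=> /andP[/eqP -> /eqP ->]; ring.
exists (a / r), (b / r); split.
  by rewrite !expr_div_n -mulrDl -r2 divff// sqrf_eq0.
by rewrite !mulrA -mulrDl -!expr2 -r2 expr2 mulfK.
Qed.

Let expand (a b r c1 c2 t : R) : r ^+ 2 = a ^+ 2 + b ^+ 2 -> c1 ^+ 2 + c2 ^+ 2 = 1 ->
  2 * ((a - c1) ^+ 2 + (b - c2) ^+ 2 + t) = 2 * ((r - 1) ^+ 2 + t) + 4 * (r - (a * c1 + b * c2)).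
Proof. by rewrite !expr2 => h1 h2; lra. Qed.

Lemma distSO2_ge0 (F : 'M[R]_2) : 0 <= distSO2 F.
Proof. by have [[A _ <-] _] := distSO2_minimum F; exact: sqrtr_ge0. Qed.

(** Among unit c, the distance |p - c| is least for c in the direction of p, by the Cauchy-Schwarz
    inequality; [polar] provides such a c also where p = 0. *)
Lemma distSO2_sqr G x : distSO2 (G x) ^+ 2 =
  2 * ((modulus G x - 1) ^+ 2 + (cfal G x ^+ 2 + cfbe G x ^+ 2)).
Proof.
have r0 : 0 <= modulus G x by exact: sqrtr_ge0.
have r2 : modulus G x ^+ 2 = cfa G x ^+ 2 + cfb G x ^+ 2 by rewrite sqr_sqrtr// addr_ge0 ?sqr_ge0.
have [[A /SO2P[c1 [c2 [hc ->]]] <-] lb] := distSO2_minimum (G x).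
have [d1 [d2 [hd he]]] := polar _ _ _ r0 r2.
apply/eqP; rewrite eq_le; apply/andP; split; last first.
  by rewrite frob_rot (expand _ _ _ _ _ _ r2 hc) lerDl mulr_ge0// subr_ge0; exact: cauchy.
have h : frob (G x - rotmx c1 c2) ^+ 2 <= frob (G x - rotmx d1 d2) ^+ 2.
  by rewrite ler_pXn2r ?nnegrE ?sqrtr_ge0//; apply: lb; exists (rotmx d1 d2) => //; exact: SO2_rot.
by move: h; rewrite [leRHS]frob_rot [leRHS](expand _ _ _ _ _ _ r2 hd) he subrr mulr0 addr0.
Qed.

Lemma L2normE f : L2norm f = ((\int[leb2]_x (f x ^+ 2)%:E) `^ 2^-1)%E.
Proof.
rewrite /L2norm unlock /Lnorm; congr (_ `^ _)%E; apply: eq_integral => x _ /=.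
by rewrite powR_mulrn// real_normK// num_real.
Qed.

Lemma integral_sqr_ge0 f : (0 <= \int[leb2]_x (f x ^+ 2)%:E)%E.
Proof. by apply: integral_ge0 => x _; rewrite lee_fin sqr_ge0. Qed.

Lemma L2norm_le_sqrt2 f g :
  (\int[leb2]_x (f x ^+ 2)%:E <= 2%:E * \int[leb2]_x (g x ^+ 2)%:E)%E ->
  (L2norm f <= (Num.sqrt 2)%:E * L2norm g)%E.
Proof.
move=> h; rewrite !L2normE -(powR12_sqrt (ler0n R 2)) -poweR_EFin -poweRM ?lee_fin ?integral_sqr_ge0//.
apply: gt0_ler_poweR => //.
all: by rewrite in_itv/= leey ?integral_sqr_ge0// mule_ge0 ?integral_sqr_ge0// lee_fin.
Qed.

(** The infinite area of the plane enters here; it yields both |c| = 1 and the uniqueness of the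
    rotation of finite norm. *)
Lemma integ_cst_eq0 (k : R) : integ (fun=> k) -> k = 0.
Proof.
move=> ik; apply/eqP; apply: contrapT => /negP k0; have {}k0 : 0 < `|k| by rewrite normr_gt0.
have iN := integrable_abse ik.
pose I := fine (\int[leb2]_(x in [set: plane R]) `|k|%:E)%E.
have IE : (\int[leb2]_(x in [set: plane R]) `|k|%:E = I%:E)%E.
  by rewrite fineK// (integrable_fin_num measurableT iN).
have I0 : 0 <= I by rewrite fine_ge0// integral_ge0.
(* The box of radius b has area 4 b^2 > b - 1, so the integral over it alone would exceed I = |k| (b
   - 1). *)
pose b := I / `|k| + 1.
have b1 : 1 <= b by rewrite lerDr divr_ge0.
have := ge0_subset_integral leb2 (measurable_box b) measurableT
  (measurable_int _ iN) (fun _ _ => lee_tofin (normr_ge0 k)) (@subsetT _ _).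
rewrite {}IE integral_cst; last exact: measurable_box.
rewrite leb2_box ?(le_trans _ b1)// -EFinM lee_fin; apply/negP; rewrite -ltNge.
have -> : I = `|k| * (b - 1) by rewrite /b addrK mulrC divfK// gt_eqF.
by rewrite ltr_pM2l//; nra.
Qed.

End norms.

Section rigidity.
Context {R : realType}.
Variables (u : plane R -> 'cV[R]_2) (G : plane R -> 'M[R]_2).
Hypothesis uG : W12loc u G.

Let la := L1loc_cfa u G uG.
Let lb := L1loc_cfb u G uG.
Let lal := L1loc_cfal u G uG.
Let lbe := L1loc_cfbe u G uG.

Let integ_le (f g : plane R -> R) : measurable_fun setT f -> (forall x, 0 <= f x <= g x) ->
  integ g -> integ f.
Proof.
move=> mf fg; apply: le_integrable => //; first exact/measurable_EFinP.
by move=> x _ /=; have /andP[f0 fgx] := fg x; rewrite lee_fin !ger0_norm// (le_trans f0).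
Qed.

Let integ_sqr (f : plane R -> R) : measurable_fun setT f -> (L2norm f < +oo)%E ->
  integ (fun x => f x ^+ 2).
Proof.
move=> mf; rewrite L2normE => /lty_poweRy h; apply/integrableP; split.
  by apply/measurable_EFinP; exact: measurable_funX.
under eq_integral do rewrite /= ger0_norm ?sqr_ge0//.
by apply: h; rewrite invr_eq0.
Qed.

Let mpq (c1 c2 : R) : measurable_fun setT (fun x => (cfa G x - c1) ^+ 2 + (cfb G x - c2) ^+ 2).
Proof.
apply: measurable_funD; apply: measurable_funX; apply: measurable_funB => //.
  exact: la.1.
exact: lb.1.
Qed.

Let mq : measurable_fun setT (fun x => cfal G x ^+ 2 + cfbe G x ^+ 2).
Proof. by apply: measurable_funD; apply: measurable_funX; [exact: lal.1|exact: lbe.1]. Qed.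

Let mmod : measurable_fun setT (modulus G).
Proof.
have ms : measurable_fun setT (@Num.sqrt R) := continuous_measurable_fun (@sqrt_continuous R).
apply: (measurableT_comp ms); apply: measurable_funD; apply: measurable_funX.
  exact: la.1.
exact: lb.1.
Qed.

Lemma measurable_dist : measurable_fun setT (fun x => distSO2 (G x)).
Proof.
have ms : measurable_fun setT (@Num.sqrt R) := continuous_measurable_fun (@sqrt_continuous R).
have h : measurable_fun setT (fun x => 2 *
    ((modulus G x - 1) ^+ 2 + (cfal G x ^+ 2 + cfbe G x ^+ 2))).
  apply: measurable_funM => //; apply: measurable_funD; last exact: mq.
  by apply: measurable_funX; exact: measurable_funB.
apply: eq_measurable_fun (measurableT_comp ms h) => x _ /=.
by rewrite -distSO2_sqr sqrtr_sqr ger0_norm// distSO2_ge0.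
Qed.

Lemma measurable_frob_rot (c1 c2 : R) : measurable_fun setT (fun x => frob (G x - rotmx c1 c2)).
Proof.
have ms : measurable_fun setT (@Num.sqrt R) := continuous_measurable_fun (@sqrt_continuous R).
have h : measurable_fun setT (fun x => 2 *
    ((cfa G x - c1) ^+ 2 + (cfb G x - c2) ^+ 2 + (cfal G x ^+ 2 + cfbe G x ^+ 2))).
  by apply: measurable_funM => //; exact: measurable_funD.
apply: eq_measurable_fun (measurableT_comp ms h) => x _ /=.
by rewrite -frob_rot sqrtr_sqr ger0_norm// sqrtr_ge0.
Qed.

Let gap (a c d t1 t2 s1 s2 : R) : 0 <= t1 -> 0 <= t2 -> 0 <= s1 -> 0 <= s2 ->
  (c - d) ^+ 2 <= 2 * ((a - c) ^+ 2 + t1 + t2) + 2 * ((a - d) ^+ 2 + s1 + s2).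
Proof.
move=> h1 h2 h3 h4; have := sqr_ge0 ((a - c) + (a - d)).
have : (c - d) ^+ 2 + ((a - c) + (a - d)) ^+ 2 = 2 * (a - c) ^+ 2 + 2 * (a - d) ^+ 2 by ring.
by lra.
Qed.

(** If two rotations had finite norm, the constants (c1 - d1)^2 and (c2 - d2)^2 would be integrable
    over the plane. *)
Lemma rot_norm_fin_inj (Q S : 'M[R]_2) : SO2 Q -> SO2 S ->
  (rot_norm G Q < +oo)%E -> (rot_norm G S < +oo)%E -> Q = S.
Proof.
move=> /SO2P[c1 [c2 [_ ->]]] /SO2P[d1 [d2 [_ ->]]].
move=> /(integ_sqr _ (measurable_frob_rot c1 c2)) i1 /(integ_sqr _ (measurable_frob_rot d1 d2)) i2.
have i := integrableD measurableT i1 i2.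
have h (k : R) : (forall x, k ^+ 2 <= frob (G x - rotmx c1 c2) ^+ 2 + frob (G x - rotmx d1 d2) ^+ 2) ->
    k = 0.
  move=> H; apply/eqP; rewrite -sqrf_eq0; apply/eqP; apply: integ_cst_eq0.
  by apply: (integ_le _ _ _ _ i) => // x; rewrite sqr_ge0 H.
have e1 : c1 - d1 = 0.
  by apply: h => x; rewrite !frob_rot; apply: gap; rewrite ?addr_ge0 ?sqr_ge0.
have e2 : c2 - d2 = 0.
  apply: h => x; rewrite !frob_rot [X in 2 * (X + _)]addrC [X in _ + 2 * (X + _)]addrC.
  by apply: gap; rewrite ?addr_ge0 ?sqr_ge0.
by move/subr0_eq: e1 => ->; move/subr0_eq: e2 => ->.
Qed.

Hypothesis dG : distL2 G.

Let mdist := measurable_dist.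

Lemma integ_dist : integ (fun x => distSO2 (G x) ^+ 2).
Proof. by apply: integ_sqr => //; move: dG; rewrite /distL2 => /andP[_ /[!inE]]. Qed.

Let iq : integ (fun x => cfal G x ^+ 2 + cfbe G x ^+ 2).
Proof.
apply: (integ_le _ _ mq _ integ_dist) => x; rewrite addr_ge0 ?sqr_ge0//= distSO2_sqr.
have := sqr_ge0 (modulus G x - 1); have := sqr_ge0 (cfal G x); have := sqr_ge0 (cfbe G x).
by lra.
Qed.

Let id2 : integ (fun x => (modulus G x - 1) ^+ 2).
Proof.
apply: (integ_le _ _ _ _ integ_dist) => [|x].
  by apply: measurable_funX; exact: measurable_funB.
rewrite sqr_ge0/= distSO2_sqr.
have := sqr_ge0 (modulus G x - 1); have := sqr_ge0 (cfal G x); have := sqr_ge0 (cfbe G x).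
by lra.
Qed.

Let L1loc_half_sqr (f g h : plane R -> R) : L2loc f -> L2loc g -> measurable_fun setT h ->
  (forall x, h x ^+ 2 <= f x ^+ 2 + g x ^+ 2) -> L1loc (fun x => h x ^+ 2).
Proof.
move=> [mf lf] [mg lg] mh H; split; first exact: measurable_funX.
move=> B; have := integrableD (measurable_box B) (lf _ (compact_box B)) (lg _ (compact_box B)).
apply: le_integrable; first exact: measurable_box.
  by apply/measurable_EFinP; apply: measurable_funTS; exact: measurable_funX.
move=> x _ /=; rewrite lee_fin ger0_norm ?sqr_ge0// (le_trans (H x))//.
by rewrite ger0_norm// addr_ge0 ?sqr_ge0.
Qed.

(** The triangle inequality for |c| - 1 through |p|, squared. It bounds the constant (|c| - 1)^2 by
    an integrable function, which forces |c| = 1. *)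
Let unit_mod (a b c1 c2 : R) : (Num.sqrt (c1 ^+ 2 + c2 ^+ 2) - 1) ^+ 2 <=
  2 * ((a - c1) ^+ 2 + (b - c2) ^+ 2) + 2 * (Num.sqrt (a ^+ 2 + b ^+ 2) - 1) ^+ 2.
Proof.
have [r0 s0] := conj (sqrtr_ge0 (a ^+ 2 + b ^+ 2)) (sqrtr_ge0 (c1 ^+ 2 + c2 ^+ 2)).
have r2 := sqr_sqrtr (addr_ge0 (sqr_ge0 a) (sqr_ge0 b)).
have s2 := sqr_sqrtr (addr_ge0 (sqr_ge0 c1) (sqr_ge0 c2)).
move: (Num.sqrt _) (Num.sqrt _) r0 s0 r2 s2 => s r s0 r0 s2 r2.
have h : a * c1 + b * c2 <= r * s.
  apply: le_trans (ler_norm _) _; rewrite -(ler_pXn2r (n := 2)) ?nnegrE ?mulr_ge0//.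
  rewrite real_normK ?num_real// exprMn -subr_ge0.
  suff -> : r ^+ 2 * s ^+ 2 - (a * c1 + b * c2) ^+ 2 = (a * c2 - b * c1) ^+ 2 by exact: sqr_ge0.
  by rewrite r2 s2; ring.
have := sqr_ge0 ((s - r) - (r - 1)).
have e : ((s - r) - (r - 1)) ^+ 2 + (s - 1) ^+ 2 = 2 * (s ^+ 2 + r ^+ 2 - 2 * (r * s)) + 2 * (r - 1) ^+ 2.
  by ring.
have e2 : (a - c1) ^+ 2 + (b - c2) ^+ 2 = s ^+ 2 + r ^+ 2 - 2 * (a * c1 + b * c2).
  by rewrite r2 s2; ring.
by rewrite e2; lra.
Qed.

Lemma rigidity : exists2 Q, SO2 Q & (rot_norm G Q <= (Num.sqrt 2)%:E * dist_norm G)%E.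
Proof.
have [_ LG _] := uG.
have half (x y : R) : ((x + y) / 2) ^+ 2 <= x ^+ 2 + y ^+ 2.
  by have := sqr_ge0 x; have := sqr_ge0 y; have := sqr_ge0 (x - y); rewrite !expr2; lra.
have la2 : L1loc (fun x => cfa G x ^+ 2).
  by apply: (L1loc_half_sqr _ _ _ (LG 0 0) (LG 1 1) la.1) => x; exact: half.
have lb2 : L1loc (fun x => cfb G x ^+ 2).
  apply: (L1loc_half_sqr _ _ _ (LG 1 0) (LG 0 1) lb.1) => x.
  by rewrite -[G x 0 1 ^+ 2]sqrrN; exact: half.
have [c1 [c2 Hc]] := gradient_bound u G uG iq id2 la2 lb2.
have ip : integ (fun x => (cfa G x - c1) ^+ 2 + (cfb G x - c2) ^+ 2).
  apply/integrableP; split; first by apply/measurable_EFinP; exact: mpq.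
  under eq_integral do rewrite /= ger0_norm ?addr_ge0 ?sqr_ge0//.
  exact: le_lt_trans Hc (ltry _).
have hc : c1 ^+ 2 + c2 ^+ 2 = 1.
  have : (Num.sqrt (c1 ^+ 2 + c2 ^+ 2) - 1) ^+ 2 = 0.
    apply: integ_cst_eq0.
    apply: (integ_le _ _ _ _ (integrableD measurableT (integrableZl measurableT 2 ip)
      (integrableZl measurableT 2 id2))) => // x.
    by rewrite sqr_ge0; exact: unit_mod.
  move/eqP; rewrite sqrf_eq0 subr_eq0 => /eqP h.
  by rewrite -[LHS]sqr_sqrtr ?addr_ge0 ?sqr_ge0// h expr1n.
exists (rotmx c1 c2); first exact: SO2_rot.
apply: L2norm_le_sqrt2.
have fin1 := integrable_fin_num measurableT integ_dist.
have i1 := integrableD measurableT ip iq.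
have i2 := integrableD measurableT id2 iq.
have -> : (\int[leb2]_x (frob (G x - rotmx c1 c2) ^+ 2)%:E = (2 *
    (\int[leb2]_x ((cfa G x - c1) ^+ 2 + (cfb G x - c2) ^+ 2) +
     \int[leb2]_x (cfal G x ^+ 2 + cfbe G x ^+ 2)))%:E)%E.
  rewrite -(RintegralD measurableT ip iq) -(RintegralZl 2 measurableT i1) /Rintegral fineK.
    by apply: eq_integral => x _; rewrite frob_rot.
  exact: (integrable_fin_num measurableT (integrableZl measurableT 2 i1)).
have -> : (\int[leb2]_x (distSO2 (G x) ^+ 2)%:E = (2 * (\int[leb2]_x (modulus G x - 1) ^+ 2 +
     \int[leb2]_x (cfal G x ^+ 2 + cfbe G x ^+ 2)))%:E)%E.
  rewrite -(RintegralD measurableT id2 iq) -(RintegralZl 2 measurableT i2) /Rintegral fineK.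
    by apply: eq_integral => x _; rewrite distSO2_sqr.
  exact: (integrable_fin_num measurableT (integrableZl measurableT 2 i2)).
(* With P, Q and r the integrals of |p - c|^2, |q|^2 and (|p| - 1)^2, the claim is 2 (P + Q) <= 4 (r
   + Q), which follows from P <= Q and r >= 0. *)
rewrite -EFinM lee_fin.
have : \int[leb2]_x ((cfa G x - c1) ^+ 2 + (cfb G x - c2) ^+ 2) <=
     \int[leb2]_x (cfal G x ^+ 2 + cfbe G x ^+ 2).
  by rewrite -lee_fin {1}/Rintegral fineK//; exact: (integrable_fin_num measurableT ip).
have : 0 <= \int[leb2]_x (modulus G x - 1) ^+ 2 by apply: Rintegral_ge0 => x _; exact: sqr_ge0.
by lra.
Qed.

Lemma dist_norm_fin : (dist_norm G < +oo)%E.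
Proof. by move: dG; rewrite /distL2 => /andP[_ /[!inE]]. Qed.

Lemma dist_norm_eq0 : dist_norm G = 0%E -> {ae leb2, forall x, distSO2 (G x) = 0}.
Proof.
move=> h; have m : measurable_fun setT (EFin \o (fun x => distSO2 (G x))).
  exact/measurable_EFinP.
have p0 : (0 < 2%:E :> \bar R)%E by rewrite lte_fin.
have [A [mA A0 sA]] := Lnorm_eq0_eq0 m p0 h.
exists A; split => // x hx; apply: sA => /= h'; apply: hx.
by have := h' Logic.I => -[].
Qed.

(** Every other rotation has infinite norm, so the minimum is attained without any compactness
    argument. *)
Lemma rot_norm_min (Q : 'M[R]_2) : SO2 Q -> (rot_norm G Q < +oo)%E ->
  forall S, SO2 S -> (rot_norm G Q <= rot_norm G S)%E.
Proof.
move=> hQ fQ S hS; have [fS|fS] := ltP (rot_norm G S) +oo%E.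
  by rewrite (rot_norm_fin_inj _ _ hQ hS fQ fS).
exact: ltW (lt_le_trans fQ fS).
Qed.

End rigidity.

(** * Nearly optimal deformations *)

Section smooth_deformations.
Context {R : realType}.
Implicit Types (x y : plane R).

Lemma compact_inbox (K : set (R * R)) : compact K -> exists B, K `<=` box B.
Proof.
move=> /compact_bounded[M [_ HM]]; exists (M + 1) => x Kx.
have h : `|x| <= M + 1 by apply: (HM (M + 1)); rewrite ?ltrDl.
by move: h; rewrite prod_normE ge_max.
Qed.

Lemma continuous_L2loc (f : R * R -> R) : continuous f -> L2loc f.
Proof.
move=> cf; split; first exact: continuous_plane_measurable.
move=> K cK; have [B KB] := compact_inbox _ cK.
have mK : measurable (K : set (plane R)).
  rewrite -[K]setCK; apply: measurableC; apply: open_plane_measurable.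
  by apply: closed_openC; apply: compact_closed => //; exact: norm_hausdorff.
have c2 : continuous (fun x => f x ^+ 2) by move=> x; apply: (@continuousM _ _ f f x); exact: cf.
exact: (integrableS (measurable_box B) mK KB ((continuous_L1loc _ c2).2 B)).
Qed.

Lemma W12loc_C1 (u : plane R -> 'cV[R]_2) (G : plane R -> 'M[R]_2) :
  (forall i, continuous (fun x : R * R => u x i 0)) ->
  (forall i j, continuous (fun x : R * R => G x i j)) ->
  (forall i j (x : R * R), is_derive x (e_ j) (fun x => u x i 0) (G x i j)) -> W12loc u G.
Proof.
move=> cu cG du; split => [i|i j|i j phi [/(_ 1%N)[cphi dphi] cK]].
- exact: continuous_L2loc.
- exact: continuous_L2loc.
have [B KB] := compact_inbox _ cK; have [derphi [cdphi _]] := dphi j.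
apply: (@parts2 _ j (fun x => u x i 0) phi (fun x => G x i j) (fun x => 'D_(e_ j) phi x) B) => //.
move=> x; apply: contraNeq => phix; apply: KB; exact: subset_closure.
Qed.

(* The field of [beurling_multiplier] at the scales 1 and 4, for which all the
   mass of [zeta _ 4] lies where [zeta _ 1] vanishes. *)
Lemma gradient_field_energy : exists (f g fx fy gy : R * R -> R),
  [/\ [/\ continuous f, continuous g, continuous fx, continuous fy & continuous gy],
   (forall x, is_derive x (e_ 0) f (fx x)) /\ (forall x, is_derive x (e_ 1) f (fy x)),
   (forall x, is_derive x (e_ 0) g (fy x)) /\ (forall x, is_derive x (e_ 1) g (gy x)),
   [/\ bms fx, bms fy & bms gy] &
   0 < \int[leb2]_x (fx x + gy x) ^+ 2 /\
   \int[leb2]_x ((fx x - gy x) ^+ 2 + (2 * fy x) ^+ 2) = \int[leb2]_x (fx x + gy x) ^+ 2].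
Proof.
have l14 : 1 < 4 :> R by rewrite ltr1n.
have [m [m1 [m2 [B [[B0 m_out] [dm dm1] [sm sm1 sm2] KE]]]]] :=
  beurling_multiplier unit_mass _ _ (@ltr01 R) l14.
pose o := @origin R.
have c2 (f : R * R -> R) : smooth2 f -> continuous f by move=> sf; exact: (smooth_cont _ _ (sf 0%N)).
have [b1 b2 b3] := And3 (kern_bms _ o (kern_kux m m1 B B0 dm sm sm1 m_out))
  (kern_bms _ o (kern_kuy m m1 B B0 dm sm1 m_out)) (kern_bms _ o (kern_kvy m m1 B B0 dm sm sm1 m_out)).
exists (ku m o), (kv m o), (kux m m1 o), (kuy m1 o), (kvy m m1 o); split => //.
- split; apply: c2; [exact: smooth2_ku|exact: smooth2_kv|exact: smooth2_kux
    |exact: smooth2_kuy|exact: smooth2_kvy].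
- by split=> x; [exact: is_derive_ku m m1 dm o x 0|exact: is_derive_ku m m1 dm o x 1].
- by split=> x; [exact: is_derive_kv m m1 dm o x 0|exact: is_derive_kv m m1 dm o x 1].
pose Z x := kux m m1 o x + kvy m m1 o x.
have ZE x : Z x = zeta unit_mass 4 o x - zeta unit_mass 1 o x by exact: KE.
have bZ : bms Z := bmsD _ _ b1 b3.
have iZ : integ (fun x => Z x ^+ 2) := bms_integ _ (bms_mul _ _ bZ bZ).
split.
  have half0 : 0 <= 2^-1 :> R by rewrite invr_ge0.
  have ib := bms_integ _ (bms_indic_box (2^-1 : R)).
  have ib4 : integ (fun x => 4^-1 * \1_(box 2^-1) x) := integrableZl measurableT 4^-1 ib.
  have l4 : 0 < 4 :> R by [].
  have iS : integ (fun x => Z x ^+ 2 + 4^-1 * \1_(box 2^-1) x) := integrableD measurableT iZ ib4.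
  (* On the box of radius 1/2, of area 1, [zeta _ 1] vanishes, so there z = [zeta _ 4] equals Z, and
     z <= z^2 + 1/4. Outside the box [zeta _ 4] is zero. Integrating its unit mass gives an energy
     of at least 3/4. *)
  have h : 1 <= \int[leb2]_x (Z x ^+ 2 + 4^-1 * \1_(box 2^-1) x).
    rewrite -[leLHS](Rintegral_zeta 4 o l4); apply: (le_Rintegral measurableT).
    - exact: zeta_integ.
    - exact: iS.
    move=> x _; have [xB|xB] := boolP (inbox 2^-1 x); last first.
      have -> : zeta unit_mass 4 o x = 0.
        apply: zeta_out => //; apply: contra xB.
        by rewrite /near_box /dx /dy /= !subr0 (_ : 2 / 4 = 2^-1)//; field.
      by rewrite addr_ge0 ?sqr_ge0// mulr_ge0 ?invr_ge0// indicE.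
    have z0 : zeta unit_mass 1 o x = 0.
      rewrite /zeta cslope_eq0l ?mulr0// expr1n mul1r /sqd /dx /dy /= !subr0.
      have /andP[x1 x2] := xB.
      rewrite -(real_normK (num_real x.1)) -(real_normK (num_real x.2)).
      have := normr_ge0 x.1; have := normr_ge0 x.2; rewrite !expr2; nra.
    rewrite indicE mem_set// mulr1 ZE z0 subr0; move: (zeta _ _ _ _) => z.
    have := sqr_ge0 (z - 2^-1); rewrite !expr2; lra.
  have e : \int[leb2]_x (Z x ^+ 2 + 4^-1 * \1_(box 2^-1) x) = \int[leb2]_x Z x ^+ 2 + 4^-1.
    rewrite (RintegralD measurableT iZ ib4) (RintegralZl _ measurableT ib) Rintegral_indic_box//.
    by rewrite divff// expr1n mulr1.
  by move: h; rewrite e; lra.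
have bsg := bmsB _ _ b1 b3; have bta := bmsZ 2 _ b2.
have [i1 i2] := conj (bms_integ _ (bms_mul _ _ bsg bsg)) (bms_integ _ (bms_mul _ _ bta bta)).
have := energy_diag m m1 m2 B B0 dm dm1 sm sm1 sm2 m_out o o.
rewrite /Tr /ksg /kta /kZ -(RintegralD measurableT i1 i2) => E.
transitivity (\int[leb2]_x (Z x * Z x)); last by apply: eq_Rintegral => x _; rewrite expr2.
by rewrite -[RHS]E; apply: eq_Rintegral => x _; rewrite !expr2.
Qed.

End smooth_deformations.

Section optimality.
Context {R : realType}.
Implicit Types (u : plane R -> 'cV[R]_2) (G : plane R -> 'M[R]_2).

Lemma L2norm_fin (f : plane R -> R) : integ (fun x => f x ^+ 2) ->
  L2norm f = (Num.sqrt (\int[leb2]_x f x ^+ 2))%:E.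
Proof.
move=> i; rewrite L2normE -powR12_sqrt; last by apply: Rintegral_ge0 => x _; exact: sqr_ge0.
by rewrite -poweR_EFin /Rintegral fineK// (integrable_fin_num measurableT i).
Qed.

(** With w = (e z / 2)^2, sqrt (1 + w) - 1 <= w / 2 makes the first square at most w^2 / 4 = e^4 z^4
    / 64; the hypothesis on [e] absorbs one factor e^2 z^2 into 16 d. *)
Let dist_upper (e z d t M : R) : 0 <= t -> `|z| <= M -> e ^+ 2 * M ^+ 2 <= 16 * d ->
  2 * ((Num.sqrt (1 ^+ 2 + (e * z / 2) ^+ 2) - 1) ^+ 2 + t) <=
  2 * t + e ^+ 2 / 2 * d * z ^+ 2.
Proof.
move=> t0 zM eM; pose w := (e * z / 2) ^+ 2; have w0 : 0 <= w by exact: sqr_ge0.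
rewrite -/w; pose r := Num.sqrt (1 ^+ 2 + w).
have r2 : r ^+ 2 = 1 + w by rewrite sqr_sqrtr expr1n// addr_ge0.
have r1 : 1 <= r by rewrite -sqrtr1 ler_wsqrtr// expr1n lerDl.
rewrite -/r.
have h : (r - 1) ^+ 2 <= w ^+ 2 / 4.
  have h1 : 0 <= r - 1 by lra.
  have h2 : 2 * (r - 1) <= w.
    have : (r - 1) * (r + 1) = w by rewrite -subr_sqr r2; lra.
    by move=> <-; rewrite [leRHS]mulrC ler_wpM2r//; lra.
  have : (2 * (r - 1)) ^+ 2 <= w ^+ 2 by rewrite ler_pXn2r ?nnegrE// mulr_ge0.
  by rewrite exprMn; lra.
have z2 : z ^+ 2 <= M ^+ 2.
  by rewrite -(real_normK (num_real z)) ler_pXn2r ?nnegrE// (le_trans _ zM).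
have h3 : e ^+ 2 * z ^+ 2 <= 16 * d.
  by apply: le_trans eM; rewrite ler_wpM2l ?sqr_ge0.
have h4 : w ^+ 2 / 4 = e ^+ 2 * z ^+ 2 * (e ^+ 2 * z ^+ 2) / 64 by rewrite /w; field.
have h5 : e ^+ 2 * z ^+ 2 * (e ^+ 2 * z ^+ 2) <= 16 * d * (e ^+ 2 * z ^+ 2).
  by rewrite ler_wpM2r// mulr_ge0 ?sqr_ge0.
have h6 : e ^+ 2 / 2 * d * z ^+ 2 = 16 * d * (e ^+ 2 * z ^+ 2) / 32 by field.
by rewrite h6; rewrite h4 in h; lra.
Qed.

Let small_parameter (M d : R) : 0 < d -> exists2 e, 0 < e & e ^+ 2 * M ^+ 2 <= 16 * d.
Proof.
move=> d0; have M1 : 0 < M ^+ 2 + 1 by rewrite ltr_wpDl// sqr_ge0.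
pose e := Num.min 1 (16 * d / (M ^+ 2 + 1)).
have e0 : 0 < e by rewrite lt_min ltr01 divr_gt0// mulr_gt0.
exists e => //.
have e1 : e <= 1 by rewrite ge_min lexx.
have e2 : e * (M ^+ 2 + 1) <= 16 * d by rewrite -ler_pdivlMr// ge_min lexx orbT.
have e3 : e ^+ 2 * M ^+ 2 <= e * M ^+ 2.
  by rewrite ler_wpM2r ?sqr_ge0// expr2 ler_piMr// ltW.
by lra.
Qed.

(** The inequality amounts to (1 - d)^2 (1 + d) <= 1. *)
Let ratio (e E d D N : R) : 0 < d -> d < 1 -> 0 <= E ->
  D <= e ^+ 2 / 2 * (E + d * E) -> N = e ^+ 2 * E -> (Num.sqrt 2 * (1 - d)) ^+ 2 * D <= N.
Proof.
move=> d0 d1 E0 DE ->; rewrite exprMn sqr_sqrtr//.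
have h : 2 * (1 - d) ^+ 2 * D <= 2 * (1 - d) ^+ 2 * (e ^+ 2 / 2 * (E + d * E)).
  by rewrite ler_wpM2l// mulr_ge0 ?sqr_ge0.
apply: le_trans h _.
have -> : 2 * (1 - d) ^+ 2 * (e ^+ 2 / 2 * (E + d * E)) =
  e ^+ 2 * E - e ^+ 2 * E * (d * (1 + d * (1 - d))) by field.
have dd : 0 <= d * (1 - d) by rewrite mulr_ge0 ?subr_ge0// ltW.
have q : 0 <= d * (1 + d * (1 - d)) by rewrite mulr_ge0 ?addr_ge0// ltW.
by rewrite lerBlDr lerDl mulr_ge0// mulr_ge0// sqr_ge0.
Qed.

Let split_le (s t w : R) : 0 <= s -> t / 2 * w <= 2 * (s + t / 4 * w).
Proof. by move=> s0; lra. Qed.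

Lemma near_optimal (d : R) : 0 < d -> d < 1 -> exists u G,
  [/\ W12loc u G, distL2 G, ~ {ae leb2, forall x, distSO2 (G x) = 0},
    (rot_norm G (rotmx 1 0) < +oo)%E &
    ((Num.sqrt 2 * (1 - d))%:E * dist_norm G <= rot_norm G (rotmx 1 0))%E].
Proof.
move=> d0 d1.
have [f [g [fx [fy [gy [[cf cg cfx cfy cgy] [df0 df1] [dg0 dg1] [bx by_ bz] [E0 EE]]]]]]] :=
  @gradient_field_energy R.
have bZ := bmsD _ _ bx bz; have bW1 := bmsB _ _ bx bz; have bW2 := bmsZ 2 _ by_.
have [_ [M [b HM]]] := bZ.
have [e e0 eM] := small_parameter M d d0.
pose u (x : plane R) : 'cV[R]_2 := \col_i (if i == 0 then x.1 + - e * g x else x.2 + e * f x).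
pose G (x : plane R) : 'M[R]_2 := \matrix_(i, j)
  (if i == 0 then if j == 0 then 1 + - e * fy x else - e * gy x
   else if j == 0 then e * fx x else 1 + e * fy x).
have j2 (j : 'I_2) : j = 0 \/ j = 1.
  by case: j => -[|[|//]] ?; [left|right]; exact/val_inj.
have cZ (c : R) (h : R * R -> R) : continuous h -> continuous (fun x => c * h x).
  by move=> ch x; apply: (@continuousM _ _ (fun=> c) h x); [exact: cvg_cst|exact: ch].
have cD (h k : R * R -> R) : continuous h -> continuous k -> continuous (fun x => h x + k x).
  by move=> ch ck x; apply: (@continuousD _ _ _ h k x); [exact: ch|exact: ck].
have c1 : continuous (fun _ : R * R => 1 : R) by move=> x; exact: cvg_cst.
have uE i : (fun x => u x i 0) = if i == 0 then (fun x => x.1 + - e * g x) else (fun x => x.2 + e * f x).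
  by apply/funext => x; rewrite mxE; case: (i == 0).
have GE i j : (fun x => G x i j) = if i == 0
   then if j == 0 then (fun x => 1 + - e * fy x) else (fun x => - e * gy x)
   else if j == 0 then (fun x => e * fx x) else (fun x => 1 + e * fy x).
  by apply/funext => x; rewrite mxE; case: (i == 0); case: (j == 0).
have uG : W12loc u G.
  apply: W12loc_C1.
  - move=> i; rewrite uE; case: (i == 0).
      by apply: (cD fst); [move=> x; exact: cvg_fst|exact: cZ].
    by apply: (cD snd); [move=> x; exact: cvg_snd|exact: cZ].
  - move=> i j; rewrite GE; case: (i == 0); case: (j == 0); do ?exact: cZ.
      by apply: (cD (fun=> 1)) => //; exact: cZ.
    by apply: (cD (fun=> 1)) => //; exact: cZ.
  - move=> i j x; rewrite uE mxE.
    have dgj : is_derive x (e_ j) g (if j == 0 then fy x else gy x).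
      have [->|->] := j2 j.
        exact: dg0.
      exact: dg1.
    have dfj : is_derive x (e_ j) f (if j == 0 then fx x else fy x).
      have [->|->] := j2 j.
        exact: df0.
      exact: df1.
    case: (i == 0).
      apply: (is_derive_eq (is_derive_addf _ _ _ _ _ _ (is_derive_fst x (e_ j))
        (is_derive_mulf _ _ _ _ _ _ (is_derive_cstf (- e) x (e_ j)) dgj))).
      by rewrite /e_; case: (j == 0) => /=; ring.
    apply: (is_derive_eq (is_derive_addf _ _ _ _ _ _ (is_derive_snd x (e_ j))
      (is_derive_mulf _ _ _ _ _ _ (is_derive_cstf e x (e_ j)) dfj))).
    by rewrite /e_; case: (j == 0) => /=; ring.
pose Z x := fx x + gy x; pose W x := (fx x - gy x) ^+ 2 + (2 * fy x) ^+ 2.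
have W0 x : 0 <= W x by rewrite addr_ge0 ?sqr_ge0.
have aE x : cfa G x = 1 by rewrite /cfa !mxE /=; field.
have bE x : cfb G x = e * Z x / 2 by rewrite /cfb /Z !mxE /=; field.
have qE x : cfal G x ^+ 2 + cfbe G x ^+ 2 = e ^+ 2 / 4 * W x.
  by rewrite /cfal /cfbe /W !mxE /=; field.
have iZ : integ (fun x => Z x ^+ 2) := bms_integ _ (bms_mul _ _ bZ bZ).
have iW : integ W.
  exact: (integrableD measurableT (bms_integ _ (bms_mul _ _ bW1 bW1)) (bms_integ _ (bms_mul _ _ bW2 bW2))).
have {}EE : \int[leb2]_x W x = \int[leb2]_x Z x ^+ 2 by [].
have {}E0 : 0 < \int[leb2]_x Z x ^+ 2 by [].
have frobE x : frob (G x - rotmx 1 0) ^+ 2 = e ^+ 2 / 2 * (Z x ^+ 2 + W x).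
  by rewrite frob_rot aE bE qE; field.
have distE x : distSO2 (G x) ^+ 2 =
    2 * ((Num.sqrt (1 ^+ 2 + (e * Z x / 2) ^+ 2) - 1) ^+ 2 + e ^+ 2 / 4 * W x).
  by rewrite distSO2_sqr /modulus aE bE qE.
have iZW : integ (fun x => e ^+ 2 / 2 * (Z x ^+ 2 + W x)) :=
  integrableZl measurableT (e ^+ 2 / 2) (integrableD measurableT iZ iW).
have idZ : integ (fun x => d * Z x ^+ 2) := integrableZl measurableT d iZ.
have iWd : integ (fun x => e ^+ 2 / 2 * (W x + d * Z x ^+ 2)) :=
  integrableZl measurableT (e ^+ 2 / 2) (integrableD measurableT iW idZ).
have ifrob : integ (fun x => frob (G x - rotmx 1 0) ^+ 2).
  by move: iZW; congr integ; apply/funext => x; rewrite frobE.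
have Nfrob : \int[leb2]_x frob (G x - rotmx 1 0) ^+ 2 = e ^+ 2 * \int[leb2]_x Z x ^+ 2.
  transitivity (\int[leb2]_x (e ^+ 2 / 2 * (Z x ^+ 2 + W x))).
    by apply: eq_Rintegral => x _; exact: frobE.
  rewrite (RintegralZl _ measurableT (integrableD measurableT iZ iW)) (RintegralD measurableT iZ iW) EE.
  by field.
have q4 x : 0 <= e ^+ 2 / 4 * W x by rewrite mulr_ge0// divr_ge0// sqr_ge0.
have dist_le x : distSO2 (G x) ^+ 2 <= e ^+ 2 / 2 * (W x + d * Z x ^+ 2).
  rewrite distE; apply: le_trans (dist_upper _ _ _ _ _ (q4 x) (HM x).1 eM) _.
  by rewrite le_eqVlt; apply/orP; left; apply/eqP; rewrite /Z; field.
have dist_ge x : e ^+ 2 / 2 * W x <= distSO2 (G x) ^+ 2.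
  by rewrite distE; apply: split_le; exact: sqr_ge0.
have mdist := measurable_dist u G uG.
have idist : integ (fun x => distSO2 (G x) ^+ 2).
  move: iWd; apply: le_integrable => //; first by apply/measurable_EFinP; exact: measurable_funX.
  by move=> x _ /=; rewrite lee_fin ger0_norm ?sqr_ge0// (le_trans (dist_le x))// ler_norm.
have Dle : \int[leb2]_x distSO2 (G x) ^+ 2 <=
    e ^+ 2 / 2 * (\int[leb2]_x Z x ^+ 2 + d * \int[leb2]_x Z x ^+ 2).
  rewrite -{1}EE -(RintegralZl d measurableT iZ) -(RintegralD measurableT iW idZ).
  rewrite -(RintegralZl _ measurableT (integrableD measurableT iW idZ)).
  exact: (le_Rintegral measurableT idist iWd).
have Dge : e ^+ 2 / 2 * \int[leb2]_x Z x ^+ 2 <= \int[leb2]_x distSO2 (G x) ^+ 2.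
  rewrite -EE -(RintegralZl _ measurableT iW).
  exact: (le_Rintegral measurableT (integrableZl measurableT (e ^+ 2 / 2) iW) idist).
exists u, G; split => //.
- rewrite /distL2; apply/andP; split; rewrite inE//.
  suff : (L2norm (fun x => distSO2 (G x)) < +oo)%E by [].
  by rewrite L2norm_fin// ltry.
- move=> [A [mA A0 sA]].
  have : (\int[leb2]_x `|(distSO2 (G x) ^+ 2)%:E| = 0)%E.
    apply/(ae_eq_integral_abs leb2 measurableT); first exact: (measurable_int _ idist).
    exists A; split => // x h; apply: sA => /= h'; apply: h => _ /=.
    by rewrite h' expr0n.
  move=> h; have : 0 < e ^+ 2 / 2 * \int[leb2]_x Z x ^+ 2.
    by rewrite mulr_gt0// divr_gt0// exprn_gt0.
  apply/negP; rewrite -leNgt; apply: le_trans Dge _.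
  rewrite (_ : \int[leb2]_x distSO2 (G x) ^+ 2 = 0)//.
  rewrite /Rintegral -[RHS](congr1 fine h); congr (fine _); apply: eq_integral => x _.
  by rewrite gee0_abs// lee_fin sqr_ge0.
- by rewrite /rot_norm L2norm_fin// ltry.
rewrite /rot_norm /dist_norm !L2norm_fin// -EFinM lee_fin.
have k0 : 0 <= Num.sqrt 2 * (1 - d) by rewrite mulr_ge0 ?sqrtr_ge0// subr_ge0 ltW.
rewrite -[X in X * _](ger0_norm k0) -sqrtr_sqr -sqrtrM ?sqr_ge0// ler_wsqrtr//.
exact: (ratio _ _ _ _ _ d0 d1 (ltW E0) Dle Nfrob).
Qed.

End optimality.

(** The quotients defining [kappa_nl] are thus divisions by a positive real, and the conventions of
    [\bar R] for division by 0 or [+oo] never intervene. *)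
Lemma dist_norm_pos (R : realType) (u : plane R -> 'cV[R]_2) (G : plane R -> 'M[R]_2) :
  W12loc u G -> distL2 G -> ~ {ae leb2, forall x, distSO2 (G x) = 0} ->
  exists2 D : R, 0 < D & dist_norm G = D%:E.
Proof.
move=> uG dG nae; have D0 : (0 <= dist_norm G)%E by exact: Lnorm_ge0.
have Dfin : dist_norm G \is a fin_num by rewrite ge0_fin_numE// dist_norm_fin.
exists (fine (dist_norm G)); last by rewrite fineK.
rewrite lt_neqAle fine_ge0// andbT eq_sym fine_eq0//; apply/eqP => h.
exact: nae (dist_norm_eq0 u G uG h).
Qed.

Theorem theorem1p5 (R : realType) :
  kappa_nl R = (Num.sqrt 2)%:E /\
  forall (u : plane R -> 'cV[R]_2) (G : plane R -> 'M[R]_2),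
    W12loc u G -> distL2 G ->
    exists2 m, is_minimum [set rot_norm G Q | Q in SO2] m &
               (m <= (Num.sqrt 2)%:E * dist_norm G)%E.
Proof.
split; last first.
  move=> u G uG dG; have [Q hQ hle] := rigidity u G uG dG.
  have fQ : (rot_norm G Q < +oo)%E.
    apply: le_lt_trans hle _; apply: lte_mul_pinfty; rewrite ?lee_fin ?sqrtr_ge0//.
    exact: dist_norm_fin.
  exists (rot_norm G Q) => //; split; first by exists Q.
  by move=> _ [S hS <-]; exact: (rot_norm_min u G uG).
apply/eqP; rewrite eq_le; apply/andP; split.
  apply: ge_ereal_sup => m [u [G [uG dG nae [_ mlb]]]].
  have [D D0 DE] := dist_norm_pos _ _ _ uG dG nae.
  have [Q hQ hle] := rigidity u G uG dG.
  apply: le_trans (mlb _ (ex_intro2 _ _ Q hQ erefl)) _.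
  by rewrite DE inver gt_eqF// lee_pdivrMr// -DE.
apply/lee_addgt0Pr => e e0.
have s0 : 0 < Num.sqrt 2 :> R by rewrite sqrtr_gt0.
(* The relative loss d costs sqrt 2 times d, at most e; the bound 1/2 keeps d below 1, as
   [near_optimal] requires. *)
pose d := Num.min 2^-1 (e / Num.sqrt 2).
have d0 : 0 < d by rewrite lt_min invr_gt0 ltr0n divr_gt0.
have d1 : d < 1 by rewrite gt_min invf_lt1// ltr1n.
have de : Num.sqrt 2 * d <= e by rewrite mulrC -ler_pdivlMr// ge_min lexx orbT.
have [u [G [uG dG nae fI hI]]] := near_optimal d d0 d1.
have [D D0 DE] := dist_norm_pos _ _ _ uG dG nae.
have I1 : SO2 (rotmx 1 0 : 'M[R]_2) by apply: SO2_rot; ring.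
apply: (@le_trans _ _ ((Num.sqrt 2 * (1 - d))%:E + e%:E)%E).
  by rewrite -EFinD lee_fin mulrBr mulr1; lra.
apply: leeD => //; apply: (@le_trans _ _ (rot_norm G (rotmx 1 0) / dist_norm G)%E).
  by rewrite DE inver gt_eqF// lee_pdivlMr// -DE.
(* The identity has finite norm, hence it is the minimising rotation, and its quotient is itself a
   member of the set whose supremum is taken. *)
apply: ereal_sup_ubound; exists u, G; split => //; split; first by exists (rotmx 1 0).
move=> _ [S hS <-]; rewrite DE inver gt_eqF//; apply: lee_wpmul2r.
  by rewrite lee_fin invr_ge0 ltW.
exact: (rot_norm_min u G uG).
Qed.
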